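(* Let $F_n$ be a free group of finite rank and $\mathbb{A}$ a finitely generated abelian group. Let $\mathcal{H}_1,\mathcal{H}_2$ be two finitely generated subgroups of $F_n\times\mathbb{A}$ given by finite sets of generators. Then $\mathcal{H}_1\cap\mathcal{H}_2$ has a recursive basis, which can be effectively computed (that is, from the given generating sets one can compute an algorithm deciding membership of elements of $F_n\times\mathbb{A}$ in a certain basis of $\mathcal{H}_1\cap\mathcal{H}_2$).
   Context: Elements of $F_n\times\mathbb{A}$ are written $w\,t^{\mathbf a}$ ($w\in F_n$, $\mathbf a\in\mathbb{A}$, $\mathbb{A}$ additive); $\pi\colon w\,t^{\mathbf a}\mapsto w$. An abelian basis of a finitely generated abelian group is a generating set of the smallest possible cardinality. A basis of a subgroup $\mathcal{H}\leqslant F_n\times\mathbb{A}$ is a generating set of $\mathcal{H}$ of the form $\{u_1t^{\mathbf a_1},u_2t^{\mathbf a_2},\dots;\ t^{\mathbf b_1},\dots,t^{\mathbf b_q}\}$ where $\{u_1,u_2,\dots\}$ is a (finite or countably infinite) free basis of $\mathcal{H}\pi$, the $\mathbf a_i\in\mathbb{A}$, and $\{\mathbf b_1,\dots,\mathbf b_q\}$ is an abelian basis of $\mathcal{H}\cap\mathbb{A}$. A subset of $F_n\times\mathbb{A}$ is recursive if membership in it is algorithmically decidable. *)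

(* Defs.v *)
From HB Require Import structures.
From Stdlib Require Cantor.
From mathcomp Require Import all_boot all_order all_algebra.
From mathcomp Require Import boolp classical_sets.

Set Implicit Arguments.
Unset Strict Implicit.
Unset Printing Implicit Defensive.

Local Open Scope classical_set_scope.
Local Open Scope group_scope.

Definition subgroup_gen (G : groupType) (X : set G) : set G :=
  smallest (fun S : set G => group_closed [in S]) X.

(* A word is a list of letters (y, e) standing for y^-1 if e = true and for y
   if e = false. *)
Definition reduced (Y : eqType) (w : seq (Y * bool)) : bool :=
  sorted (fun p q => (p.1 == q.1) ==> (p.2 == q.2)) w.

Definition word_val (Y : Type) (G : groupType) (v : Y -> G)
    (w : seq (Y * bool)) : G :=
  \prod_(p <- w) (if p.2 then (v p.1)^-1 else v p.1).

Definition free_basis (G : groupType) (U K : set G) : Prop :=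
  subgroup_gen U = K /\
  forall w : seq (G * bool), w <> [::] -> reduced w ->
    (forall p, p \in w -> U p.1) -> word_val id w <> 1.

(* [Algebra.to_multiplicative A] is A with its addition written multiplicatively, so
   that the product of the group F and the additive group A is the library's
   direct product of groups; w t^a is the pair (w, a). *)
Notation "F \x_t A" := (F * Algebra.to_multiplicative A)%type (at level 40).

(* The least length of a generating list is the least cardinality of a finite
   generating set, and a list of least length has no repetition. *)
Definition abelian_basis (A : zmodType) (b : seq A) (L : set A) : Prop :=
  @subgroup_gen (Algebra.to_multiplicative A) [set` b] = L /\
  forall c : seq A, @subgroup_gen (Algebra.to_multiplicative A) [set` c] = L ->
    (size b <= size c)%N.

(* Countability of U is not required: it is automatic when F is finitely
   generated. *)
Definition is_basis (F : groupType) (A : zmodType) (H B : set (F \x_t A)) :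
    Prop :=
  exists (U : set F) (al : F -> A) (b : seq A),
    [/\ free_basis U [set g.1 | g in H],
        abelian_basis b [set c : A | H (1, c)],
        B = [set ((u, al u) : F \x_t A) | u in U] `|`
            [set ((1, c) : F \x_t A) | c in [set` b]]
      & subgroup_gen B = H].

(* Partial recursive functions, as unary functions on nat with Cantor's
   pairing. *)
Definition cpair (x y : nat) : nat := Cantor.to_nat (x, y).

Inductive prog : Type :=
  | PZero | PSucc | PFst | PSnd
  | PPair of prog & prog
  | PComp of prog & prog
  | PRec of prog & prog
  | PMu of prog.

(* [evals P x y]: the program P halts on the input x with the output y. *)
Inductive evals : prog -> nat -> nat -> Prop :=
  | ev_zero x : evals PZero x 0%N
  | ev_succ x : evals PSucc x x.+1
  | ev_fst x y : evals PFst (cpair x y) x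
  | ev_snd x y : evals PSnd (cpair x y) y
  | ev_pair P Q x y z :
      evals P x y -> evals Q x z -> evals (PPair P Q) x (cpair y z)
  | ev_comp P Q x y z :
      evals Q x y -> evals P y z -> evals (PComp P Q) x z
  | ev_rec0 P Q x y : evals P x y -> evals (PRec P Q) (cpair x 0%N) y
  | ev_recS P Q x k r y :
      evals (PRec P Q) (cpair x k) r -> evals Q (cpair x (cpair k r)) y ->
      evals (PRec P Q) (cpair x k.+1) y
  | ev_mu P x k (v : nat -> nat) :
      evals P (cpair x k) 0%N ->
      (forall j, (j < k)%N -> evals P (cpair x j) (v j).+1) ->
      evals (PMu P) x k.

Fixpoint prog_code (P : prog) : nat :=
  match P with
  | PZero => cpair 0 0
  | PSucc => cpair 1 0
  | PFst => cpair 2 0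
  | PSnd => cpair 3 0
  | PPair Q R => cpair 4 (cpair (prog_code Q) (prog_code R))
  | PComp Q R => cpair 5 (cpair (prog_code Q) (prog_code R))
  | PRec Q R => cpair 6 (cpair (prog_code Q) (prog_code R))
  | PMu Q => cpair 7 (prog_code Q)
  end.

(* An element of F \x_t A is presented to a program by a word in the fixed
   basis of F and a vector of integer coordinates in the fixed generators
   of A. *)
Definition presentation (n m : nat) : Type :=
  (seq ('I_n * bool) * m.-tuple int)%type.

Definition elem (n m : nat) (F : groupType) (x : 'I_n -> F) (A : zmodType)
    (a : 'I_m -> A) (r : presentation n m) : F \x_t A :=
  (word_val x r.1, \sum_(i < m) a i *~ tnth r.2 i)%R.

Definition seq_code (T : Type) (e : T -> nat) (s : seq T) : nat :=
  foldr (fun y c => (cpair (e y) c).+1) 0%N s.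

Definition letter_code (n : nat) (p : 'I_n * bool) : nat :=
  cpair (p.1 : nat) (p.2 : nat).

Definition int_code (z : int) : nat :=
  match z with Posz k => k.*2 | Negz k => k.*2.+1 end.

Definition pres_code (n m : nat) (r : presentation n m) : nat :=
  cpair (seq_code (@letter_code n) r.1) (seq_code int_code r.2).

Definition decides (n m : nat) (F : groupType) (x : 'I_n -> F) (A : zmodType)
    (a : 'I_m -> A) (D : prog) (B : set (F \x_t A)) : Prop :=
  forall r : presentation n m,
    (B (elem x a r) -> evals D (pres_code r) 1%N) /\
    (~ B (elem x a r) -> evals D (pres_code r) 0%N).

(* Main.v *)
From HB Require Import structures.
From Stdlib Require Cantor.
Require Import Defs.
From mathcomp Require Import all_boot all_order all_algebra.
From mathcomp Require Import boolp classical_sets.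
From mathcomp Require Import zify.

(** A recursive basis of the intersection of two finitely generated subgroups
    H1 and H2 of F x A, with F free and A abelian.

    The intersection H need not be finitely generated, and neither need its
    projection K to F. Still, membership in K is decidable, and this is enough
    for a recursive free basis of K. In each left coset of K take the word with
    the least code. The code of a list increases with the code of its tail, so
    these words form a Schreier transversal ([rep_tail]), and they are found by
    unbounded search. The Schreier generators attached to this transversal
    freely generate K: reading a word of F letter by letter and recording the
    generators that are crossed turns a product of generators back into the
    formal word in them ([schreier_free_basis]). The same process shows that a
    basis element is crossed somewhere along each word that represents it, so a
    bounded search decides membership in the basis ([schreier_basisP]). Finally
    each basis element is lifted to H by a search, and an abelian basis of the
    intersection of H with A is added.

    What has to be decided thus reduces to two questions on one finitely
    generated subgroup <S> of F x A, uniformly in S: which elements lie in it,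
    and which elements of A generate its abelian part. No algorithm is followed
    step by step: a predicate and its negation are both shown to be
    semidecidable by finite certificates, and the choice of a value in a total
    semidecidable relation is an unbounded search ([post], [uniformize]).

    - Membership in <S> is certified by a product of generators. A certificate
      for non-membership is a folded graph, a finite part of the coset graph of
      the projection of <S> to F, whose edges carry labels in A modulo a list b
      of elements of A. When all the generators label loops at the base point,
      so do all the elements of <S>. If b generates the abelian part of <S>,
      such a graph proves that it does ([abelian_part]), and by following one
      more word along the graph one refutes membership
      ([dec_gen_free_abelian]).
    - The group A is replaced by Z^m, after adding to all lists of generators a
      fixed list of generators of the kernel of Z^m -> A. In Z^m everything
      follows from one step of elimination: a subgroup of Z x G is generated by
      its elements over 0 and one more element ([kernel_step]). Iterating, one
      computes generators of the kernel of a projection from Z^m x G to Z^m,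
      which gives membership ([dec_gen_zpow]) and intersections
      ([zpow_intersection]).
    - An element w of F fails to lie in K exactly when it fails to lie in the
      projection of H2, or when some (w, v) in H2 does not lie in the product
      of H1 with the abelian part of H2 ([dec_inter_proj]).
    - A generating list of a finitely generated abelian group has the least
      possible length if some prime divides all the coefficients of all the
      relations between its entries, and a list of this kind always exists
      ([divisible_minimal], [divisible_exists]). Divisibility is expressed by
      finitely many membership tests ([independent_mod]).

    The resulting decision procedure takes the lists of generators as a
    parameter, and fixing a parameter in a program is a computable operation on
    its code ([parametrize]). *)

Set Implicit Arguments.
Unset Strict Implicit.
Unset Printing Implicit Defensive.

(** * Codes *)

(** Codes are bijections with nat. Each natural number is then a valid input of
    each program, and decoding is computed by the identity. *)
HB.mixin Record isCoded T := {
  code : T -> nat;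
  decode : nat -> T;
  codeK : cancel code decode;
  decodeK : cancel decode code }.

#[short(type="codedType")]
HB.structure Definition Coded := {T of isCoded T & Equality T}.

Lemma code_inj (X : codedType) : injective (code : X -> nat).
Proof. exact: can_inj codeK. Qed.

Definition uncpair (k : nat) : nat * nat := Cantor.of_nat k.

Arguments cpair : simpl never.
Arguments uncpair : simpl never.

Lemma cpairK x y : uncpair (cpair x y) = (x, y).
Proof. exact: Cantor.cancel_of_to. Qed.

Lemma uncpairK k : cpair (uncpair k).1 (uncpair k).2 = k.
Proof.
by rewrite /cpair -[RHS]Cantor.cancel_to_of /uncpair; case: (Cantor.of_nat k).
Qed.

Lemma cpair_ge x y : x + y <= cpair x y.
Proof. by have := Cantor.to_nat_non_decreasing x y; rewrite /cpair; lia. Qed.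

HB.instance Definition _ :=
  @isCoded.Build nat id id (fun _ => erefl) (fun _ => erefl).

Section PairCode.
Variables X Y : codedType.
Definition pair_code (p : X * Y) := cpair (code p.1) (code p.2).
Definition pair_decode k : X * Y :=
  (decode (uncpair k).1, decode (uncpair k).2).
Lemma pair_codeK : cancel pair_code pair_decode.
Proof. by case=> x y; rewrite /pair_decode cpairK /= !codeK. Qed.
Lemma pair_decodeK : cancel pair_decode pair_code.
Proof. by move=> k; rewrite /pair_code /= !decodeK uncpairK. Qed.
HB.instance Definition _ := @isCoded.Build (X * Y)%type _ _ pair_codeK pair_decodeK.
End PairCode.

Section SeqCode.
Variable X : codedType.

Fixpoint seq_decode_rec (fuel k : nat) : seq X :=
  if fuel is f.+1 then
    if k is k'.+1 then
      decode (uncpair k').1 :: seq_decode_rec f (uncpair k').2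
    else [::]
  else [::].
Definition seq_decode k := seq_decode_rec k k.

Lemma seq_codeK : cancel (seq_code (@code X)) seq_decode.
Proof.
move=> s; rewrite /seq_decode; move: (leqnn (seq_code code s)).
move: {2 3}(seq_code _ _) => f; elim: s f => [[|f]|y s IH [|f]] //=.
rewrite ltnS cpairK /= codeK => le_f; rewrite IH //.
by apply: leq_trans le_f; have := cpair_ge (code y) (seq_code code s); lia.
Qed.

Lemma seq_decodeK : cancel seq_decode (seq_code (@code X)).
Proof.
move=> k; rewrite /seq_decode; move: (leqnn k); move: {2 3}k => f.
elim: f k => [[|k]|f IH [|k]] //= le_f; rewrite decodeK IH ?uncpairK //.
by have := cpair_ge (uncpair k).1 (uncpair k).2; rewrite uncpairK; lia.
Qed.

HB.instance Definition _ := @isCoded.Build (seq X) _ _ seq_codeK seq_decodeK.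
End SeqCode.

Definition int_decode k : int := if odd k then Negz k./2 else Posz k./2.

Lemma int_codeK : cancel int_code int_decode.
Proof.
by case=> k; rewrite /int_decode /= ?oddS odd_double /= ?uphalf_double ?doubleK.
Qed.

Lemma int_decodeK : cancel int_decode int_code.
Proof.
move=> k; rewrite /int_decode -[RHS]odd_double_half.
by case: (odd k).
Qed.

HB.instance Definition _ := @isCoded.Build int _ _ int_codeK int_decodeK.

Lemma code_nat (k : nat) : code k = k. Proof. by []. Qed.
Lemma code_pair (X Y : codedType) (x : X) (y : Y) :
  code (x, y) = cpair (code x) (code y).
Proof. by []. Qed.
Lemma code_cons (X : codedType) (x : X) s : code (x :: s) = (code (x, s)).+1.
Proof. by []. Qed.

(** * Computable functions *)

Definition computable (X Y : codedType) (f : X -> Y) : Prop :=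
  exists P, forall x, evals P (code x) (code (f x)).

Fixpoint const_prog (c : nat) : prog :=
  if c is c'.+1 then PComp PSucc (const_prog c') else PZero.

Lemma evals_const c x : evals (const_prog c) x c.
Proof.
elim: c => [|c IH]; first exact: ev_zero.
exact: ev_comp IH (ev_succ c).
Qed.

Definition id_prog := PPair PFst PSnd.

Lemma evals_id x : evals id_prog x x.
Proof.
rewrite -[x]uncpairK; exact: ev_pair (ev_fst _ _) (ev_snd _ _).
Qed.

Section Closure.
Variables X Y Z : codedType.

Lemma eq_computable (f g : X -> Y) : f =1 g -> computable f -> computable g.
Proof. by move=> eq_fg [P HP]; exists P => x; rewrite -eq_fg. Qed.

(** Programs act on codes only, so a change of type that keeps the code costs
    nothing. *)
Lemma computable_of_code (f : X -> Y) :
  (forall x, code (f x) = code x) -> computable f.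
Proof. by move=> eq_f; exists id_prog => x; rewrite eq_f; apply: evals_id. Qed.

Lemma computable_const (y : Y) : computable (fun _ : X => y).
Proof. by exists (const_prog (code y)) => x; apply: evals_const. Qed.

Lemma computable_comp (f : Y -> Z) (g : X -> Y) :
  computable f -> computable g -> computable (fun x => f (g x)).
Proof.
by move=> [P HP] [Q HQ]; exists (PComp P Q) => x; apply: ev_comp (HQ x) (HP _).
Qed.

Lemma computable_pair (f : X -> Y) (g : X -> Z) :
  computable f -> computable g -> computable (fun x => (f x, g x)).
Proof.
by move=> [P HP] [Q HQ]; exists (PPair P Q) => x; apply: ev_pair (HP x) (HQ x).
Qed.

Lemma computable_fst (f : X -> Y * Z) :
  computable f -> computable (fun x => (f x).1).
Proof.
move=> [P HP]; exists (PComp PFst P) => x; apply: ev_comp (HP x) _.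
by case: (f x) => y z; apply: ev_fst.
Qed.

Lemma computable_snd (f : X -> Y * Z) :
  computable f -> computable (fun x => (f x).2).
Proof.
move=> [P HP]; exists (PComp PSnd P) => x; apply: ev_comp (HP x) _.
by case: (f x) => y z; apply: ev_snd.
Qed.

End Closure.

Lemma computable_id (X : codedType) : computable (fun x : X => x).
Proof. exact: computable_of_code. Qed.

Lemma computable_code (X Y : codedType) (f : X -> Y) :
  computable f -> computable (fun x => code (f x)).
Proof. by apply: (computable_comp (f := code)); apply: computable_of_code. Qed.

Lemma computable_decode (X Y : codedType) (f : X -> nat) :
  computable f -> computable (fun x => decode (f x) : Y).
Proof.
apply: (computable_comp (f := decode)); apply: computable_of_code => k.
by rewrite decodeK.
Qed.

Lemma computable_succ (X : codedType) (f : X -> nat) :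
  computable f -> computable (fun x => (f x).+1).
Proof.
by apply: (computable_comp (f := S)); exists PSucc => k; apply: ev_succ.
Qed.

Lemma computable_rec (X R : codedType) (h0 : X -> R) (hS : X -> nat -> R -> R)
    (n : X -> nat) :
  computable h0 -> computable (fun p : X * (nat * R) => hS p.1 p.2.1 p.2.2) ->
  computable n -> computable (fun x => nat_rect (fun=> R) (h0 x) (hS x) (n x)).
Proof.
move=> [P HP] [Q HQ] [N HN].
exists (PComp (PRec P Q) (PPair id_prog N)) => x.
apply: (ev_comp (y := cpair (code x) (n x))).
  exact: ev_pair (evals_id _) (HN x).
elim: (n x) => [|k IH] /=; first exact: ev_rec0 (HP x).
exact: ev_recS IH (HQ (x, (k, _))).
Qed.

Lemma computable_iter (X R : codedType) (f : X -> R -> R) (g : X -> R)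
    (n : X -> nat) :
  computable (fun p : X * R => f p.1 p.2) -> computable g -> computable n ->
  computable (fun x => iter (n x) (f x) (g x)).
Proof.
move=> Cf Cg Cn.
apply: (eq_computable (f := fun x => nat_rect (fun=> R) (g x)
   (fun k r => f x r) (n x))).
  by move=> x; elim: (n x) => //= k ->.
apply: computable_rec => //.
apply: (computable_comp (f := fun p : X * R => f p.1 p.2)
                        (g := fun p => (p.1, p.2.2))) => //.
apply: computable_pair; first exact/computable_fst/computable_id.
exact/computable_snd/computable_snd/computable_id.
Qed.

Lemma computable_pred (X : codedType) (f : X -> nat) :
  computable f -> computable (fun x => (f x).-1).
Proof.
move=> Cf; apply: (eq_computable (f := fun x => nat_rect (fun=> nat) 0
   (fun k _ => k) (f x))).
  by move=> x; case: (f x).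
apply: computable_rec => //; first exact: computable_const.
exact/computable_fst/computable_snd/computable_id.
Qed.

(** The conditional is a primitive recursion on the truth value. Both branches
    may be evaluated, as they are total. *)
Lemma computable_if_nat (X Y : codedType) (b : X -> bool) (f g : X -> Y) :
  computable (fun x => b x : nat) -> computable f -> computable g ->
  computable (fun x => if b x then f x else g x).
Proof.
move=> Cb Cf Cg.
apply: (eq_computable (f := fun x => nat_rect (fun=> Y) (g x)
   (fun _ _ => f x) (b x : nat))).
  by move=> x; case: (b x).
apply: computable_rec => //; apply: computable_comp => //.
exact/computable_fst/computable_id.
Qed.

Lemma computable_add (X : codedType) (f g : X -> nat) :
  computable f -> computable g -> computable (fun x => f x + g x).
Proof.
move=> Cf Cg.
apply: (eq_computable (f := fun x => iter (f x) S (g x))).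
  by move=> x /=; elim: (f x) => //= k ->.
apply: computable_iter => //; apply: computable_succ.
exact/computable_snd/computable_id.
Qed.

Lemma computable_sub (X : codedType) (f g : X -> nat) :
  computable f -> computable g -> computable (fun x => f x - g x).
Proof.
move=> Cf Cg.
apply: (eq_computable (f := fun x => iter (g x) predn (f x))).
  by move=> x /=; elim: (g x) => [|k /= ->] /=; rewrite ?subn0 // subnS.
apply: computable_iter => //; apply: computable_pred.
exact/computable_snd/computable_id.
Qed.

(** ** Decidable predicates *)

(** Truth values are classical, so that a predicate is shown to be decidable
    without exhibiting a boolean version of it. *)
Definition dec (X : codedType) (P : X -> Prop) : Prop :=
  computable (fun x => `[< P x >] : nat).

Lemma dec_bool (X : codedType) (b : X -> bool) :
  computable (fun x => b x : nat) -> dec (fun x => b x).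
Proof. by apply: eq_computable => x; rewrite asboolb. Qed.

Lemma bool_dec (X : codedType) (b : X -> bool) :
  dec (fun x => b x) -> computable (fun x => b x : nat).
Proof. by apply: eq_computable => x; rewrite asboolb. Qed.

Lemma eq_dec (X : codedType) (P Q : X -> Prop) :
  (forall x, P x <-> Q x) -> dec P -> dec Q.
Proof.
by move=> PQ; apply: eq_computable => x; congr nat_of_bool; apply: asbool_equiv_eq.
Qed.

Lemma computable_if (X Y : codedType) (b : X -> bool) (f g : X -> Y) :
  dec (fun x => b x) -> computable f -> computable g ->
  computable (fun x => if b x then f x else g x).
Proof. by move=> /bool_dec; apply: computable_if_nat. Qed.

Lemma dec_comp (X Y : codedType) (P : Y -> Prop) (f : X -> Y) :
  dec P -> computable f -> dec (fun x => P (f x)).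
Proof. exact: computable_comp. Qed.

Lemma dec_const (X : codedType) (P : Prop) : dec (fun _ : X => P).
Proof. exact: computable_const. Qed.

Lemma dec_eq0 (X : codedType) (f : X -> nat) :
  computable f -> dec (fun x => f x = 0).
Proof.
move=> Cf; apply: (eq_dec (P := fun x => f x == 0)); first by move=> x; split=> /eqP.
apply/dec_bool.
apply: (eq_computable (f := fun x => 1 - f x)); first by move=> x; case: (f x).
by apply: computable_sub => //; apply: computable_const.
Qed.

Lemma dec_eq (X Y : codedType) (f g : X -> Y) :
  computable f -> computable g -> dec (fun x => f x = g x).
Proof.
move=> Cf Cg.
apply: (eq_dec (P := fun x => (code (f x) - code (g x))
                             + (code (g x) - code (f x)) = 0)).
  by move=> x; split=> [?|->]; [apply: code_inj|]; lia.
by apply/dec_eq0/computable_add; apply: computable_sub; apply: computable_code.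
Qed.

Lemma dec_eqb (X Y : codedType) (f g : X -> Y) :
  computable f -> computable g -> dec (fun x => f x == g x).
Proof.
move=> Cf Cg; apply: (eq_dec (P := fun x => f x = g x)); last exact: dec_eq.
by move=> x; split=> /eqP.
Qed.

Lemma dec_not (X : codedType) (P : X -> Prop) : dec P -> dec (fun x => ~ P x).
Proof.
move=> DP; apply: (eq_dec (P := fun x => (`[< P x >] : nat) = 0)).
  by move=> x; case: asboolP; split.
exact: dec_eq0.
Qed.

Lemma dec_and (X : codedType) (P Q : X -> Prop) :
  dec P -> dec Q -> dec (fun x => P x /\ Q x).
Proof.
move=> DP DQ.
apply: (eq_dec (P := fun x => if `[< P x >] then `[< Q x >] else false)).
  move=> x; case: (asboolP (P x)) => Px; last by split=> // -[].
  by case: (asboolP (Q x)) => Qx; split=> // -[].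
apply: (dec_bool (b := fun x => if `[< P x >] then `[< Q x >] else false)).
apply: (eq_computable (f := fun x => if `[< P x >] then `[< Q x >] : nat else 0)).
  by move=> x; case: `[< P x >].
by apply: computable_if_nat => //; apply: computable_const.
Qed.

Lemma dec_or (X : codedType) (P Q : X -> Prop) :
  dec P -> dec Q -> dec (fun x => P x \/ Q x).
Proof.
move=> DP DQ; apply: (eq_dec (P := fun x => ~ (~ P x /\ ~ Q x))).
  by move=> x; rewrite not_andP !notK.
by apply: (dec_not (P := fun x => _ /\ _)); apply: dec_and; apply: dec_not.
Qed.

Lemma dec_andb (X : codedType) (P Q : X -> bool) :
  dec (fun x => P x) -> dec (fun x => Q x) -> dec (fun x => P x && Q x).
Proof.
move=> DP DQ; apply: (eq_dec _ (dec_and DP DQ)) => x.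
by split=> /andP.
Qed.

Lemma dec_negb (X : codedType) (P : X -> bool) :
  dec (fun x => P x) -> dec (fun x => ~~ P x).
Proof. by move=> DP; apply: (eq_dec _ (dec_not DP)) => x; split=> /negP. Qed.

(** ** Recursion on lists *)

Lemma computable_cons (X Y : codedType) (f : X -> Y) (s : X -> seq Y) :
  computable f -> computable s -> computable (fun x => f x :: s x).
Proof.
move=> Cf Cs.
apply: (eq_computable (f := fun x => decode (code (f x, s x)).+1)).
  by move=> x; rewrite -code_cons codeK.
exact/computable_decode/computable_succ/computable_code/computable_pair.
Qed.

(** Reading the predecessor of the code as a pair makes the operation total; at
    the empty list the result is the pair with code 0. *)
Definition uncons (X : codedType) (s : seq X) : X * seq X := decode (code s).-1.

Arguments uncons : simpl never.

Lemma uncons_cons (X : codedType) (y : X) s : uncons (y :: s) = (y, s).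
Proof. by rewrite /uncons code_cons codeK. Qed.

Lemma computable_uncons (X Y : codedType) (s : X -> seq Y) :
  computable s -> computable (fun x => uncons (s x)).
Proof. by move=> Cs; apply/computable_decode/computable_pred/computable_code. Qed.

Lemma dec_nil (X Y : codedType) (s : X -> seq Y) :
  computable s -> dec (fun x => s x == [::]).
Proof. by move=> Cs; apply: dec_eqb => //; apply: computable_const. Qed.

(** The code of a list bounds its length, so it serves as the number of
    iterations of the loop, which idles once the list is exhausted. *)
Lemma computable_foldl (X Y R : codedType) (f : X -> R -> Y -> R) (g : X -> R)
    (s : X -> seq Y) :
  computable (fun p : X * (Y * R) => f p.1 p.2.2 p.2.1) ->
  computable g -> computable s ->
  computable (fun x => foldl (f x) (g x) (s x)).
Proof.
move=> Cf Cg Cs.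
pose step x (p : seq Y * R) : seq Y * R :=
  if p.1 == [::] then p else ((uncons p.1).2, f x p.2 (uncons p.1).1).
have stepE x y t r : step x (y :: t, r) = (t, f x r y).
  by rewrite /step uncons_cons.
apply: (eq_computable (f := fun x =>
   (iter (code (s x)) (step x) (s x, g x)).2)).
  move=> x; move: (leqnn (code (s x))); move: {2 3}(code _) => n.
  elim: n (s x) (g x) => [|n IH] [|y t] r //=.
    by rewrite -iterS iterSr /= => _; apply: IH.
  rewrite -iterS iterSr stepE => le_n; apply: IH.
  rewrite code_cons ltnS in le_n; apply: leq_trans le_n.
  by rewrite code_pair; have := cpair_ge (code y) (code t); lia.
have C2 : computable (fun p : X * (seq Y * R) => p.2).
  exact/computable_snd/computable_id.
have C21 := computable_fst C2; have C22 := computable_snd C2.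
apply/computable_snd/computable_iter; last exact: computable_code.
  apply: computable_if => //; first exact: dec_nil.
  apply: computable_pair; first exact/computable_snd/computable_uncons.
  apply: (computable_comp (f := fun p : X * (Y * R) => f p.1 p.2.2 p.2.1)
            (g := fun p => (p.1, ((uncons p.2.1).1, p.2.2)))) => //.
  apply: computable_pair; first exact/computable_fst/computable_id.
  by apply: computable_pair => //; apply/computable_fst/computable_uncons.
exact: computable_pair.
Qed.

Lemma computable_rev (X Y : codedType) (s : X -> seq Y) :
  computable s -> computable (fun x => rev (s x)).
Proof.
move=> Cs; apply: (eq_computable (f := fun x =>
   foldl (fun r y => y :: r) [::] (s x))).
  move=> x; rewrite -[RHS]/(catrev _ _).
  by elim: (s x) [::] => //= y t IH r; rewrite IH.
apply: computable_foldl => //; last exact: computable_const.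
by apply: computable_cons; [apply: computable_fst | apply: computable_snd];
   apply/computable_snd/computable_id.
Qed.

Lemma computable_foldr (X Y R : codedType) (f : X -> Y -> R -> R) (g : X -> R)
    (s : X -> seq Y) :
  computable (fun p : X * (Y * R) => f p.1 p.2.1 p.2.2) ->
  computable g -> computable s ->
  computable (fun x => foldr (f x) (g x) (s x)).
Proof.
move=> Cf Cg Cs; apply: (eq_computable (f := fun x =>
   foldl (fun r y => f x y r) (g x) (rev (s x)))).
  by move=> x; rewrite foldl_rev.
by apply: computable_foldl => //; apply: computable_rev.
Qed.

Lemma dec_leq (X : codedType) (f g : X -> nat) :
  computable f -> computable g -> dec (fun x => f x <= g x).
Proof.
move=> Cf Cg; apply: (eq_dec (P := fun x => f x - g x = 0)).
  by move=> x; rewrite -subn_eq0; split=> /eqP.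
exact/dec_eq0/computable_sub.
Qed.

(* Closes computability goals by following the structure of the function. The
   hook comp_step is rebound when further operations become available. *)
Ltac comp_step := fail.
Ltac comp :=
  repeat (match goal with
  | H : computable ?f |- computable ?f => exact H
  | H : dec ?f |- dec ?f => exact H
  | |- computable (fun x => x) => exact: computable_id
  | H : computable ?f |- computable (fun x => ?f _) => apply: (computable_comp H)
  | H : dec ?P |- dec (fun x => ?P _) => apply: (dec_comp H)
  | |- computable id => exact: computable_id
  | |- computable fst => exact: (computable_fst (computable_id _))
  | |- computable snd => exact: (computable_snd (computable_id _))
  | |- computable (fun x => fst _) => apply: computable_fst
  | |- computable (fun x => snd _) => apply: computable_snd
  | |- computable (fun x => pair _ _) => apply: computable_pair
  | |- computable (fun x => cons _ _) => apply: computable_cons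
  | |- computable (fun x => S _) => apply: computable_succ
  | |- computable (fun x => predn _) => apply: computable_pred
  | |- computable (fun x => addn _ _) => apply: computable_add
  | |- computable (fun x => subn _ _) => apply: computable_sub
  | |- computable (fun x => code _) => apply: computable_code
  | |- computable (fun x => decode _) => apply: computable_decode
  | |- computable (fun x => if _ then _ else _) => apply: computable_if
  | |- computable (fun x => nat_of_bool (asbool (@?P x))) => change (dec P)
  | |- computable (fun x => nat_of_bool _) => apply: bool_dec
  | |- computable (fun x => iter _ _ _) => apply: computable_iter
  | |- computable (fun x => foldr _ _ _) => apply: computable_foldr
  | |- computable (fun x => uncons _) => apply: computable_uncons
  | |- computable (fun x => rev _) => apply: computable_rev
  | |- dec (fun x => is_true (leq _ _)) => apply: dec_leq
  | |- dec (fun x => is_true (_ == _)) => apply: dec_eqb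
  | |- dec (fun x => is_true (_ && _)) => apply: dec_andb
  | |- dec (fun x => is_true (~~ _)) => apply: dec_negb
  | |- dec (fun x => not _) => apply: dec_not
  | |- dec (fun x => _ /\ _) => apply: dec_and
  | |- dec (fun x => _ \/ _) => apply: dec_or
  | |- dec (fun x => _ = _) => apply: dec_eq
  | |- computable (fun x => ?c) => exact: computable_const
  | |- dec (fun x => ?c) => exact: dec_const
  | _ => comp_step
  end; cbv beta).

Lemma computable_comp2 (X A B Y : codedType) (f : A -> B -> Y) (g : X -> A)
    (h : X -> B) :
  computable (fun p : A * B => f p.1 p.2) -> computable g -> computable h ->
  computable (fun x => f (g x) (h x)).
Proof.
move=> Cf Cg Ch.
apply: (computable_comp (f := fun p : A * B => f p.1 p.2) (g := fun x => (g x, h x))) => //.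
by comp.
Qed.

Lemma dec_comp2 (X A B : codedType) (P : A -> B -> Prop) (g : X -> A)
    (h : X -> B) :
  dec (fun p : A * B => P p.1 p.2) -> computable g -> computable h ->
  dec (fun x => P (g x) (h x)).
Proof. exact: (computable_comp2 (f := fun x y => `[< P x y >] : nat)). Qed.

Lemma computable_map (X Y Z : codedType) (f : X -> Y -> Z) (s : X -> seq Y) :
  computable (fun p : X * Y => f p.1 p.2) -> computable s ->
  computable (fun x => [seq f x y | y <- s x]).
Proof.
move=> Cf Cs; apply: (eq_computable (f := fun x =>
  foldr (fun y r => f x y :: r) [::] (s x))); first by [].
comp.
by apply: (computable_comp2 (f := f)) => //; comp.
Qed.

Lemma computable_cat (X Y : codedType) (s t : X -> seq Y) :
  computable s -> computable t -> computable (fun x => s x ++ t x).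
Proof.
move=> Cs Ct; apply: (eq_computable (f := fun x => foldr cons (t x) (s x))).
  by move=> x; elim: (s x) => //= y u ->.
by comp.
Qed.

Lemma dec_all (X Y : codedType) (P : X -> Y -> Prop) (s : X -> seq Y) :
  dec (fun p : X * Y => P p.1 p.2) -> computable s ->
  dec (fun x => forall y, y \in s x -> P x y).
Proof.
move=> DP Cs; apply: (eq_dec (P := fun x =>
  foldr (fun y r => if `[< P x y >] then r else 0) 1 (s x) = 1)).
  move=> x; elim: (s x) => [|y t IH] //=; case: asboolP => Py.
    split=> [/IH all_t z|all_t]; last by apply/IH => z zt; apply: all_t; rewrite inE zt orbT.
    by rewrite inE => /predU1P[->//|]; apply: all_t.
  by split=> // all_t; case: Py; apply: all_t; rewrite inE eqxx.
comp; apply: (dec_comp2 (P := fun x y => `[< P x y >])); comp.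
by apply: eq_dec DP => x; split=> /asboolP.
Qed.

Lemma dec_ex_in (X Y : codedType) (P : X -> Y -> Prop) (s : X -> seq Y) :
  dec (fun p : X * Y => P p.1 p.2) -> computable s ->
  dec (fun x => exists2 y, y \in s x & P x y).
Proof.
move=> DP Cs; apply: (eq_dec (P := fun x => ~ forall y, y \in s x -> ~ P x y)).
  move=> x; split=> [|[y ys Py] /(_ y ys)//].
  move=> nall; apply: contrapT => nex; apply: nall => y ys Py.
  by apply: nex; exists y.
by apply: dec_not; apply: dec_all => //; comp.
Qed.

Lemma dec_mem (X Y : codedType) (f : X -> Y) (s : X -> seq Y) :
  computable f -> computable s -> dec (fun x => f x \in s x).
Proof.
move=> Cf Cs; apply: (eq_dec (P := fun x => exists2 y, y \in s x & y = f x)).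
  by move=> x; split=> [[y ys <-]//|]; exists (f x).
by apply: dec_ex_in => //; comp.
Qed.

(** A fold that rebuilds its argument gives access to the tails of a list, and
    so to tests that compare an entry with the later ones. *)
Lemma dec_tail (X Y : codedType) (P : X -> Y -> seq Y -> Prop) (s : X -> seq Y) :
  dec (fun p : X * (Y * seq Y) => P p.1 p.2.1 p.2.2) -> computable s ->
  dec (fun x => forall u y t, s x = u ++ y :: t -> P x y t).
Proof.
move=> DP Cs; pose tails (r : seq Y) : seq (Y * seq Y) :=
  (foldr (fun y p => (y :: p.1, (y, p.1) :: p.2)) ([::], [::]) r).2.
have tailsE r y t : (y, t) \in tails r <-> exists u, r = u ++ y :: t.
  rewrite /tails; set g := fun _ _ => _.
  have r1 q : (foldr g ([::], [::]) q).1 = q by elim: q => //= z q ->.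
  elim: r => [|z r IH] /=; first by split=> // -[[]].
  rewrite inE r1; split=> [/predU1P[[-> ->]|/IH[u ->]]|[[|a u] /= []]].
  - by exists [::].
  - by exists (z :: u).
  - by move=> -> ->; rewrite eqxx.
  - by move=> _ Er; apply/orP; right; apply/IH; exists u.
apply: (eq_dec (P := fun x => forall q, q \in tails (s x) -> P x q.1 q.2)).
  move=> x; split=> [allP u y t Es|allP [y t] /tailsE[u Es]]; last exact: allP Es.
  by apply: (allP (y, t)); apply/tailsE; exists u.
apply: dec_all => //; apply/computable_snd; comp.
Qed.

Lemma dec_ex_tail (X Y : codedType) (P : X -> Y -> seq Y -> Prop) (s : X -> seq Y) :
  dec (fun p : X * (Y * seq Y) => P p.1 p.2.1 p.2.2) -> computable s ->
  dec (fun x => exists u y t, s x = u ++ y :: t /\ P x y t).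
Proof.
move=> DP Cs.
apply: (eq_dec (P := fun x => ~ forall u y t, s x = u ++ y :: t -> ~ P x y t)).
  move=> x; split=> [|[u [y [t [Es Py]]]] /(_ u y t Es)//].
  move=> nall; apply: contrapT => nex; apply: nall => u y t Es Py.
  by apply: nex; exists u, y, t.
by apply: dec_not; apply: dec_tail => //; comp.
Qed.

Lemma dec_ex_lt (X : codedType) (P : X -> nat -> Prop) (n : X -> nat) :
  dec (fun p : X * nat => P p.1 p.2) -> computable n ->
  dec (fun x => exists2 k, k < n x & P x k).
Proof.
move=> DP Cn; pose h x k r := if `[< P x k >] then 1 else r.
apply: (eq_dec (P := fun x => nat_rect (fun=> nat) 0 (h x) (n x) = 1)).
  move=> x; elim: (n x) => [|k IH] /=; first by split=> // -[].
  rewrite /h; case: asboolP => Pk; first by split=> // _; exists k.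
  rewrite IH; split=> -[j lt_jk Pj]; exists j => //; first exact: ltnW.
  by rewrite ltn_neqAle -ltnS lt_jk andbT; apply/eqP => jk; rewrite jk in Pj.
apply: dec_eq; last by comp.
apply: computable_rec => //; rewrite /h; comp.
apply: (dec_comp2 (P := fun x y => `[< P x y >])); comp.
by apply: eq_dec DP => x; split=> /asboolP.
Qed.

(** * Semidecidable predicates *)

Definition semidec (X : codedType) (P : X -> Prop) : Prop :=
  exists2 Q : X -> nat -> Prop, dec (fun p : X * nat => Q p.1 p.2) &
    forall x, P x <-> exists k, Q x k.

Section Semidec.
Variable X : codedType.

Lemma eq_semidec (P Q : X -> Prop) :
  (forall x, P x <-> Q x) -> semidec P -> semidec Q.
Proof. by move=> PQ [R DR PR]; exists R => // x; rewrite -PQ. Qed.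

Lemma semidec_comp (Y : codedType) (P : Y -> Prop) (f : X -> Y) :
  semidec P -> computable f -> semidec (fun x => P (f x)).
Proof.
move=> [R DR PR] Cf; exists (fun x => R (f x)) => //.
apply: (dec_comp2 (P := R)) => //; last by comp.
by apply: (computable_comp (f := f)) => //; comp.
Qed.

Lemma dec_semidec (P : X -> Prop) : dec P -> semidec P.
Proof.
move=> DP; exists (fun x _ => P x); first by apply: (dec_comp (P := P)) => //; comp.
by move=> x; split=> [Px|[]//]; exists 0.
Qed.

Lemma semidec_and (P Q : X -> Prop) :
  semidec P -> semidec Q -> semidec (fun x => P x /\ Q x).
Proof.
move=> [R DR PR] [S DS QS].
exists (fun x k => R x (uncpair k).1 /\ S x (uncpair k).2).
  apply: dec_and.
    apply: (dec_comp2 (P := R) (h := fun p => (decode p.2 : nat * nat).1)) => //.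
      by comp.
    by apply: computable_fst; comp.
  apply: (dec_comp2 (P := S) (h := fun p => (decode p.2 : nat * nat).2)) => //.
    by comp.
  by apply: computable_snd; comp.
move=> x; rewrite PR QS; split=> [[[i Ri] [j Sj]]|[k []]]; last by split; eexists; eauto.
by exists (cpair i j); rewrite cpairK.
Qed.

Lemma semidec_or (P Q : X -> Prop) :
  semidec P -> semidec Q -> semidec (fun x => P x \/ Q x).
Proof.
move=> [R DR PR] [S DS QS]; exists (fun x k => R x k \/ S x k); first exact: dec_or.
move=> x; rewrite PR QS; split=> [[]|] [k]; first by exists k; left.
  by exists k; right.
by case=> ?; [left|right]; exists k.
Qed.

Lemma semidec_ex (Y : codedType) (P : X -> Y -> Prop) :
  semidec (fun p : X * Y => P p.1 p.2) -> semidec (fun x => exists y, P x y).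
Proof.
move=> [R DR PR].
exists (fun x k => R (x, decode (uncpair k).1) (uncpair k).2).
  apply: (dec_comp2 (P := R) (g := fun p => (p.1, (decode p.2 : Y * nat).1))
                    (h := fun p => (decode p.2 : Y * nat).2)) => //.
    by apply: computable_pair; comp.
  by apply: computable_snd; comp.
move=> x; split=> [[y /(PR (x, y))[k Rk]]|[k Rk]].
  by exists (cpair (code y) k); rewrite cpairK codeK.
by exists (decode (uncpair k).1); apply/(PR (x, _)); exists (uncpair k).2.
Qed.

(** Finitely many witnesses are replaced by a common bound, which leaves a
    bounded search. *)
Lemma semidec_all (Y : codedType) (P : X -> Y -> Prop) (s : X -> seq Y) :
  semidec (fun p : X * Y => P p.1 p.2) -> computable s ->
  semidec (fun x => forall y, y \in s x -> P x y).
Proof.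
move=> [R DR PR] Cs.
exists (fun x k => forall y, y \in s x -> exists2 j, j < k & R (x, y) j).
  apply: (dec_all (P := fun (q : X * nat) y => exists2 j, j < q.2 & R (q.1, y) j)).
    apply: (dec_ex_lt (P := fun q : X * nat * Y => R (q.1.1, q.2))); last by comp.
    by apply: (dec_comp2 (P := R)) => //; comp.
  by apply: (computable_comp (f := s)) => //; comp.
move=> x; split=> [|[k allR] y /allR[j _ Rj]]; last by apply/(PR (x, y)); exists j.
elim: (s x) => [|y t IH] Pt; first by exists 0.
have [|k allR] := IH; first by move=> z zt; apply: Pt; rewrite inE zt orbT.
have /(PR (x, y))[j Rj] : P x y by apply: Pt; rewrite inE eqxx.
exists (maxn j.+1 k) => z; rewrite inE => /predU1P[->|/allR[i lt_i Ri]].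
  by exists j => //; rewrite leq_max ltnSn.
by exists i => //; rewrite leq_max lt_i orbT.
Qed.

(** The only use of unbounded search. *)
Lemma least_computable (P : X -> nat -> Prop) (f : X -> nat) :
  dec (fun p : X * nat => P p.1 p.2) ->
  (forall x, P x (f x) /\ forall k, P x k -> f x <= k) -> computable f.
Proof.
move=> DP fP.
have [M HM] : computable (fun p : X * nat => if `[< P p.1 p.2 >] then 0 else 1).
  by comp; apply: eq_dec DP => p; split=> /asboolP.
exists (PMu M) => x; have [Pf f_min] := fP x.
apply: (ev_mu (v := fun _ => 0)).
  by have := HM (x, f x); case: asboolP.
move=> j lt_j; have := HM (x, j); case: asboolP => //= /f_min; rewrite code_nat.
by rewrite leqNgt lt_j.
Qed.

(** Every total semidecidable relation contains the graph of a computable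
    function: search for a value together with its witness. *)
Lemma uniformize (Y : codedType) (P : X -> Y -> Prop) :
  semidec (fun p : X * Y => P p.1 p.2) -> (forall x, exists y, P x y) ->
  exists2 f : X -> Y, computable f & forall x, P x (f x).
Proof.
move=> [R DR PR] tot.
pose Q x k := R (x, decode (uncpair k).1) (uncpair k).2.
have DQ : dec (fun p : X * nat => Q p.1 p.2).
  apply: (dec_comp2 (P := R) (g := fun p => (p.1, (decode p.2 : Y * nat).1))
                    (h := fun p => (decode p.2 : Y * nat).2)) => //.
    by apply: computable_pair; comp.
  by apply: computable_snd; comp.
have exQ x : exists k, `[< Q x k >].
  have [y /(PR (x, y))[k Rk]] := tot x.
  by exists (cpair (code y) k); apply/asboolP; rewrite /Q cpairK codeK.
pose mu x := ex_minn (exQ x).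
have muP x : Q x (mu x) /\ forall k, Q x k -> mu x <= k.
  by rewrite /mu; case: ex_minnP => k /asboolP Qk k_min; split=> // j /asboolP/k_min.
exists (fun x => (decode (mu x) : Y * nat).1).
  by apply/computable_fst/computable_decode/(least_computable DQ).
by move=> x; have [Qx _] := muP x; apply/(PR (x, _)); eexists; apply: Qx.
Qed.

End Semidec.

(** Post's theorem: search for a witness of P and for one of its negation at the
    same time. *)
Lemma post (X : codedType) (P : X -> Prop) :
  semidec P -> semidec (fun x => ~ P x) -> dec P.
Proof.
move=> SP SN.
have [|x|b Cb bP] := @uniformize X _
  (fun x (b : nat) => P x /\ b = 1 \/ ~ P x /\ b = 0).
- cbv beta; apply: semidec_or; apply: semidec_and.
  + by apply: (semidec_comp SP); comp.
  + by apply: dec_semidec; comp.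
  + by apply: (semidec_comp SN); comp.
  + by apply: dec_semidec; comp.
- by have [Px|nPx] := pselect (P x); [exists 1; left | exists 0; right].
apply: (eq_dec (P := fun x => b x = 1)); last by comp.
by move=> x; case: (bP x) => -[Px ->]; split.
Qed.

(* The analogue of comp for semidecidability; semi_step is a hook. *)
Ltac semi_step := fail.
Ltac semi :=
  repeat (match goal with
  | H : semidec ?f |- semidec ?f => exact H
  | |- semidec (fun x => _ /\ _) => apply: semidec_and
  | |- semidec (fun x => _ \/ _) => apply: semidec_or
  | |- semidec (fun x => exists y, _) => apply: semidec_ex
  | |- semidec (fun x => forall y, is_true (y \in _) -> _) => apply: semidec_all
  | |- semidec (fun x => _ = _) => apply: dec_semidec
  | |- semidec (fun x => ~ (_ = _)) => apply: dec_semidec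
  | |- semidec (fun x => is_true (_ \in _)) => apply: dec_semidec
  | |- computable _ => progress comp
  | |- dec _ => progress comp
  | _ => semi_step
  end; cbv beta).

(** * Integer arithmetic *)

Lemma computable_half (X : codedType) (f : X -> nat) :
  computable f -> computable (fun x => (f x)./2).
Proof.
apply: (computable_comp (f := half)).
apply: (least_computable (P := fun (k h : nat) => k - (h + h).+1 = 0)).
  by comp.
by move=> k; split=> [|h Hh]; lia.
Qed.

Lemma dec_odd (X : codedType) (f : X -> nat) :
  computable f -> dec (fun x => odd (f x)).
Proof.
move=> Cf; apply: (eq_dec (P := fun x => f x - ((f x)./2 + (f x)./2) = 1)).
  by move=> x; split; lia.
have Ch := computable_half Cf.
by comp.
Qed.

Definition int_parts (z : int) : nat * nat :=
  if odd (code z) then (0, (code z)./2.+1) else ((code z)./2, 0).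

Lemma int_partsE z : z = ((int_parts z).1%:Z - (int_parts z).2%:Z)%R.
Proof.
case: z => k; rewrite /int_parts /code /= ?odd_double ?doubleK ?uphalf_double /=.
  by rewrite GRing.subr0.
by rewrite NegzE; lia.
Qed.

Lemma computable_int_parts (X : codedType) (f : X -> int) :
  computable f -> computable (fun x => int_parts (f x)).
Proof.
move=> Cf; have Cc := computable_code Cf.
apply: computable_if; first exact: dec_odd.
  by have ? := computable_half Cc; comp.
by have ? := computable_half Cc; comp.
Qed.

Lemma computable_int_sub (X : codedType) (f g : X -> nat) :
  computable f -> computable g ->
  computable (fun x => ((f x)%:Z - (g x)%:Z)%R : int).
Proof.
move=> Cf Cg; apply: (eq_computable (f := fun x => decode
   (if f x - g x == 0 then
      if g x - f x == 0 then 0 else ((g x - f x).-1 + (g x - f x).-1).+1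
    else (f x - g x) + (f x - g x)))); last by comp.
move=> x; apply: (canLR codeK).
case: ifP => le_fg; last first.
  have -> : ((f x)%:Z - (g x)%:Z)%R = Posz (f x - g x) by lia.
  by rewrite /code /= addnn.
case: ifP => le_gf.
  by have -> : ((f x)%:Z - (g x)%:Z)%R = Posz 0 by lia.
have -> : ((f x)%:Z - (g x)%:Z)%R = Negz (g x - f x).-1 by lia.
by rewrite /code /= addnn.
Qed.

Lemma computable_addz : computable (fun p : int * int => (p.1 + p.2)%R).
Proof.
have C1 := computable_int_parts (computable_fst (@computable_id (int * int)%type)).
have C2 := computable_int_parts (computable_snd (@computable_id (int * int)%type)).
have C := computable_int_sub (computable_add (computable_fst C1) (computable_fst C2))
                             (computable_add (computable_snd C1) (computable_snd C2)).
apply: eq_computable C => p.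
by rewrite [in RHS](int_partsE p.1) [in RHS](int_partsE p.2) /=; lia.
Qed.

Lemma computable_oppz : computable (fun z : int => (- z)%R).
Proof.
have C1 := computable_int_parts (@computable_id int).
have C := computable_int_sub (computable_snd C1) (computable_fst C1).
by apply: eq_computable C => z; rewrite [in RHS](int_partsE z) /=; lia.
Qed.

(** * Subgroups *)

Local Open Scope group_scope.
Local Open Scope classical_set_scope.

(** The closure condition that defines generated subgroups, stated for sets
    rather than for boolean predicates. *)
Definition subgroup (G : groupType) (K : set G) : Prop :=
  K 1 /\ forall x y, K x -> K y -> K (x * y^-1).

Section Subgroup.
Variable G : groupType.
Implicit Types (K X : set G).

Lemma subgroup1 K : subgroup K -> K 1. Proof. by case. Qed.

Lemma subgroupV K x : subgroup K -> K x -> K x^-1.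
Proof. by case=> K1 Kd Kx; rewrite -[x^-1]mul1g; apply: Kd. Qed.

Lemma subgroupM K x y : subgroup K -> K x -> K y -> K (x * y).
Proof.
by move=> sK Kx Ky; rewrite -[y]invgK; apply: (proj2 sK) => //; apply: subgroupV.
Qed.

Lemma subgroup_closed K : subgroup K <-> group_closed [in K].
Proof.
split=> -[K1 Kd]; split; rewrite ?inE //.
  by move=> x y /set_mem Kx /set_mem Ky; apply/mem_set/Kd.
  by apply/set_mem.
by move=> x y /mem_set Kx /mem_set Ky; apply/set_mem/Kd.
Qed.

Lemma subgroup_gen_subgroup X : subgroup (subgroup_gen X).
Proof.
split=> [K [cK _]|x y gx gy K KX].
  exact: subgroup1 (proj2 (subgroup_closed K) cK).
have [_ Kd] := proj2 (subgroup_closed K) (proj1 KX).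
by apply: Kd; [apply: gx|apply: gy].
Qed.

Lemma subset_subgroup_gen X x : X x -> subgroup_gen X x.
Proof. by move=> Xx K [_]; apply. Qed.

Lemma subgroup_gen_min X K :
  subgroup K -> (forall x, X x -> K x) -> forall x, subgroup_gen X x -> K x.
Proof. by move=> /subgroup_closed sK XK x; apply; split. Qed.

End Subgroup.

Lemma subgroup_image (G H : groupType) (f : G -> H) (K : set G) :
  f 1 = 1 -> (forall x y, f (x * y^-1) = f x * (f y)^-1) ->
  subgroup K -> subgroup [set f x | x in K].
Proof.
move=> f1 fd sK; split; first by exists 1 => //; apply: subgroup1.
by move=> _ _ [x Kx <-] [y Ky <-]; exists (x * y^-1) => //; apply: (proj2 sK).
Qed.

(** ** Integer powers *)

Definition gpow (G : groupType) (g : G) (k : int) : G :=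
  match k with Posz n => g ^+ n | Negz n => g^-1 ^+ n.+1 end.

Section Gpow.
Variable G : groupType.
Implicit Types (g : G) (k l : int).

Lemma gpowSr g k : gpow g (k + 1)%R = gpow g k * g.
Proof.
case: k => n /=; first by rewrite addn1 expgSr.
case: n => [|n]; first by rewrite expg1 mulVg.
have -> : (Negz n.+1 + 1)%R = Negz n by lia.
by rewrite [in RHS]expgSr mulgVK.
Qed.

Lemma gpowD g k l : gpow g (k + l)%R = gpow g k * gpow g l.
Proof.
elim: l => [|n IH|n IH]; first by rewrite GRing.addr0 /= mulg1.
  have -> : Posz n.+1 = (Posz n + 1)%R by lia.
  by rewrite GRing.addrA !gpowSr IH mulgA.
apply: (@mulIg _ g); rewrite -mulgA -!gpowSr.
have -> : (k - n.+1%:Z + 1)%R = (k - n%:Z)%R by lia.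
by rewrite IH; congr (_ * gpow _ _); lia.
Qed.

Lemma gpowN g k : gpow g (- k)%R = (gpow g k)^-1.
Proof. by apply/esym/mulg1_eq; rewrite -gpowD GRing.subrr. Qed.

Lemma subgroup_gpow (K : set G) g k : subgroup K -> K g -> K (gpow g k).
Proof.
move=> sK; have KX h n : K h -> K (h ^+ n).
  move=> Kh; elim: n => [|n IH]; first exact: subgroup1.
  by rewrite expgS; apply: subgroupM.
by case: k => n Kg; apply: KX => //; apply: subgroupV.
Qed.

End Gpow.

Notation Zm := (Algebra.to_multiplicative int).

Lemma gpow_pair (G H : groupType) (p : G * H) k :
  gpow p k = (gpow p.1 k, gpow p.2 k).
Proof.
have E (q : G * H) n : q ^+ n = (q.1 ^+ n, q.2 ^+ n).
  by elim: n => [|n IH] //; rewrite !expgS IH.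
by case: k => n; rewrite /= E.
Qed.

Lemma gpow_int (z : Zm) k : gpow z k = (k * z)%R.
Proof.
have E (q : Zm) n : q ^+ n = (n%:Z * q)%R.
  elim: n => [|n IH]; first by rewrite GRing.mul0r.
  rewrite expgS IH -[_ * _]/(_ + _)%R; lia.
case: k => n; rewrite /= E //.
by rewrite -[z^-1]/(- z)%R; lia.
Qed.

(** Euclidean division by the least positive element. *)
Lemma int_subgroup (L : set Zm) :
  subgroup L -> exists d : nat, forall k : int, L k <-> exists q : int, k = (q * d%:Z)%R.
Proof.
move=> sL; have LD (x y : int) : L x -> L y -> L (x + y)%R.
  exact: (@subgroupM Zm).
have LM (q x : int) : L x -> L (q * x)%R.
  by move=> Lx; rewrite -gpow_int; apply: subgroup_gpow.
have [[d0 [Ld0 d0_gt0]]|noL] := pselect (exists d : nat, L (Posz d) /\ 0 < d); last first.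
  exists 0 => k; split=> [Lk|[q ->]]; last by rewrite GRing.mulr0; apply: (subgroup1 sL).
  exists 0%R; rewrite GRing.mul0r; apply: contrapT => k0.
  case: noL; exists `|k|%N; split; last by lia.
  have [?|?] : k = Posz `|k|%N \/ (-1 * k)%R = Posz `|k|%N by lia.
    by congr L: Lk.
  by have := LM (-1)%R k Lk; congr L.
have ex : exists d : nat, `[< L (Posz d) /\ 0 < d >] by exists d0; apply/asboolP.
case: (ex_minnP ex) => d /asboolP[Ld d_gt0] d_min; exists d => k.
split=> [Lk|[q ->]]; last exact: LM.
exists (k %/ d)%Z; have Ek := divz_eq k d.
have Lr : L (k %% d)%Z.
  have -> : (k %% d)%Z = (k + (- (k %/ d)%Z) * d%:Z)%R by rewrite {2}Ek; lia.
  by apply: LD => //; apply: LM.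
have r_ge0 : (0 <= k %% d)%Z%R by rewrite modz_ge0 //; lia.
have r_lt : ((k %% d)%Z < d%:Z)%R by rewrite ltz_pmod //; lia.
have [r0|r_gt0] := eqVneq (k %% d)%Z 0%R; first by rewrite {1}Ek r0 GRing.addr0.
have : d <= `|(k %% d)%Z|%N.
  apply: d_min; apply/asboolP; split; last by lia.
  by have -> : Posz `|(k %% d)%Z|%N = (k %% d)%Z by lia.
by lia.
Qed.

(** * Computable groups *)

(** A group whose elements are named by codes, not necessarily uniquely nor
    exhaustively, with computable operations and a decidable equality. *)
Record cgroup := CGroup {
  cgX : codedType;
  cgG : groupType;
  cval : cgX -> cgG;
  cg1 : cgX;
  cgM : cgX -> cgX -> cgX;
  cgV : cgX -> cgX;
  cval1 : cval cg1 = 1;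
  cvalM : forall x y, cval (cgM x y) = cval x * cval y;
  cvalV : forall x, cval (cgV x) = (cval x)^-1;
  computable_cgM_subproof : computable (fun p : cgX * cgX => cgM p.1 p.2);
  computable_cgV_subproof : computable cgV;
  dec_cval_subproof : dec (fun p : cgX * cgX => cval p.1 = cval p.2) }.

Arguments cg1 {c}.

Section CgroupComputable.
Variables (Y : cgroup) (X : codedType).

Lemma computable_cgM (f g : X -> cgX Y) :
  computable f -> computable g -> computable (fun x => cgM (f x) (g x)).
Proof. exact/computable_comp2/computable_cgM_subproof. Qed.

Lemma computable_cgV (f : X -> cgX Y) :
  computable f -> computable (fun x => cgV (f x)).
Proof. exact/computable_comp/computable_cgV_subproof. Qed.

Lemma dec_cval (f g : X -> cgX Y) :
  computable f -> computable g -> dec (fun x => cval (f x) = cval (g x)).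
Proof.
exact/(@dec_comp2 _ _ _ (fun x y => cval x = cval y))/dec_cval_subproof.
Qed.

End CgroupComputable.

Ltac comp_group :=
  match goal with
  | |- computable (fun x => cgM _ _) => apply: computable_cgM
  | |- computable (fun x => cgV _) => apply: computable_cgV
  | |- dec (fun x => cval _ = cval _) => apply: dec_cval
  | |- computable (fun x => cat _ _) => apply: computable_cat
  | |- computable (fun x => map _ _) => apply: computable_map
  | |- dec (fun x => is_true (_ \in _)) => apply: dec_mem
  | |- dec (fun x => is_true (odd _)) => apply: dec_odd
  | |- computable (fun x => half _) => apply: computable_half
  end.
Ltac comp_step ::= comp_group.

Section CgProd.
Variables Y Z : cgroup.
Let X : codedType := (cgX Y * cgX Z)%type.

Definition cgprod_val (p : X) : (cgG Y * cgG Z)%type := (cval p.1, cval p.2).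
Definition cgprod_M (p q : X) : X := (cgM p.1 q.1, cgM p.2 q.2).
Definition cgprod_V (p : X) : X := (cgV p.1, cgV p.2).

Lemma cgprod_val1 : cgprod_val (cg1, cg1) = 1.
Proof. by rewrite /cgprod_val !cval1. Qed.
Lemma cgprod_valM p q : cgprod_val (cgprod_M p q) = cgprod_val p * cgprod_val q.
Proof. by rewrite /cgprod_val !cvalM. Qed.
Lemma cgprod_valV p : cgprod_val (cgprod_V p) = (cgprod_val p)^-1.
Proof. by rewrite /cgprod_val !cvalV. Qed.
Lemma cgprod_computableM : computable (fun p : X * X => cgprod_M p.1 p.2).
Proof. by rewrite /cgprod_M; comp. Qed.
Lemma cgprod_computableV : computable cgprod_V.
Proof. by rewrite /cgprod_V; comp. Qed.
Lemma cgprod_dec : dec (fun p : X * X => cgprod_val p.1 = cgprod_val p.2).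
Proof.
apply: (eq_dec (P := fun p : X * X =>
   cval p.1.1 = cval p.2.1 /\ cval p.1.2 = cval p.2.2)); last by comp.
by move=> p; rewrite /cgprod_val; split=> [[-> ->]|[]].
Qed.

Definition cg_prod : cgroup :=
  CGroup cgprod_val1 cgprod_valM cgprod_valV
         cgprod_computableM cgprod_computableV cgprod_dec.
End CgProd.

Definition cg_int : cgroup :=
  @CGroup int Zm id 0%R (fun x y => (x + y)%R) (fun x => (- x)%R)
    erefl (fun _ _ => erefl) (fun _ => erefl)
    computable_addz computable_oppz
    (dec_eq (computable_fst (@computable_id _)) (computable_snd (@computable_id _))).

Definition cg_triv : cgroup :=
  @CGroup nat (Algebra.to_multiplicative 'I_1) (fun=> ord0) 0 (fun _ _ => 0) (fun=> 0)
    erefl (fun _ _ => esym (mulg1 _)) (fun _ => esym (@invg1 _))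
    (computable_const _ 0) (computable_const _ 0) (dec_const _ _).

(** ** Finitely generated subgroups *)

Section Gen.
Variable Y : cgroup.
Implicit Types (S : seq (cgX Y)) (g : cgG Y).

Definition gen S : set (cgG Y) :=
  subgroup_gen [set cval s | s in [set` S]].

Lemma gen_subgroup S : subgroup (gen S).
Proof. exact: subgroup_gen_subgroup. Qed.

Lemma gen1 S : gen S 1.
Proof. exact: subgroup1 (gen_subgroup S). Qed.

Lemma mem_gen S s : s \in S -> gen S (cval s).
Proof. by move=> sS; apply: subset_subgroup_gen; exists s. Qed.

Lemma gen_min S K : subgroup K -> (forall s, s \in S -> K (cval s)) ->
  forall g, gen S g -> K g.
Proof.
by move=> sK SK; apply: subgroup_gen_min => // _ [s sS <-]; apply: SK.
Qed.

Definition signed (p : cgX Y * nat) : cgX Y :=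
  if p.2 == 0 then p.1 else cgV p.1.

Definition sprod (l : seq (cgX Y * nat)) : cgX Y :=
  foldr (fun p r => cgM (signed p) r) cg1 l.

Lemma sprod_cat l1 l2 : cval (sprod (l1 ++ l2)) = cval (sprod l1) * cval (sprod l2).
Proof.
by elim: l1 => [|p l IH] /=; rewrite ?cval1 ?mul1g // !cvalM IH mulgA.
Qed.

(** This makes membership semidecidable. *)
Lemma genP S g :
  gen S g <-> exists l, (forall p, p \in l -> p.1 \in S) /\ cval (sprod l) = g.
Proof.
split=> [|[l [lS <-]]]; last first.
  elim: l lS => [|p l IH] lS /=; first by rewrite cval1; apply: gen1.
  rewrite cvalM; apply: (subgroupM (gen_subgroup S)); last first.
    by apply: IH => q ql; apply: lS; rewrite inE ql orbT.
  have pS : p.1 \in S by apply: lS; rewrite inE eqxx.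
  rewrite /signed; case: eqP => _; first exact: mem_gen.
  by rewrite cvalV; apply: subgroupV (gen_subgroup S) (mem_gen _).
move: g; apply: gen_min => [|s sS]; last first.
  exists [:: (s, 0)]; rewrite /= cvalM cval1 mulg1; split=> // p.
  by rewrite inE => /eqP->.
split=> [|_ _ [l1 [lS1 <-]] [l2 [lS2 <-]]]; first by exists [::]; rewrite /= cval1.
exists (l1 ++ rev [seq (p.1, p.2 == 0 : nat) | p <- l2]); split=> [p|].
  rewrite mem_cat mem_rev => /orP[/lS1//|/mapP[q /lS2 qS ->]//].
rewrite sprod_cat; congr (_ * _); elim: l2 {lS2} => [|p l IH] /=.
  by rewrite cval1 invg1.
rewrite rev_cons -cats1 sprod_cat IH /= !cvalM cval1 mulg1 invgM; congr (_ * _).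
by rewrite /signed /=; case: (p.2 == 0); rewrite /= cvalV ?invgK.
Qed.

Lemma semidec_gen (X : codedType) (S : X -> seq (cgX Y)) (g : X -> cgX Y) :
  computable S -> computable g -> semidec (fun x => gen (S x) (cval (g x))).
Proof.
move=> CS Cg; apply: (eq_semidec (P := fun x => exists l,
  (forall p : cgX Y * nat, p \in l -> p.1 \in S x) /\ cval (sprod l) = cval (g x))).
  by move=> x; rewrite genP.
by rewrite /sprod /signed; semi.
Qed.

Lemma gen_sub S T : (forall s, s \in S -> gen T (cval s)) ->
  forall g, gen S g -> gen T g.
Proof. exact: gen_min (gen_subgroup T). Qed.

Lemma gen_mono S T : {subset S <= T} -> forall g, gen S g -> gen T g.
Proof. by move=> ST; apply: gen_sub => s /ST/mem_gen. Qed.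

End Gen.

Ltac semi_step ::=
  match goal with
  | |- semidec (fun x => gen _ (cval _)) => apply: semidec_gen
  end.

Definition noetherian (Y : cgroup) : Prop :=
  forall L : set (cgG Y), subgroup L -> exists b : seq (cgX Y), forall g, gen b g <-> L g.

Definition commutative_group (G : groupType) : Prop := forall x y : G, x * y = y * x.

Lemma subgroup_mul (Y : cgroup) (comY : commutative_group (cgG Y)) (K L : set (cgG Y)) :
  subgroup K -> subgroup L -> subgroup [set g | exists k l, [/\ K k, L l & g = k * l]].
Proof.
move=> sK sL; split; first by exists 1, 1; split; rewrite ?mulg1 //; apply: subgroup1.
move=> _ _ [k [l [Kk Ll ->]]] [k' [l' [Kk' Ll' ->]]].
exists (k * k'^-1), (l * l'^-1); split; first exact: (proj2 sK).
  exact: (proj2 sL).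
by rewrite invgM -!mulgA; congr (_ * _); rewrite [RHS]comY mulgA.
Qed.

(** Elimination of one coordinate. Take an element (d, y) over a generator d of
    the projection of L to Z: subtracting multiples of it from the elements of L
    leaves elements over 0. When the projection is trivial, (0, 1) is used, so
    that the shape of the list is always the same. *)
Lemma int_prod_subgroup (Y : cgroup) (L : set (Zm * cgG Y)) :
  subgroup L -> noetherian Y ->
  exists d y b, [/\ forall g, gen b g <-> L (0%R, g),
    d <> 0%R \/ y = cg1 &
    forall g, @gen (cg_prod cg_int Y) ((d, y) :: [seq (0%R, z) | z <- b]) g <-> L g].
Proof.
move=> sL noY.
have sL0 : subgroup [set g | L (0%R, g)].
  split; first exact: (subgroup1 sL).
  by move=> g h Lg Lh; apply: (proj2 sL) (0%R, g) (0%R, h) Lg Lh.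
have [b bP] := noY _ sL0.
have sL1 : subgroup [set p.1 | p in L] by apply: subgroup_image.
have [d dP] := int_subgroup sL1.
have [y [dy0 Ldy]] : exists y : cgX Y, (Posz d <> 0%R \/ y = cg1) /\ L (Posz d, cval y).
  case: d dP => [|d] dP.
    by exists cg1; split; [right | rewrite cval1; apply: (subgroup1 sL)].
  have /dP[p Lp p1] : exists q : int, Posz d.+1 = (q * Posz d.+1)%R.
    by exists 1%R; rewrite GRing.mul1r.
  have [c cP] := noY _ (@subgroup_gen_subgroup _ [set: cgG Y]).
  have /cP/genP[l [_ El]] : subgroup_gen [set: cgG Y] p.2 by apply: subset_subgroup_gen.
  exists (sprod l); split; first by left.
  by rewrite El -p1; case: p Lp {p1 El}.
exists (Posz d), y, b; split=> // g.
set B := _ :: _; have sB : subgroup (@gen (cg_prod cg_int Y) B) by apply: gen_subgroup.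
split=> [|Lg].
  apply: (gen_min (Y := cg_prod cg_int Y) sL) => s; rewrite inE => /predU1P[->//|].
  by case/mapP=> z zb ->; exact: (proj1 (bP _) (mem_gen zb)).
have /dP[q Eq] : [set p.1 | p in L] g.1 by exists g.
pose e : (Zm * cgG Y)%type := (Posz d, cval y).
have Be : @gen (cg_prod cg_int Y) B e.
  by apply: (@mem_gen (cg_prod cg_int Y) B (Posz d, y)); rewrite inE eqxx.
have -> : g = gpow e q * (0%R, (gpow (cval y) q)^-1 * g.2).
  rewrite gpow_pair; case: g Eq {Lg} => g1 g2 /= ->; congr pair.
    by rewrite gpow_int -[_ * _]/(_ + 0)%R GRing.addr0.
  by rewrite mulVKg.
apply: (subgroupM sB); first exact: (subgroup_gpow q sB Be).
have : L (0%R, (gpow (cval y) q)^-1 * g.2).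
  have : L ((gpow e q)^-1 * g).
    by apply: (subgroupM sL) => //; apply: (subgroupV sL); apply: (subgroup_gpow q sL Ldy).
  rewrite gpow_pair; case: g Eq {Lg} => g1 g2 /= ->; congr (L (_, _)).
  by rewrite gpow_int -[_ * _]/(- _ + _)%R GRing.addNr.
move/bP; move: (_ * g.2) => h; move: h.
apply: gen_min => [|z zb].
  split; first exact: subgroup1 sB.
  by move=> u v Bu Bv; apply: (proj2 sB (0%R, u) (0%R, v) Bu Bv).
apply: (@mem_gen (cg_prod cg_int Y) B (0%R, z)).
by rewrite inE map_f ?orbT.
Qed.

Lemma noetherian_int_prod (Y : cgroup) : noetherian Y -> noetherian (cg_prod cg_int Y).
Proof.
move=> noY L sL; have [d [y [b [_ _ bP]]]] := int_prod_subgroup sL noY.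
by eexists; apply: bP.
Qed.

Lemma noetherian_int : noetherian cg_int.
Proof.
move=> L sL; have [d dP] := int_subgroup sL; exists [:: Posz d] => k.
have sg := @gen_subgroup cg_int [:: Posz d].
split.
  apply: gen_min => // s; rewrite inE => /eqP->.
  by apply/dP; exists 1%R; rewrite GRing.mul1r.
case/dP=> q ->; rewrite -gpow_int; apply: (subgroup_gpow q sg).
by apply: (@mem_gen cg_int [:: Posz d] (Posz d)); rewrite inE eqxx.
Qed.

Lemma noetherian_triv : noetherian cg_triv.
Proof.
move=> L sL; exists [::] => g; have -> : g = 1 by rewrite [g]ord1.
by split=> _; [apply: subgroup1 | apply: gen1].
Qed.

(** A list of the shape found in [int_prod_subgroup] is searched for; both
    inclusions between the two subgroups are semidecidable. An element over 0 is
    a product of a power of the first entry (d, y), which has exponent 0 when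
    d <> 0 and is trivial otherwise, and of an element that the other entries
    generate. *)
Lemma kernel_step (Y : cgroup) :
  commutative_group (cgG Y) -> noetherian Y ->
  exists2 K : seq (int * cgX Y) -> seq (cgX Y), computable K &
  forall b g, gen (K b) g <-> @gen (cg_prod cg_int Y) b (0%R, g).
Proof.
move=> comY noY; pose Z := cg_prod cg_int Y.
pose P (b : seq (int * cgX Y)) (c : seq (cgX Y)) := exists e : int * cgX Y,
  (e.1 <> 0%R \/ e.2 = cg1) /\
  ((forall s, s \in b -> @gen Z (e :: [seq (0%R, z) | z <- c]) (@cval Z s)) /\
   (forall s, s \in e :: [seq (0%R, z) | z <- c] -> @gen Z b (@cval Z s))).
have [|b|K CK KP] := @uniformize _ _ P.
- by rewrite /P; semi; apply: (semidec_gen (Y := Z)); comp.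
- have [d [y [c [_ dy cP]]]] := int_prod_subgroup (@gen_subgroup Z b) noY.
  exists c, (d, y); split=> //; split=> s.
    by move=> sb; exact: (proj2 (cP _) (@mem_gen Z _ _ sb)).
  by move=> sc; exact: (proj1 (cP _) (@mem_gen Z _ _ sc)).
exists K => // b g; have [[d y] [/= dy [bP cP]]] := KP b.
set B := _ :: _ in bP cP.
split=> [|/(@gen_sub Z _ _ bP)].
  move: g; apply: gen_min.
    split; first by apply: gen1.
    by move=> u v Bu Bv; apply: (proj2 (@gen_subgroup Z b) (0%R, u) (0%R, v) Bu Bv).
  by move=> z zK; apply: (cP (0%R, z)); rewrite inE map_f ?orbT.
pose e : (Zm * cgG Y)%type := (d, cval y).
have : forall h : (Zm * cgG Y)%type, @gen Z B h ->
    exists (q : int) k, gen (K b) k /\ h = gpow e q * (0%R, k).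
  apply: (@gen_min Z B) => [|s].
    split; first by exists 0%R, 1; split; [apply: gen1 | rewrite mul1g].
    move=> _ _ [q [k [Kk ->]]] [q' [k' [Kk' ->]]].
    exists (q - q')%R, (k * k'^-1); split; first exact: (proj2 (gen_subgroup _)).
    have comZ : commutative_group (Zm * cgG Y)%type.
      by move=> u v; congr pair; [apply: GRing.addrC | apply: comY].
    rewrite gpowD gpowN invgM -!mulgA; congr (_ * _).
    by rewrite mulgA comZ; congr (_ * _); congr pair.
  rewrite inE => /predU1P[->|/mapP[z zK ->]].
    by exists 1%R, 1; split; [apply: gen1 | rewrite mulg1].
  by exists 0%R, (cval z); split; [apply: mem_gen | rewrite mul1g].
move=> H /H[q [k [Kk]]]; rewrite gpow_pair gpow_int => -[/esym E ->].
have {}E : (q * d = 0)%R by rewrite -[LHS]GRing.addr0; exact: E.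
apply: (subgroupM (gen_subgroup _)) => //.
case: dy => [d0|->]; last first.
  by rewrite cval1; apply: (subgroup_gpow _ (gen_subgroup _)); apply: gen1.
have -> : q = 0%R by nia.
exact: gen1.
Qed.

Lemma gen_cat (Y : cgroup) (S T : seq (cgX Y)) g : commutative_group (cgG Y) ->
  gen (S ++ T) g <-> exists s t, [/\ gen S s, gen T t & g = s * t].
Proof.
move=> comY; split=> [|[s [t [Ss Tt ->]]]]; last first.
  apply: (subgroupM (gen_subgroup _)).
    by apply: gen_mono Ss => x; rewrite mem_cat => ->.
  by apply: gen_mono Tt => x; rewrite mem_cat orbC => ->.
have sK := subgroup_mul comY (gen_subgroup S) (gen_subgroup T).
apply: (gen_min sK) => s; rewrite mem_cat => /orP[]sS.
  by exists (cval s), 1; rewrite mulg1; split=> //; [apply: mem_gen|apply: gen1].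
by exists 1, (cval s); rewrite mul1g; split=> //; [apply: gen1|apply: mem_gen].
Qed.

Lemma gen_map (Y Z : cgroup) (f : cgX Y -> cgX Z) (phi : cgG Y -> cgG Z) S h :
  (forall x y, phi (x * y^-1) = phi x * (phi y)^-1) ->
  (forall x, x \in S -> cval (f x) = phi (cval x)) ->
  gen [seq f x | x <- S] h <-> exists2 g, gen S g & phi g = h.
Proof.
move=> phid fE; have phi1 : phi 1 = 1 by rewrite -(mulgV 1) phid mulgV.
split.
  move: h; apply: gen_min; first exact: subgroup_image phi1 phid (gen_subgroup S).
  by move=> _ /mapP[x xS ->]; exists (cval x); [apply: mem_gen|rewrite fE //].
case=> g + <-; move: g; apply: gen_min => [|x xS]; last first.
  by rewrite /= -fE //; apply: mem_gen (map_f _ xS).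
split; first by rewrite /= phi1; apply: gen1.
by move=> x y Sx Sy; rewrite /= phid; apply: (proj2 (gen_subgroup _)).
Qed.

(** * Free abelian groups *)

Fixpoint zext (m : nat) (B : cgroup) : cgroup :=
  if m is k.+1 then cg_prod cg_int (zext k B) else B.

Definition zpow (m : nat) : cgroup := zext m cg_triv.

Lemma commutative_zext m B :
  commutative_group (cgG B) -> commutative_group (cgG (zext m B)).
Proof.
move=> comB; elim: m => //= m IH x y.
by congr pair; [apply: GRing.addrC|apply: IH].
Qed.

Lemma commutative_zpow m : commutative_group (cgG (zpow m)).
Proof. by apply: commutative_zext => x y; rewrite [x]ord1 [y]ord1. Qed.

Lemma noetherian_zext m B : noetherian B -> noetherian (zext m B).
Proof. by move=> noB; elim: m => //= m; apply: noetherian_int_prod. Qed.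

Lemma noetherian_zpow m : noetherian (zpow m).
Proof. exact/noetherian_zext/noetherian_triv. Qed.

Section Join.
Variable B : cgroup.

Fixpoint join m : cgX (zpow m) -> cgX B -> cgX (zext m B) :=
  match m return cgX (zpow m) -> cgX B -> cgX (zext m B) with
  | 0 => fun _ y => y
  | k.+1 => fun v y => (v.1, join v.2 y)
  end.

Fixpoint gjoin m : cgG (zpow m) -> cgG B -> cgG (zext m B) :=
  match m return cgG (zpow m) -> cgG B -> cgG (zext m B) with
  | 0 => fun _ y => y
  | k.+1 => fun v y => (v.1, gjoin v.2 y)
  end.

Lemma cval_join m (v : cgX (zpow m)) y : cval (join v y) = gjoin (cval v) (cval y).
Proof. by elim: m v => //= m IH v; rewrite /cgprod_val /= IH. Qed.

Lemma gjoinD m (u v : cgG (zpow m)) y z :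
  gjoin (u * v^-1) (y * z^-1) = gjoin u y * (gjoin v z)^-1.
Proof. by elim: m u v => //= m IH u v; rewrite IH. Qed.

Lemma gjoinM m (u v : cgG (zpow m)) y z :
  gjoin (u * v) (y * z) = gjoin u y * gjoin v z.
Proof. by elim: m u v => //= m IH u v; rewrite IH. Qed.

Lemma gjoin_inj m (u v : cgG (zpow m)) y z :
  gjoin u y = gjoin v z -> u = v /\ y = z.
Proof.
elim: m u v => [|m IH] u v /=; first by rewrite [u]ord1 [v]ord1.
by case: u v => [a u] [c v] [-> /IH[-> ->]].
Qed.

Lemma computable_join m (X : codedType) (f : X -> cgX (zpow m)) (g : X -> cgX B) :
  computable f -> computable g -> computable (fun x => join (f x) (g x)).
Proof.
elim: m f => [|m IH] f Cf Cg //=; apply: computable_pair; first by comp.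
by apply: (IH (fun x => (f x).2)) => //; apply: (computable_snd (f := f)).
Qed.

(** The coordinates of Z^m are eliminated one after the other. *)
Lemma kernel_zext m : commutative_group (cgG B) -> noetherian B ->
  exists2 K : seq (cgX (zext m B)) -> seq (cgX B), computable K &
  forall b g, gen (K b) g <-> gen b (gjoin (1 : cgG (zpow m)) g).
Proof.
move=> comB noB; elim: m => [|m [K CK KP]]; first by exists id; [comp|].
have [K' CK' KP'] := kernel_step (commutative_zext (m := m) comB)
                                 (noetherian_zext (m := m) noB).
by exists (fun b => K (K' b)) => [|b g]; [comp | rewrite KP KP'].
Qed.

End Join.

Ltac comp_step ::=
  first [ comp_group
        | match goal with
          | |- computable (fun x => join _ _) => apply: computable_join
          end ].

(** The subgroup generated by ks omits 1 if and only if all of ks consists of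
    multiples of some d other than 1 and -1; this makes the negation
    semidecidable. *)
Lemma dec_gen_int1 : dec (fun ks : seq int => @gen cg_int ks 1%R).
Proof.
apply: post; first by apply: (semidec_gen (Y := cg_int) (g := fun=> 1%R)); comp.
apply: (eq_semidec (P := fun ks : seq int => exists d : int,
   ((d <> 1%R) /\ (d <> (-1)%R)) /\ forall k : int, k \in ks -> @gen cg_int [:: d] k)).
  move=> ks; have sk := @gen_subgroup cg_int ks.
  split=> [[d [[d1 dN1] dP]] k1|nk1].
    have := @gen_sub cg_int ks [:: d] dP _ k1.
    have : subgroup [set k : Zm | exists q : int, k = (q * d)%R].
      split; first by exists 0%R; rewrite GRing.mul0r.
      by move=> _ _ [p ->] [q ->]; exists (p - q)%R; rewrite GRing.mulrBl.
    move=> sd /(gen_min (Y := cg_int) sd)[|q E]; last first.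
      have : absz (q * d)%R = 1%N by rewrite -E.
      by rewrite abszM => /eqP; rewrite muln_eq1 => /andP[_ /eqP]; lia.
    by move=> s; rewrite inE => /eqP->; exists 1%R; rewrite GRing.mul1r.
  have [d dP] := int_subgroup sk; exists (Posz d); split.
    split=> //; case=> d1; apply: nk1; apply/dP; exists 1%R; lia.
  move=> k kks; have /dP[q Eq] := @mem_gen cg_int ks k kks.
  rewrite [k]Eq -gpow_int; apply: (subgroup_gpow _ (@gen_subgroup cg_int _)).
  by apply: (@mem_gen cg_int _ (Posz d)); rewrite inE eqxx.
by semi; apply: (semidec_gen (Y := cg_int)); comp.
Qed.

Section Zpow.
Variable m : nat.
Notation Y := (zpow m).
Let comY : commutative_group (cgG Y) := @commutative_zpow m.

Lemma commutative_zextint k : commutative_group (cgG (zext k cg_int)).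
Proof. by apply: commutative_zext => x y; apply: GRing.addrC. Qed.

(** c lies in <b> if and only if, in the subgroup of Z^m x Z generated by
    (c, 1) and the (s, 0) with s in b, the kernel of the projection to Z^m
    contains 1. *)
Lemma dec_gen_zpow : dec (fun p : seq (cgX Y) * cgX Y => gen p.1 (cval p.2)).
Proof.
have [K CK KP] := @kernel_zext cg_int m (fun x y => GRing.addrC x y) noetherian_int.
pose T (p : seq (cgX Y) * cgX Y) : seq (cgX (zext m cg_int)) :=
  [:: join p.2 (1%R : cgX cg_int)] ++ [seq join s (0%R : cgX cg_int) | s <- p.1].
apply: (eq_dec (P := fun p => @gen cg_int (K (T p)) 1%R)); last first.
  by apply: (dec_comp dec_gen_int1); rewrite /T; comp.
case=> b c; rewrite KP /T gen_cat; last exact: commutative_zextint.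
have mapP h : gen [seq join s (0%R : cgX cg_int) | s <- b] h <->
    exists2 g, gen b g & gjoin g (0%R : cgG cg_int) = h.
  apply: gen_map => [x y|x _]; last by rewrite cval_join.
  by rewrite -gjoinD mulgV.
have oneP h : gen [:: join c (1%R : cgX cg_int)] h <->
    exists2 q, @gen cg_int [:: 1%R] q & gjoin (gpow (cval c) q) q = h.
  rewrite -[[:: _]]/[seq join c (1%R : cgX cg_int) | _ <- [:: 1%R : int]].
  apply: (@gen_map cg_int) => [x y|x]; first by rewrite -gjoinD -gpowN -gpowD.
  by rewrite inE => /eqP->; rewrite cval_join.
split=> [[u [v [/oneP[q _ <-] /mapP[g bg <-]]]]|bc].
  rewrite -gjoinM => /gjoin_inj[]; rewrite -[q * _]/(q + 0)%R GRing.addr0 => E q1.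
  move: E; rewrite -q1 => /esym/mulg1_eq E.
  rewrite -[cval c]invgK E; exact: subgroupV (gen_subgroup b) bg.
exists (gjoin (cval c) (1%R : cgG cg_int)), (gjoin (cval c)^-1 (0%R : cgG cg_int)).
split.
- by apply/oneP; exists 1%R => //; apply: (@mem_gen cg_int); rewrite inE.
- by apply/mapP; exists (cval c)^-1 => //; apply: subgroupV (gen_subgroup b) bc.
- by rewrite -gjoinM mulgV.
Qed.

(** In the subgroup of Z^m x Z^m generated by the (s, s) with s in the first list
    and the (s, 1) with s in the second, the elements over 1 are the (1, g) with
    g in both subgroups. *)
Lemma zpow_intersection :
  exists2 I : seq (cgX Y) * seq (cgX Y) -> seq (cgX Y), computable I &
  forall p g, gen (I p) g <-> gen p.1 g /\ gen p.2 g.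
Proof.
have [K CK KP] := @kernel_zext Y m comY (@noetherian_zpow m).
exists (fun p => K ([seq join s s | s <- p.1] ++ [seq join s cg1 | s <- p.2])).
  by comp.
case=> b1 b2 g; rewrite KP gen_cat; last exact: commutative_zext.
have map1 h : gen [seq join s s | s <- b1] h <-> exists2 g, gen b1 g & gjoin g g = h.
  by apply: gen_map => [x y|x _]; rewrite -?gjoinD ?cval_join.
have map2 h : gen [seq join s cg1 | s <- b2] h <->
    exists2 g, gen b2 g & gjoin g (1 : cgG Y) = h.
  by apply: gen_map => [x y|x _]; rewrite -?gjoinD ?mulgV ?cval_join ?cval1.
split=> [[u [v [/map1[y b1y <-] /map2[z b2z <-]]]]|[b1g b2g]].
  rewrite -gjoinM mulg1 => /gjoin_inj[/esym/mulg1_eq yz ->]; split=> //.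
  by rewrite -[y]invgK yz; apply: subgroupV (gen_subgroup b2) b2z.
exists (gjoin g g), (gjoin g^-1 (1 : cgG Y)); split.
- by apply/map1; exists g.
- by apply/map2; exists g^-1 => //; apply: subgroupV (gen_subgroup b2) b2g.
- by rewrite -gjoinM mulgV mulg1.
Qed.

End Zpow.

(** * Free reduction *)

(** Free reduction with respect to a formal inversion of letters. It is used for
    the letters of F, and for signed elements of F when words in a subset of F
    are considered. *)
Section Push.
Variables (L : eqType) (inv : L -> L).

Definition push (p : L) (s : seq L) : seq L :=
  if s is q :: s' then if q == inv p then s' else p :: s else [:: p].

Definition irreducible (s : seq L) : bool := sorted (fun p q => q != inv p) s.

Lemma irreducible_push p s : irreducible s -> irreducible (push p s).
Proof.
case: s => //= q s; case: ifP => [_|/negbT qp] sred; last by rewrite /= qp.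
by case: s sred => //= r s /andP[].
Qed.

Lemma pushK p s : involutive inv -> irreducible s -> push (inv p) (push p s) = s.
Proof.
move=> invK; case: s => [|q s] /= sred; first by rewrite invK eqxx.
case: eqP => [Eq|_] /=; last by rewrite invK eqxx.
case: s sred => [|r s] /=; first by rewrite Eq.
by rewrite Eq invK => /andP[/negPf->].
Qed.

Lemma push_cons p s : irreducible (p :: s) -> push p s = p :: s.
Proof. by case: s => //= q s /andP[/negPf->]. Qed.

Lemma mem_push p s q : q \in push p s -> q = p \/ q \in s.
Proof.
case: s => [|r s] /=; first by rewrite inE => /eqP; left.
case: ifP => _; first by rewrite inE => ->; right; rewrite orbT.
by rewrite inE => /predU1P.
Qed.

End Push.

Section Words.
Variables (n : nat) (F : groupType) (x : 'I_n -> F).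
Implicit Types (l : nat * nat) (w : seq (nat * nat)).

(** Letters outside the alphabet have the value 1 and any nonzero sign means
    inversion, so that all lists of pairs are meaningful. *)
Definition letter l : F :=
  if insub l.1 is Some i then if l.2 == 0 then x i else (x i)^-1 else 1.

Definition wval w : F := foldr (fun l g => letter l * g) 1 w.

Definition flip l : nat * nat := (l.1, l.2 == 0 : nat).
Definition unit_sign l : nat * nat := (l.1, l.2 != 0 : nat).
Definition winv w := rev [seq flip l | l <- w].

Lemma letter_flip l : letter (flip l) = (letter l)^-1.
Proof.
rewrite /letter /=; case: insubP => [i _ _|_]; last by rewrite invg1.
by case: (l.2 == 0); rewrite /= ?invgK.
Qed.

Lemma letter_unit_sign l : letter (unit_sign l) = letter l.
Proof. by rewrite /letter /=; case: (l.2 == 0). Qed.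

Lemma letter_large l : n <= l.1 -> letter l = 1.
Proof. by move=> le_n; rewrite /letter insubF // ltnNge le_n. Qed.

Lemma wval_cat w1 w2 : wval (w1 ++ w2) = wval w1 * wval w2.
Proof. by elim: w1 => [|l w IH] /=; rewrite ?mul1g // IH mulgA. Qed.

Lemma wval_winv w : wval (winv w) = (wval w)^-1.
Proof.
elim: w => [|l w IH] /=; first by rewrite invg1.
by rewrite /winv map_cons rev_cons -cats1 wval_cat IH /= mulg1 letter_flip invgM.
Qed.

Definition wnf w : seq (nat * nat) :=
  foldr (fun l s => if l.1 < n then push flip (unit_sign l) s else s) [::] w.

Lemma wval_push l s : wval (push flip (unit_sign l) s) = letter l * wval s.
Proof.
case: s => [|q s] /=; first by rewrite letter_unit_sign.
case: eqP => [->|_] /=; last by rewrite letter_unit_sign.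
by rewrite letter_flip letter_unit_sign mulVKg.
Qed.

Lemma wval_wnf w : wval (wnf w) = wval w.
Proof.
elim: w => //= l w IH; case: ltnP => [_|le_n]; first by rewrite wval_push IH.
by rewrite IH letter_large // mul1g.
Qed.

Lemma wnf_irreducible w : irreducible flip (wnf w).
Proof. by elim: w => //= l w IH; case: ifP => // _; apply: irreducible_push. Qed.

Lemma wnf_letters w l : l \in wnf w -> l.1 < n /\ l.2 < 2.
Proof.
elim: w l => //= l w IH q; case: ifP => [lt_n|_]; last exact: IH.
by case/mem_push=> [->|/IH//]; split=> //=; case: (l.2 != 0).
Qed.

Hypotheses (x_inj : injective x) (x_basis : free_basis (range x) [set: F]).

(** An irreducible word in the letters is a reduced word in the free basis,
    hence has a nontrivial value unless it is empty. *)
Lemma wval_eq1 w : wval w = 1 -> wnf w = [::].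
Proof.
rewrite -wval_wnf; have := wnf_irreducible w; have := @wnf_letters w.
move: (wnf w) => s s_let s_irr sval; apply/eqP/contraT => /eqP s_nnil; exfalso.
have s_ord l : l \in s -> exists i : 'I_n, l.1 = i.
  by case/s_let=> lt_n _; exists (Ordinal lt_n).
have letter0 (i : 'I_n) : letter (i : nat, 0) = x i by rewrite /letter /= valK.
pose t := [seq (letter (l.1, 0), l.2 != 0) | l <- s].
case: x_basis => _ /(_ t); apply; first by rewrite /t; case: (s) s_nnil.
- rewrite /reduced /t; elim: s {s_nnil sval t} s_let s_irr s_ord => //= l s IH s_let.
  case: s IH s_let => //= q s IH s_let /andP[ql s_irr] s_ord.
  rewrite IH // ?andbT; first 1 last.
  + by move=> r rs; apply: s_let; rewrite inE rs orbT.
  + by move=> r rs; apply: s_ord; rewrite inE rs orbT.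
  have [|i li] := s_ord l; first by rewrite inE eqxx.
  have [|j qj] := s_ord q; first by rewrite !inE eqxx orbT.
  rewrite li qj !letter0; apply/implyP => /eqP/x_inj ij.
  have [|_ l2] := s_let l; first by rewrite inE eqxx.
  have [|_ q2] := s_let q; first by rewrite !inE eqxx orbT.
  move: ql; case: q qj q2 {s_let s_ord IH s_irr} => a b /= -> b2.
  rewrite /flip li ij; case: l l2 {li} => c [|[|//]] /= _; case: b b2 => [|[|//]] //= _.
    by rewrite eqxx.
  by rewrite eqxx.
- move=> _ /mapP[l /s_ord[i li] ->] /=; rewrite li letter0; by exists i.
rewrite -sval /word_val /t big_map.
elim: s s_ord {s_let s_irr sval s_nnil t} => [|l s IH] s_ord.
  by rewrite big_nil.
rewrite big_cons IH /=; last by move=> r rs; apply: s_ord; rewrite inE rs orbT.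
congr (_ * _); have [|i li] := s_ord l; first by rewrite inE eqxx.
by rewrite /letter /= li valK /=; case: (l.2 == 0).
Qed.

Lemma wval_surj g : exists w, wval w = g.
Proof.
have : subgroup_gen (range x) g by rewrite (proj1 x_basis).
move: g; apply: subgroup_gen_min => [|_ [i _ <-]]; last first.
  by exists [:: (i : nat, 0)]; rewrite /= mulg1 /letter /= valK.
split; first by exists [::].
by move=> _ _ [u <-] [v <-]; exists (u ++ winv v); rewrite wval_cat wval_winv.
Qed.

(** Partial actions of the letters by mutually inverse injections, defined
    where [ok] holds, factor through the free group: a word with trivial value
    fixes each state on which it is defined, because free reduction removes
    steps that undo each other. *)
Section Walk.
Variables (Z : Type) (ok : Z -> Prop) (step : nat * nat -> Z -> Z).
Hypothesis step_inv : forall l z,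
  ok (step l z) -> ok z /\ step (flip l) (step l z) = z.
Hypothesis step_large : forall l z, n <= l.1 -> step l z = z.
Hypothesis step_sign : forall l z, step (unit_sign l) z = step l z.

Definition walk w z := foldr step z w.

Lemma walk_cat u v z : walk (u ++ v) z = walk u (walk v z).
Proof. by rewrite /walk foldr_cat. Qed.

Lemma walk_winv w z : ok (walk w z) -> walk (winv w) (walk w z) = z.
Proof.
elim: w => //= l w IH okw; have [okw' E] := step_inv okw.
by rewrite /winv map_cons rev_cons -cats1 walk_cat /= E; apply: IH.
Qed.

Lemma walk_wnf w z : ok (walk w z) -> walk (wnf w) z = walk w z.
Proof.
elim: w => //= l w IH okw; have [okw' E] := step_inv okw.
case: ltnP => [_|le_n]; last by rewrite IH // step_large.
have := IH okw'; case: (wnf w) => [|q s] /=; first by move=> <-; rewrite step_sign.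
case: eqP => [->|_] /= Ez; last by rewrite Ez step_sign.
have [|_ E'] := @step_inv (flip (unit_sign l)) (walk s z).
  by rewrite Ez.
rewrite Ez in E'; rewrite -[LHS]E' -[in RHS]step_sign; congr (step _ _).
by rewrite /flip /unit_sign /=; case: (l.2 == 0).
Qed.

Lemma walk_eq1 w z : wval w = 1 -> ok (walk w z) -> walk w z = z.
Proof. by move=> /wval_eq1 w1 /walk_wnf <-; rewrite w1. Qed.

Lemma walk_eq u v z : wval u = wval v -> ok (walk u z) -> ok (walk v z) ->
  walk u z = walk v z.
Proof.
move=> uv oku okv.
have E := walk_winv okv.
have : walk (u ++ winv v) (walk v z) = walk v z.
  apply: walk_eq1; first by rewrite wval_cat wval_winv uv mulgV.
  by rewrite walk_cat E.
by rewrite walk_cat E.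
Qed.

End Walk.

(** ** Words as a computable group *)

Lemma dec_wval : dec (fun p : seq (nat * nat) * seq (nat * nat) => wval p.1 = wval p.2).
Proof.
apply: (eq_dec (P := fun p => wnf (p.1 ++ winv p.2) = [::])).
  move=> [u v] /=; split=> [E|uv].
    apply/(@mulIg _ (wval v)^-1); rewrite mulgV -wval_winv -wval_cat -wval_wnf.
    by rewrite E.
  by apply: wval_eq1; rewrite wval_cat wval_winv uv mulgV.
apply: dec_eq; last by comp.
have pushE p (s : seq (nat * nat)) : push flip p s =
    if s == [::] then [:: p] else
    if (uncons s).1 == flip p then (uncons s).2 else p :: s.
  by case: s => [|q s] //; rewrite uncons_cons.
have Cflip : computable flip by rewrite /flip; comp.
have Csign : computable unit_sign by rewrite /unit_sign; comp.
rewrite /wnf /winv; comp.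
apply: (eq_computable (f := fun p => if p.2.2 == [::] then [:: unit_sign p.2.1] else
   if (uncons p.2.2).1 == flip (unit_sign p.2.1) then (uncons p.2.2).2
   else unit_sign p.2.1 :: p.2.2)) => [p|]; last by comp.
by rewrite pushE.
Qed.

Lemma computable_winv : computable winv.
Proof.
have Cflip : computable flip by rewrite /flip; comp.
rewrite /winv; apply: computable_rev.
by apply: (computable_map (s := fun w => w)); comp.
Qed.

Lemma computable_wcat :
  computable (fun p : seq (nat * nat) * seq (nat * nat) => p.1 ++ p.2).
Proof. by comp. Qed.

Definition cg_word : cgroup :=
  @CGroup (seq (nat * nat))%type F wval [::] cat winv
    erefl wval_cat wval_winv computable_wcat computable_winv dec_wval.

End Words.

(** * Least coset representatives *)

Lemma ltn_cpair2 a b c : b < c -> cpair a b < cpair a c.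
Proof.
have := Cantor.to_nat_spec a b; have := Cantor.to_nat_spec a c.
by rewrite /cpair; move: (Cantor.to_nat _) (Cantor.to_nat _) => u v; nia.
Qed.

Section Rep.
Variables (n : nat) (F : groupType) (x : 'I_n -> F).
Hypotheses (x_inj : injective x) (x_basis : free_basis (range x) [set: F]).
Variables (K : set F) (sK : subgroup K).
Implicit Types (g h : F).

Let ex_vtx g : exists k, `[< K ((wval x (decode k))^-1 * g) >].
Proof.
have [w <-] := wval_surj x_basis g; exists (code w); apply/asboolP.
by rewrite codeK mulVg; apply: subgroup1.
Qed.

Definition vtx g : nat := ex_minn (ex_vtx g).
Definition rep g : seq (nat * nat) := decode (vtx g).

Lemma code_rep g : code (rep g) = vtx g. Proof. exact: decodeK. Qed.

Lemma rep_coset g : K ((wval x (rep g))^-1 * g).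
Proof. by rewrite /rep /vtx; case: ex_minnP => k /asboolP. Qed.

Lemma rep_min g w : K ((wval x w)^-1 * g) -> code (rep g) <= code w.
Proof.
rewrite code_rep /vtx; case: ex_minnP => k _ k_min Kw; apply: k_min.
by apply/asboolP; rewrite codeK.
Qed.

Lemma coset_sym g h : K (g^-1 * h) -> K (h^-1 * g).
Proof. by move=> /(subgroupV sK); rewrite invgM invgK. Qed.

Lemma coset_trans g h k : K (g^-1 * h) -> K (h^-1 * k) -> K (g^-1 * k).
Proof. by move=> gh hk; have := subgroupM sK gh hk; rewrite mulgA mulgK. Qed.

Lemma rep_eq g h : K (g^-1 * h) -> rep g = rep h.
Proof.
move=> gh; apply: code_inj; apply/eqP; rewrite eqn_leq; apply/andP; split.
  by apply: rep_min; apply: coset_trans (rep_coset h) (coset_sym gh).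
by apply: rep_min; apply: coset_trans (rep_coset g) gh.
Qed.

Lemma rep_inj g h : rep g = rep h -> K (g^-1 * h).
Proof.
move=> gh; apply: coset_trans (coset_sym (rep_coset g)) _.
by rewrite gh; apply: rep_coset.
Qed.

Lemma rep_wval_rep g : rep (wval x (rep g)) = rep g.
Proof. exact/rep_eq/rep_coset. Qed.

Lemma rep_mem g : K g -> rep g = [::].
Proof.
move=> Kg; apply: code_inj; apply/eqP; rewrite -leqn0 -[0]/(code ([::] : seq (nat * nat))).
by apply: rep_min; rewrite /= invg1 mul1g.
Qed.

Lemma coset_mull a g h : K ((a * g)^-1 * (a * h)) <-> K (g^-1 * h).
Proof. by rewrite invgM -mulgA mulKg. Qed.

(** The least representatives form a Schreier transversal: the code of a list
    increases with the code of its tail, so a smaller representative of the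
    coset of the tail would give a smaller one of the whole coset. *)
Lemma rep_tail g l q : rep g = l :: q -> rep (wval x q) = q.
Proof.
move=> Eg; apply: code_inj; apply/eqP; rewrite eqn_leq; apply/andP; split.
  by apply: rep_min; rewrite mulVg; apply: subgroup1.
rewrite leqNgt; apply/negP => lt_q.
have : code (rep g) <= code (l :: rep (wval x q)).
  apply: rep_min; apply: coset_trans (rep_coset g); rewrite Eg /= coset_mull.
  exact: rep_coset.
by rewrite Eg !code_cons ltnS !code_pair leqNgt ltn_cpair2.
Qed.

End Rep.

(** * Folded graphs *)

Section Graph.
Variables (n : nat) (F : groupType) (x : 'I_n -> F).
Hypotheses (x_inj : injective x) (x_basis : free_basis (range x) [set: F]).
Variable Y : cgroup.
Hypothesis comY : commutative_group (cgG Y).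

(** The edge ((u, i), (v, c)) leads from the vertex u to the vertex v along the
    i-th free generator and carries the label c. The vertex 0 is reserved for
    failure, and walks start at the vertex 1. *)
Definition edge : codedType := ((nat * nat) * (nat * cgX Y))%type.
Implicit Types (Gr : seq edge) (e : edge) (l : nat * nat).

(** An edge is determined by its generator together with either of its ends, so
    each letter acts on the vertices by a partial injection. *)
Definition folded Gr : Prop := forall e, e \in Gr ->
  (e.1.1 <> 0 /\ e.2.1 <> 0) /\ forall e', e' \in Gr ->
    e.1.2 <> e'.1.2 \/ ((e.1.1 <> e'.1.1 /\ e.2.1 <> e'.2.1) \/ e = e').

Definition look Gr l (v : nat) : nat * cgX Y :=
  foldr (fun e r => if (e.1.2 == l.1) && ((if l.2 == 0 then e.1.1 else e.2.1) == v)
     then (if l.2 == 0 then e.2 else (e.1.1, cgV e.2.2)) else r) (0, cg1) Gr.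

Definition gstep Gr l (st : nat * cgX Y) : nat * cgX Y :=
  if l.1 < n then ((look Gr l st.1).1, cgM (look Gr l st.1).2 st.2) else st.

Definition gwalk Gr (w : seq (nat * nat)) : nat * cgX Y :=
  foldr (gstep Gr) (1%N, cg1) w.

(** The step as seen in the group: labels have their values instead of their
    names, so that the step of an inverse letter is an exact inverse. *)
Definition sstep Gr l (st : nat * cgG Y) : nat * cgG Y :=
  if l.1 < n then ((look Gr l st.1).1, cval (look Gr l st.1).2 * st.2) else st.

Definition swalk Gr w (st : nat * cgG Y) : nat * cgG Y := walk (sstep Gr) w st.

Lemma gwalkE Gr w : ((gwalk Gr w).1, cval (gwalk Gr w).2) = swalk Gr w (1%N, 1).
Proof.
rewrite /gwalk /swalk /walk; elim: w => [|l w IH] /=; first by rewrite cval1.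
by rewrite -IH /gstep /sstep; case: ifP => //= _; rewrite cvalM.
Qed.

Lemma swalk_mul Gr w v g h :
  swalk Gr w (v, g * h) = ((swalk Gr w (v, g)).1, (swalk Gr w (v, g)).2 * h).
Proof.
rewrite /swalk /walk; elim: w => //= l w ->.
by rewrite /sstep; case: ifP => //= _; rewrite mulgA.
Qed.

Section Folded.
Variable Gr : seq edge.
Hypothesis Gr_folded : folded Gr.

Lemma look_edge e l : e \in Gr -> e.1.2 = l.1 ->
  look Gr l (if l.2 == 0 then e.1.1 else e.2.1)
  = if l.2 == 0 then e.2 else (e.1.1, cgV e.2.2).
Proof.
move=> eGr el; have := (Gr_folded eGr).2; move: (eGr); rewrite /look.
elim: (Gr) => //= e' Gr' IH; rewrite inE => eG uniq; case: ifP => [|/negbT].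
  case/andP=> /eqP e'l /eqP E.
  have [|//|[[n1 n2]|<-//]] := uniq e'; first by rewrite inE eqxx.
    by rewrite el e'l.
  by case: ifP E => _ E; [case: n1|case: n2].
move=> ne; case/predU1P: eG => [Ee|eG]; last first.
  by apply: IH => // f fG; apply: uniq; rewrite inE fG orbT.
by case/negP: ne; rewrite -Ee el !eqxx.
Qed.

Lemma look_ok l v : (look Gr l v).1 <> 0 -> exists e, [/\ e \in Gr, e.1.2 = l.1,
  v = (if l.2 == 0 then e.1.1 else e.2.1)
  & look Gr l v = if l.2 == 0 then e.2 else (e.1.1, cgV e.2.2)].
Proof.
rewrite /look; elim: (Gr) => //= e Gr' IH; case: ifP => [/andP[/eqP el /eqP ev] _|_].
  by exists e; split=> //; rewrite inE eqxx.
by case/IH=> f [fG fl fv ->]; exists f; split=> //; rewrite inE fG orbT.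
Qed.

Definition alive (st : nat * cgG Y) : Prop := st.1 <> 0.

Lemma sstep_inv l st : alive (sstep Gr l st) ->
  alive st /\ sstep Gr (flip l) (sstep Gr l st) = st.
Proof.
rewrite /sstep /=; case: ifP => [lt_n|//]; case: st => v g /= /look_ok[e [eG el -> ->]].
have [[src tgt] _] := Gr_folded eG.
have := @look_edge e (flip l) eG el.
rewrite /flip /=; case: (l.2 == 0) => /= ->; rewrite /alive /=; split=> //.
  by rewrite cvalV mulKg.
by rewrite cvalV mulVKg.
Qed.

Lemma sstep_large l st : n <= l.1 -> sstep Gr l st = st.
Proof. by rewrite /sstep ltnNge => ->. Qed.

Lemma sstep_sign l st : sstep Gr (unit_sign l) st = sstep Gr l st.
Proof. by rewrite /sstep /look /=; case: (l.2 == 0). Qed.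

Lemma swalk_eq u v st : wval x u = wval x v ->
  alive (swalk Gr u st) -> alive (swalk Gr v st) -> swalk Gr u st = swalk Gr v st.
Proof. exact: (walk_eq x_inj x_basis sstep_inv sstep_large sstep_sign). Qed.

Lemma swalk_winv w st : alive (swalk Gr w st) -> swalk Gr (winv w) (swalk Gr w st) = st.
Proof. exact: (walk_winv sstep_inv). Qed.

End Folded.

Definition closes Gr (b : seq (cgX Y)) (s : seq (nat * nat) * cgX Y) : Prop :=
  (gwalk Gr s.1).1 = 1%N /\ gen b (cval (cgM (cgV (gwalk Gr s.1).2) s.2)).

Notation FY := (cg_prod (cg_word x_inj x_basis) Y).

(** The elements represented by a loop with the right label modulo <b> form a
    subgroup. *)
Lemma gen_closes Gr b S h : folded Gr -> (forall s, s \in S -> closes Gr b s) ->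
  @gen FY S h -> exists w, [/\ wval x w = h.1, (swalk Gr w (1%N, 1)).1 = 1%N
    & gen b ((swalk Gr w (1%N, 1)).2^-1 * h.2)].
Proof.
move=> fG Sb; move: h; apply: gen_min => [|s /Sb[s1 s2]]; last first.
  exists s.1; rewrite -gwalkE; split=> //=.
  by move: s2; rewrite cvalM cvalV.
split; first by exists [::]; split=> //=; rewrite mulVg; apply: gen1.
move=> g h [u [ug u1 ub]] [v [vh v1 vb]]; exists (u ++ winv v).
have okv : alive (swalk Gr v (1%N, 1)) by rewrite /alive v1.
have Ev : swalk Gr (winv v) (1%N, 1) = (1%N, (swalk Gr v (1%N, 1)).2^-1).
  have E := swalk_winv fG okv; move: E; set r := swalk Gr v (1%N, 1).
  have Er : r = (1%N, 1 * r.2) by rewrite mul1g -v1 -surjective_pairing.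
  rewrite {1}Er swalk_mul; case: (swalk Gr (winv v) (1%N, 1)) => a c [-> E].
  by have := canRL (mulgK _) E; rewrite mul1g => ->.
have Euv : swalk Gr (u ++ winv v) (1%N, 1)
    = (1%N, (swalk Gr u (1%N, 1)).2 * (swalk Gr v (1%N, 1)).2^-1).
  rewrite /swalk walk_cat -!/(swalk _ _ _) Ev.
  by rewrite -{1}[_^-1]mul1g swalk_mul u1.
rewrite Euv; split=> //=; first by rewrite wval_cat wval_winv ug vh.
have := proj2 (gen_subgroup b) _ _ ub vb; congr (gen b _).
by rewrite !invgM !invgK -!mulgA [RHS]comY -!mulgA; congr (_ * (_ * _)); rewrite comY.
Qed.

End Graph.

(** * Subgroups of a product of a free and an abelian group *)

Section FreeByAbelian.
Variables (n : nat) (F : groupType) (x : 'I_n -> F).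
Hypotheses (x_inj : injective x) (x_basis : free_basis (range x) [set: F]).
Variable Y : cgroup.
Hypotheses (comY : commutative_group (cgG Y)) (noY : noetherian Y).
Hypothesis decY : dec (fun p : seq (cgX Y) * cgX Y => gen p.1 (cval p.2)).

Notation FY := (cg_prod (cg_word x_inj x_basis) Y).
Notation word := (seq (nat * nat)).
Notation proj H := [set g.1 | g in H].

(** A finite part of the coset graph of the projection of H to F. The vertices
    are the cosets, numbered by their least representatives; the edge from the
    coset of g along a generator y is labelled by an element that lifts
    rep(y g)^-1 y rep(g) to H. *)
Section Existence.
Variable H : set (F * cgG Y).
Hypothesis sH : subgroup H.

Lemma proj_subgroup : subgroup (proj H).
Proof. exact: subgroup_image. Qed.

Notation vtxH := (vtx x_basis proj_subgroup).
Notation repH := (rep x_basis proj_subgroup).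
Notation wvalx := (wval x).

Lemma ex_label (k i : nat) : exists c : cgX Y, forall g,
  vtxH g = k ->
  H ((wvalx (repH (letter x (i, 0) * g)))^-1 * (letter x (i, 0) * wvalx (repH g)), cval c).
Proof.
have [[g Eg]|ng] := pselect (exists g, vtxH g = k); last first.
  by exists cg1 => g Eg; case: ng; exists g.
set h := (wvalx (repH (letter x (i, 0) * g)))^-1 * (letter x (i, 0) * wvalx (repH g)).
have : proj H h.
  apply: (coset_trans proj_subgroup (rep_coset x_basis proj_subgroup _)).
  apply: (proj2 (coset_mull _ _ _ _)).
  by apply: (coset_sym proj_subgroup); apply: rep_coset.
case=> -[h' a] Ha /= h'E; rewrite h'E in Ha.
have [b bP] := noY (subgroup_gen_subgroup [set: cgG Y]).
have /bP/genP[l [_ El]] : subgroup_gen [set: cgG Y] a by apply: subset_subgroup_gen.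
exists (sprod l) => g' Eg'; rewrite El.
have Er : repH g = repH g' by apply: code_inj; rewrite !code_rep Eg Eg'.
suff -> : repH (letter x (i, 0) * g') = repH (letter x (i, 0) * g) by rewrite -Er.
by apply: rep_eq; apply: (proj2 (coset_mull _ _ _ _)); apply: (rep_inj (esym Er)).
Qed.

Definition label (k i : nat) : cgX Y := projT1 (cid (ex_label k i)).

Definition coset_edge (g : F) (i : nat) : edge Y :=
  (((vtxH g).+1, i), ((vtxH (letter x (i, 0) * g)).+1, label (vtxH g) i)).

Fixpoint word_edges (w : word) : seq (edge Y) :=
  if w is l :: q then
    coset_edge (if l.2 == 0 then wvalx q else wvalx w) l.1 :: word_edges q
  else [::].

Definition coset_graph (W : seq word) : seq (edge Y) := flatten (map word_edges W).

Lemma mem_coset_graph W e : e \in coset_graph W -> exists g i, e = coset_edge g i.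
Proof.
case/flattenP=> _ /mapP[w _ ->]; elim: w => //= l q IH.
by rewrite inE => /predU1P[->|/IH//]; do 2 eexists.
Qed.

Lemma vtx_rep g h : vtxH g = vtxH h <-> repH g = repH h.
Proof. by split=> [E|E]; [apply: code_inj; rewrite !code_rep|rewrite -!code_rep E]. Qed.

Lemma vtx_mull a g h : vtxH (a * g) = vtxH (a * h) <-> vtxH g = vtxH h.
Proof.
rewrite !vtx_rep; split=> /rep_inj E; apply: rep_eq.
  exact: (proj1 (coset_mull _ a _ _) E).
exact: (proj2 (coset_mull _ a _ _) E).
Qed.

Lemma coset_graph_folded W : folded (coset_graph W).
Proof.
move=> _ /mem_coset_graph[g [i ->]]; split=> // _ /mem_coset_graph[h [j ->]] /=.
have [<-|ij] := eqVneq i j; last by left; apply/eqP.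
right; have [E|E] := eqVneq (vtxH g) (vtxH h).
  by right; rewrite /coset_edge E; congr (_, (_.+1, _)); apply/vtx_mull.
by left; split; [case=> E' | case=> /vtx_mull E']; case/eqP: E.
Qed.

(** Along the walk of w the label lifts rep(w)^-1 w to H. *)
Lemma coset_graph_walk W w : w \in W -> exists c,
  swalk n (coset_graph W) w (1%N, 1) = ((vtxH (wvalx w)).+1, c) /\
  H ((wvalx (repH (wvalx w)))^-1 * wvalx w, c).
Proof.
move=> wW; set Gr := coset_graph W; have fG : folded Gr by apply: coset_graph_folded.
have : {subset word_edges w <= Gr}.
  by move=> e ew; apply/flattenP; exists (word_edges w); rewrite ?map_f.
elim: w {wW} => [|l q IH] sub.
  have r1 : repH 1 = [::] by apply: rep_mem; apply: subgroup1 proj_subgroup.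
  exists 1; split; first by rewrite /= -(code_rep _ _) r1.
  by rewrite /= r1 /= mulg1 invg1; apply: subgroup1 sH.
have [|c [Ec Hc]] := IH; first by move=> e eq; apply: sub; rewrite inE eq orbT.
rewrite [swalk _ _ _ _]/(sstep n Gr l (swalk n Gr q (1%N, 1))) Ec /sstep.
case: ltnP => [lt_n|le_n]; last first.
  by exists c; rewrite /= letter_large // mul1g.
have eG : coset_edge (if l.2 == 0 then wvalx q else wvalx (l :: q)) l.1 \in Gr.
  by apply: sub; rewrite inE eqxx.
have := look_edge (l := l) fG eG erefl; set y := letter x (l.1, 0).
have labelP g : H ((wvalx (repH (y * g)))^-1 * (y * wvalx (repH g)),
                   cval (label (vtxH g) l.1)).
  by rewrite /label; case: cid => c' /= cP; apply: cP.
have letterE : letter x l = if l.2 == 0 then y else y^-1.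
  rewrite -(letter_unit_sign x l) -[y^-1](letter_flip x (l.1, 0)) /unit_sign /flip /=.
  by case: (l.2 == 0).
rewrite /= letterE; case: (l.2 == 0) => /=; rewrite -/y => E; last first.
  rewrite mulVKg in E; rewrite E; eexists; split; first by [].
  have := subgroupM sH (subgroupV sH (labelP (y^-1 * wvalx q))) Hc.
  congr (H (_, _)); last by rewrite cvalV.
  by rewrite mulVKg /= !invgM invgK -!mulgA mulVKg.
rewrite E; eexists; split; first by [].
have := subgroupM sH (labelP (wvalx q)) Hc; congr (H (_, _)).
by rewrite /= -!mulgA mulVKg.
Qed.

End Existence.
Lemma computable_gwalk (X : codedType) (Gr : X -> seq (edge Y)) (w : X -> word) :
  computable Gr -> computable w -> computable (fun x => gwalk n (Gr x) (w x)).
Proof. by move=> CG Cw; rewrite /gwalk /gstep /look; comp. Qed.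

Lemma dec_folded (X : codedType) (Gr : X -> seq (edge Y)) :
  computable Gr -> dec (fun x => folded (Gr x)).
Proof.
move=> CG; apply: dec_all => //; comp.
by apply: dec_all => //; comp.
Qed.

Lemma dec_closes (X : codedType) (Gr : X -> seq (edge Y)) (b : X -> seq (cgX Y))
    (s : X -> word * cgX Y) :
  computable Gr -> computable b -> computable s ->
  dec (fun x => closes n (Gr x) (b x) (s x)).
Proof.
move=> CG Cb Cs; apply: dec_and.
  by apply: dec_eq; comp; apply: computable_gwalk; comp.
apply: (dec_comp decY (f := fun x => (b x, _))); comp.
by apply: computable_gwalk; comp.
Qed.

(** Completeness of the certificates. The graph follows the words of S and the
    extra word w, and b generates the abelian part of <S>; closing up is then the
    same as representing an element of <S>. *)
Lemma folded_certificate (S : seq (word * cgX Y)) (w : word) : exists b Gr,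
  [/\ folded Gr, forall s, s \in S -> closes n Gr b s,
      forall a, gen b a <-> @gen FY S (1, a),
      (gwalk n Gr w).1 <> 0
    & forall a, closes n Gr b (w, a) -> @gen FY S (wval x w, cval a)].
Proof.
have sS := @gen_subgroup FY S.
have sL : subgroup [set a | @gen FY S (1, a)].
  split; first exact: subgroup1 sS.
  move=> a c La Lc; have := proj2 sS _ _ La Lc; congr (@gen FY S (_, _)).
  by rewrite /= mulgV.
have [b bP] := noY sL; pose Gr := coset_graph sS (w :: [seq s.1 | s <- S]).
have closesE s c : swalk n Gr s.1 (1%N, 1) =
      ((vtx x_basis (proj_subgroup sS) (wval x s.1)).+1, c) ->
    @gen FY S ((wval x (rep x_basis (proj_subgroup sS) (wval x s.1)))^-1 * wval x s.1, c) ->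
    closes n Gr b s <-> @gen FY S (wval x s.1, cval s.2).
  move=> Ew Hc; have E1 := f_equal fst (gwalkE n Gr s.1).
  have E2 := f_equal snd (gwalkE n Gr s.1); rewrite Ew /= in E1 E2.
  rewrite /closes E1 cvalM cvalV E2; split=> [[]|Hs].
    move=> [v0] /bP/= Hcs; have r0 : rep x_basis (proj_subgroup sS) (wval x s.1) = [::].
      by apply: code_inj; rewrite code_rep v0.
    rewrite r0 /= invg1 mul1g in Hc.
    by have := subgroupM sS Hc Hcs; congr (@gen FY S (_, _)); rewrite /= ?mulg1 ?mulVKg.
  have r0 : rep x_basis (proj_subgroup sS) (wval x s.1) = [::].
    by apply: rep_mem; eexists; first exact: Hs.
  rewrite r0 /= invg1 mul1g in Hc.
  split; first by rewrite -(code_rep _ _) r0.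
  apply/bP; have := subgroupM sS (subgroupV sS Hc) Hs.
  by congr (@gen FY S (_, _)); rewrite /= mulVg.
exists b, Gr; split=> //.
- exact: coset_graph_folded.
- move=> s sS'.
  have [|c [Ew Hc]] := coset_graph_walk sS (W := w :: [seq s.1 | s <- S]) (w := s.1).
    by rewrite inE map_f ?orbT.
  by apply/(closesE _ _ Ew Hc); exact: (@mem_gen FY S s).
- have [|c [Ew Hc]] := coset_graph_walk sS (W := w :: [seq s.1 | s <- S]) (w := w).
    by rewrite inE eqxx.
  by have E1 := f_equal fst (gwalkE n Gr w); rewrite Ew /= in E1; rewrite E1.
- move=> a; have [|c [Ew Hc]] := coset_graph_walk sS (W := w :: [seq s.1 | s <- S]) (w := w).
    by rewrite inE eqxx.
  by move/(closesE (w, a) c Ew Hc).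
Qed.

(** The elements of the abelian factor in a finitely generated subgroup: a list
    of such elements generates all of them as soon as some folded graph with
    labels modulo that list closes up on the generators. *)
Lemma abelian_part : exists2 K : seq (word * cgX Y) -> seq (cgX Y), computable K &
  forall S a, gen (K S) a <-> @gen FY S (1, a).
Proof.
pose P (S : seq (word * cgX Y)) (b : seq (cgX Y)) :=
  (forall y, y \in b -> @gen FY S (@cval FY ([::], y))) /\
  exists Gr : seq (edge Y), folded Gr /\ forall s, s \in S -> closes n Gr b s.
have [|S|K CK KP] := @uniformize _ _ P.
- rewrite /P; semi.
  + by apply/dec_semidec/dec_folded; comp.
  + by apply: dec_semidec; apply: dec_closes; comp.
- have [b [Gr [fG Sb bP _ _]]] := folded_certificate S [::].
  exists b; split; last by exists Gr.
  by move=> y yb; exact: (proj1 (bP _) (mem_gen yb)).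
exists K => // S a; have [KS [Gr [fG closeS]]] := KP S; split.
  have sS := @gen_subgroup FY S.
  move: a; apply: gen_min; last by move=> y yK; exact: KS.
  split; first exact: subgroup1 sS.
  move=> a c La Lc; have := proj2 sS _ _ La Lc; congr (@gen FY S (_, _)).
  by rewrite /= mulgV.
move=> /(gen_closes comY fG closeS)[w [w1 v1 Kw]].
have E : swalk n Gr w (1%N, 1) = (1%N, 1).
  have -> : (1%N, 1) = swalk n Gr [::] (1%N, 1) :> nat * cgG Y by [].
  by apply: (swalk_eq x_inj x_basis fG) => //; rewrite /alive v1.
by rewrite E /= invg1 mul1g in Kw.
Qed.

(** For non-membership of (w, a), a graph on which the generators close up and
    the walk of w is defined but does not close up suffices: an element of <S>
    over the value of w is represented by a closing walk, and walks of words with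
    the same value agree where both are defined. *)
Lemma dec_gen_free_abelian :
  dec (fun p : seq (word * cgX Y) * (word * cgX Y) => @gen FY p.1 (@cval FY p.2)).
Proof.
apply: post; first by apply: (semidec_gen (Y := FY)); comp.
apply: (eq_semidec (P := fun p : seq (word * cgX Y) * (word * cgX Y) =>
  exists b : seq (cgX Y), exists Gr : seq (edge Y),
  (folded Gr /\ forall s, s \in p.1 -> closes n Gr b s) /\
  ((gwalk n Gr p.2.1).1 <> 0 /\ ~ closes n Gr b p.2))).
  case=> S [w a] /=; split=> [[b [Gr [[fG closeS] [okw nclose]]]] Sw|nS].
    have [u [/= uw u1 ub]] := gen_closes comY fG closeS Sw; apply: nclose.
    have Ew := gwalkE n Gr w.
    have Ewu : swalk n Gr w (1%N, 1) = swalk n Gr u (1%N, 1).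
      apply: (swalk_eq x_inj x_basis fG); first by rewrite uw.
        by rewrite -Ew.
      by rewrite /alive u1.
    rewrite Ewu in Ew; rewrite -Ew /= in u1 ub.
    by split; rewrite // cvalM cvalV.
  have [b [Gr [fG Sb bP okw wP]]] := folded_certificate S w.
  by exists b, Gr; split=> //; split=> // /wP.
semi.
- by apply/dec_semidec/dec_folded; comp.
- by apply: dec_semidec; apply: dec_closes; comp.
- by apply: computable_gwalk; comp.
- by apply: dec_semidec; apply: dec_not; apply: dec_closes; comp.
Qed.

End FreeByAbelian.

(** * Schreier bases *)

Section SignedLetters.
Variable F : groupType.

Definition finv (p : F * bool) : F * bool := (p.1, ~~ p.2).

Lemma finvK : involutive finv.
Proof. by case=> u e; rewrite /finv /= negbK. Qed.

Lemma reducedE (s : seq (F * bool)) : reduced s = irreducible finv s.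
Proof.
apply: eq_sorted => -[u e] [v d]; rewrite /finv xpair_eqE /= negb_and [v == u]eq_sym implybE.
by case: d e => -[].
Qed.

Lemma word_val_cons (p : F * bool) s :
  word_val id (p :: s) = (if p.2 then p.1^-1 else p.1) * word_val id s.
Proof. by rewrite /word_val big_cons. Qed.

Lemma word_val_nil : word_val id ([::] : seq (F * bool)) = 1.
Proof. by rewrite /word_val big_nil. Qed.

Lemma word_val_push p s :
  word_val id (push finv p s) = (if p.2 then p.1^-1 else p.1) * word_val id s.
Proof.
case: s => [|q s] /=; first by rewrite word_val_cons.
case: eqP => [->|_]; last by rewrite word_val_cons.
by rewrite word_val_cons /=; case: p => u [] /=; rewrite ?mulKg ?mulVKg.
Qed.

End SignedLetters.

Section Schreier.
Variables (n : nat) (F : groupType) (x : 'I_n -> F).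
Hypotheses (x_inj : injective x) (x_basis : free_basis (range x) [set: F]).
Variables (K : set F) (sK : subgroup K).

Notation repK := (rep x_basis sK).
Notation wvalx := (wval x).
Notation word := (seq (nat * nat)).
Notation stack := (seq (F * bool)).

Definition schreier_gen (i : nat) (g : F) : F :=
  (wvalx (repK (letter x (i, 0) * g)))^-1 * (letter x (i, 0) * wvalx (repK g)).

Definition schreier_basis : set F :=
  [set u | u <> 1 /\ exists i g, u = schreier_gen i g].

Lemma schreier_gen_coset i g h : K (g^-1 * h) -> schreier_gen i g = schreier_gen i h.
Proof.
move=> gh; rewrite /schreier_gen (rep_eq _ _ gh).
by rewrite (@rep_eq _ _ _ x_basis _ sK _ (letter x (i, 0) * h)) ?coset_mull.
Qed.

Lemma schreier_gen_mem i g : K (schreier_gen i g).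
Proof.
apply: (coset_trans sK (rep_coset x_basis sK _)).
by rewrite coset_mull; apply: (coset_sym sK); apply: rep_coset.
Qed.

(** The rewriting process: reading a word letter by letter, the state keeps the
    group element read so far and the reduced word over the Schreier
    generators crossed so far. Each letter acts by a bijection whose inverse
    is the action of the inverse letter. *)
Definition emit (u : F) (e : bool) (s : stack) : stack :=
  if u == 1 then s else push (@finv F) (u, e) s.

Definition rstep (l : nat * nat) (z : F * stack) : F * stack :=
  if irreducible (@finv F) z.2 then
    (letter x l * z.1,
     if l.2 == 0 then emit (schreier_gen l.1 z.1) false z.2
     else emit (schreier_gen l.1 (letter x l * z.1)) true z.2)
  else z.

Definition rwalk (w : word) (z : F * stack) : F * stack := walk rstep w z.

Definition live (z : F * stack) : Prop := irreducible (@finv F) z.2.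

Lemma emit_irreducible u e s :
  irreducible (@finv F) s -> irreducible (@finv F) (emit u e s).
Proof. by rewrite /emit; case: ifP => // _; apply: irreducible_push. Qed.

Lemma emitK u e s : irreducible (@finv F) s -> emit u (~~ e) (emit u e s) = s.
Proof.
rewrite /emit; case: (u == 1) => // irr.
exact: (pushK (u, e) (@finvK F) irr).
Qed.

Lemma rstep_live l z : live z -> live (rstep l z).
Proof.
rewrite /live /rstep => lz; rewrite lz /=.
by case: ifP => _; apply: emit_irreducible.
Qed.

Lemma rstep_inv l z : live (rstep l z) -> live z /\ rstep (flip l) (rstep l z) = z.
Proof.
have [lz _|nz] := boolP (irreducible (@finv F) z.2); last first.
  by rewrite {1}/rstep (negPf nz) /live (negPf nz).
split=> //; have := rstep_live l lz; rewrite /live /rstep lz => -> /=.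
rewrite letter_flip mulKg; case: z lz => g s lz /=; congr pair.
by case: (l.2 == 0) => /=; apply: emitK.
Qed.

Lemma rstep_large l z : n <= l.1 -> rstep l z = z.
Proof.
move=> le_n; rewrite /rstep; case: ifP => // lz; case: z lz => g s lz /=.
have E h : schreier_gen l.1 h = 1.
  by rewrite /schreier_gen letter_large // !mul1g mulVg.
by rewrite letter_large // mul1g !E /emit eqxx; case: ifP.
Qed.

Lemma rstep_sign l z : rstep (unit_sign l) z = rstep l z.
Proof. by rewrite /rstep letter_unit_sign /=; case: (l.2 == 0). Qed.

Lemma rwalk_live w z : live z -> live (rwalk w z).
Proof. by move=> lz; elim: w => //= l w; apply: rstep_live. Qed.

Lemma rwalk_eq u v z : live z -> wvalx u = wvalx v -> rwalk u z = rwalk v z.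
Proof.
move=> lz uv.
by apply: (walk_eq x_inj x_basis rstep_inv rstep_large rstep_sign) => //; apply: rwalk_live.
Qed.

Lemma rwalk_winv w z : live z -> rwalk (winv w) (rwalk w z) = z.
Proof. by move=> lz; apply: (walk_winv rstep_inv); apply: rwalk_live. Qed.

Lemma rwalk_cons l w z : live z -> rwalk (l :: w) z =
  (letter x l * (rwalk w z).1,
   if l.2 == 0 then emit (schreier_gen l.1 (rwalk w z).1) false (rwalk w z).2
   else emit (schreier_gen l.1 (letter x l * (rwalk w z).1)) true (rwalk w z).2).
Proof. by move=> /(rwalk_live w) lw; rewrite [LHS]/(rstep l (rwalk w z)) /rstep lw. Qed.

Lemma rwalk_fst w g s : live (g, s) -> (rwalk w (g, s)).1 = wvalx w * g.
Proof.
move=> lz; elim: w => [|l w IH]; first by rewrite /= mul1g.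
by rewrite rwalk_cons //= IH mulgA.
Qed.

Lemma letter0 l : letter x (l.1, 0) = if l.2 == 0 then letter x l else (letter x l)^-1.
Proof.
rewrite -letter_flip -{1}(letter_unit_sign x l) /unit_sign /flip.
by case: (l.2 == 0).
Qed.

(** The Schreier generators are the defects of the transversal, so the word
    over them read along w telescopes. *)
Lemma word_val_rwalk w s : live (1, s) -> word_val id (rwalk w (1, s)).2 =
  (wvalx (repK (wvalx w)))^-1 * wvalx w * word_val id s.
Proof.
move=> lz; elim: w => [|l w IH].
  by rewrite rep_mem ?invg1 ?mul1g //; apply: subgroup1 sK.
have emitE u e t : word_val id (emit u e t) = (if e then u^-1 else u) * word_val id t.
  rewrite /emit; case: eqP => [->|_]; last exact: word_val_push.
  by rewrite invg1 if_same mul1g.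
have L0 := letter0 l; rewrite rwalk_cons // !rwalk_fst // mulg1 /=.
case: (l.2 == 0) in L0 *; rewrite emitE IH /schreier_gen L0 /=.
  by rewrite !mulgA mulgK.
by rewrite mulKg !invgM !invgK !mulgA mulgK.
Qed.

Lemma tree_gen l q : repK (wvalx (l :: q)) = l :: q ->
  schreier_gen l.1 (if l.2 == 0 then wvalx q else letter x l * wvalx q) = 1.
Proof.
move=> E; have Eq := rep_tail E; have L0 := letter0 l; rewrite /schreier_gen L0.
rewrite /= in E; case: (l.2 == 0) in L0 *; first by rewrite E Eq /= mulVg.
by rewrite mulKg Eq E /= mulKg mulVg.
Qed.

Lemma coset_mulr g k : K k -> K (g^-1 * (g * k)).
Proof. by rewrite mulKg. Qed.

Lemma rwalk_tree t k s : repK (wvalx t) = t -> K k -> live (k, s) ->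
  rwalk t (k, s) = (wvalx t * k, s).
Proof.
move=> + Kk lz; elim: t => [|l t IH] E; first by rewrite /= mul1g.
have Et := rep_tail E; have := tree_gen E; rewrite rwalk_cons // IH //=.
have coset g : schreier_gen l.1 (g * k) = schreier_gen l.1 g.
  exact/esym/schreier_gen_coset/coset_mulr.
rewrite mulgA !coset /emit.
by case: (l.2 == 0) => ->; rewrite eqxx.
Qed.

Definition schreier_word (i : nat) (g : F) : word :=
  winv (repK (letter x (i, 0) * g)) ++ (i, 0) :: repK g.

Lemma wval_schreier_word i g : wvalx (schreier_word i g) = schreier_gen i g.
Proof. by rewrite wval_cat wval_winv. Qed.

Lemma rwalk_schreier_word i g k s : K k -> live (k, s) ->
  rwalk (schreier_word i g) (k, s)
  = (schreier_gen i g * k, emit (schreier_gen i g) false s).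
Proof.
move=> Kk lz; rewrite /rwalk walk_cat -!/(rwalk _ _) rwalk_cons //.
rewrite (rwalk_tree (rep_wval_rep x_basis sK g) Kk lz) /=.
rewrite -(@schreier_gen_coset i g) => [|]; last first.
  apply: (coset_trans sK (coset_sym sK (rep_coset x_basis sK g))).
  exact: coset_mulr.
set t := repK _; set s' := emit _ _ _.
have Ku : K (schreier_gen i g * k) by apply: subgroupM sK _ Kk; apply: schreier_gen_mem.
have ls : live (schreier_gen i g * k, s') by apply: emit_irreducible.
have := rwalk_winv t ls; rewrite (rwalk_tree (rep_wval_rep x_basis sK _) Ku ls) => <-.
congr (rwalk _ (_, _)).
by rewrite /schreier_gen -!mulgA mulVKg.
Qed.

Lemma rwalk_schreier_wordV i g k s : K k -> live (k, s) ->
  rwalk (winv (schreier_word i g)) (k, s)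
  = ((schreier_gen i g)^-1 * k, emit (schreier_gen i g) true s).
Proof.
move=> Kk lz; set u := schreier_gen i g.
have ls : live (u^-1 * k, emit u true s) by apply: emit_irreducible.
have := rwalk_winv (schreier_word i g) ls; rewrite rwalk_schreier_word //.
  by rewrite -/u mulVKg -[false]/(~~ true) emitK.
by apply: subgroupM => //; apply: subgroupV => //; apply: schreier_gen_mem.
Qed.

Lemma schreier_word_val W : reduced W -> (forall p, p \in W -> schreier_basis p.1) ->
  K (word_val id W) /\
  exists w, wvalx w = word_val id W /\ rwalk w (1, [::]) = (word_val id W, W).
Proof.
rewrite reducedE; elim: W => [|[u e] W IH] irr UW.
  rewrite word_val_nil; split; first exact: subgroup1.
  by exists [::].
have irrW : irreducible (@finv F) W by case: (W) irr => //= q s /andP[].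
have [|KW [w [Ew Rw]]] := IH irrW.
  by move=> p pW; apply: UW; rewrite inE pW orbT.
have [|/= /eqP u1 [i [g Eu]]] := UW (u, e); first by rewrite inE eqxx.
have lW : live (word_val id W, W) by [].
have Ku : K u by rewrite Eu; apply: schreier_gen_mem.
have emitE : emit u e W = (u, e) :: W by rewrite /emit (negPf u1) push_cons.
rewrite word_val_cons /=; split.
  by apply: subgroupM => //; case: (e) => //; apply: subgroupV.
exists ((if e then winv (schreier_word i g) else schreier_word i g) ++ w).
rewrite wval_cat Ew /rwalk walk_cat -!/(rwalk _ _) Rw; split.
  by case: (e); rewrite ?wval_winv wval_schreier_word -Eu.
by case: (e) emitE => <-; rewrite ?rwalk_schreier_wordV ?rwalk_schreier_word -?Eu.
Qed.

Lemma mem_emit u e s p : p \in emit u e s -> (p = (u, e) /\ u <> 1) \/ p \in s.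
Proof.
rewrite /emit; case: eqP => [_|u1]; first by right.
by case/mem_push=> [->|]; [left|right].
Qed.

Lemma mem_rwalk w p : p \in (rwalk w (1, [::])).2 -> p.1 <> 1 /\
  exists v l q, w = v ++ l :: q /\
   ((p.2 = false -> l.2 = 0 /\ p.1 = schreier_gen l.1 (wvalx q)) /\
   exists g, p.1 = schreier_gen l.1 g).
Proof.
have l0 : live (1, [::]) by [].
elim: w => [//|l w IH]; rewrite rwalk_cons // rwalk_fst // mulg1 [(_, _).2]/=.
have IH' : p \in (rwalk w (1, [::])).2 -> p.1 <> 1 /\
  exists v l' q, l :: w = v ++ l' :: q /\
   ((p.2 = false -> l'.2 = 0 /\ p.1 = schreier_gen l'.1 (wvalx q)) /\
   exists g, p.1 = schreier_gen l'.1 g).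
  by case/IH=> p1 [v [l' [q [-> H]]]]; split=> //; exists (l :: v), l', q.
case: eqP => l2 /mem_emit[[-> p1]|/IH'//]; split=> //; exists [::], l, w; split=> //=.
  by split=> //; exists (wvalx w).
by split=> //; eexists.
Qed.

Theorem schreier_free_basis : free_basis schreier_basis K.
Proof.
split; last first.
  move=> W Wn Wred WU W1; have [_ [w [Ew Rw]]] := schreier_word_val Wred WU.
  have := @rwalk_eq w [::] (1, [::]) isT; rewrite Ew W1 Rw => /(_ erefl)[_].
  exact: Wn.
apply/seteqP; split=> g.
  apply: subgroup_gen_min => // _ [_ [i [h ->]]]; exact: schreier_gen_mem.
move=> Kg; have [w Ew] := wval_surj x_basis g.
have := word_val_rwalk w (s := [::]) isT.
rewrite Ew rep_mem // invg1 mul1g word_val_nil mulg1 => <-.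
have sU := subgroup_gen_subgroup schreier_basis.
have : forall p, p \in (rwalk w (1, [::])).2 -> schreier_basis p.1.
  by move=> p /mem_rwalk[p1 [v [l [q [_ [_ [h ph]]]]]]]; split=> //; exists l.1, h.
elim: (rwalk _ _).2 => [|p s IH] Us; first by rewrite word_val_nil; apply: subgroup1 sU.
rewrite word_val_cons; apply: (subgroupM sU).
  have Up : subgroup_gen schreier_basis p.1.
    by apply: subset_subgroup_gen; apply: Us; rewrite inE eqxx.
  by case: ifP => // _; apply: (subgroupV sU).
by apply: IH => q qs; apply: Us; rewrite inE qs orbT.
Qed.

(** Whichever word represents a basis element u, rewriting it ends with the
    one-letter stack (u), so u is crossed at some letter of that word. *)
Lemma schreier_basisP w : schreier_basis (wvalx w) <-> wvalx w <> 1 /\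
  exists v l q, w = v ++ l :: q /\ (l.2 = 0 /\ wvalx w = schreier_gen l.1 (wvalx q)).
Proof.
split=> [[w1 [i [g Ew]]]|[w1 [v [l [q [_ [_ Ew]]]]]]]; last first.
  by split=> //; exists l.1, (wvalx q).
split=> //; have := @rwalk_eq w (schreier_word i g) (1, [::]) isT.
rewrite wval_schreier_word => /(_ Ew).
rewrite rwalk_schreier_word //; last exact: subgroup1.
rewrite -Ew /emit; case: eqP => // _ R.
have [|_ [v [l [q [Evw [/(_ erefl)[l2 E] _]]]]]] := @mem_rwalk w (wvalx w, false).
  by rewrite R /= inE.
by exists v, l, q.
Qed.

End Schreier.

(** * Abelian bases *)

Section AbelianBasis.
Local Open Scope ring_scope.
Import GRing.Theory Num.Theory Order.TTheory.
Variable A : zmodType.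
Implicit Types (b c : seq A) (l : nat -> int).

Definition zspan b : set A := @subgroup_gen (Algebra.to_multiplicative A) [set` b].

Definition comb (r : nat) (f : nat -> A) l : A := \sum_(j < r) f j *~ l j.

Lemma zspan_subgroup b : @subgroup (Algebra.to_multiplicative A) (zspan b).
Proof. exact: subgroup_gen_subgroup. Qed.

Lemma zspan0 b : zspan b 0. Proof. exact: subgroup1 (zspan_subgroup b). Qed.

Lemma zspanD b y z : zspan b y -> zspan b z -> zspan b (y + z).
Proof. exact: subgroupM (zspan_subgroup b). Qed.

Lemma zspanN b y : zspan b y -> zspan b (- y).
Proof. exact: subgroupV (zspan_subgroup b). Qed.

Lemma zspanB b y z : zspan b y -> zspan b z -> zspan b (y - z).
Proof. by move=> by_ /zspanN; apply: zspanD. Qed.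

Lemma zspan_mem b y : y \in b -> zspan b y.
Proof. by move=> yb; apply: subset_subgroup_gen. Qed.

Lemma zspanMz b y (k : int) : zspan b y -> zspan b (y *~ k).
Proof.
move=> by_; have pos n : zspan b (y *+ n).
  by elim: n => [|n IH]; rewrite ?mulr0n ?mulrS; [apply: zspan0|apply: zspanD].
by case: k => n; [exact: pos | rewrite NegzE mulrNz; exact: zspanN (pos _)].
Qed.

Lemma zspan_ind b (P : A -> Prop) : P 0 -> (forall y z, P y -> P z -> P (y - z)) ->
  (forall y, y \in b -> P y) -> forall y, zspan b y -> P y.
Proof.
by move=> P0 Pd bP; apply: (@subgroup_gen_min (Algebra.to_multiplicative A) _ P).
Qed.

Lemma zspan_min b c : (forall y, y \in b -> zspan c y) -> forall y, zspan b y -> zspan c y.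
Proof.
by move=> bc; apply: (@subgroup_gen_min (Algebra.to_multiplicative A) _ _ (zspan_subgroup c)).
Qed.

Lemma zspan_mono b c : {subset b <= c} -> forall y, zspan b y -> zspan c y.
Proof. by move=> bc; apply: zspan_min => y /bc/zspan_mem. Qed.

Lemma zspan_comb b r f l : (forall j, (j < r)%N -> zspan b (f j)) -> zspan b (comb r f l).
Proof.
move=> fb; rewrite /comb; elim/big_ind: _ => [|y z|j _]; [exact: zspan0|exact: zspanD|].
by apply: zspanMz; apply: fb; apply: ltn_ord.
Qed.

Lemma combB r f l l' : comb r f (fun j => l j - l' j) = comb r f l - comb r f l'.
Proof. by rewrite /comb -sumrB; apply: eq_bigr => j _; rewrite mulrzBr. Qed.

Lemma combZ r f l (q : int) : comb r f (fun j => l j * q) = comb r f l *~ q.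
Proof.
by rewrite /comb mulrz_suml; apply: eq_bigr => j _; rewrite mulrzA.
Qed.

Lemma comb_delta r f k : (k < r)%N -> comb r f (fun j => (j == k)%:Z) = f k.
Proof.
move=> lt_kr; rewrite /comb (bigD1 (Ordinal lt_kr)) //= eqxx mulr1z big1 ?addr0 //.
by move=> j; rewrite -val_eqE /= => /negPf->; rewrite mulr0z.
Qed.

Lemma zspanP b y : zspan b y <-> exists l, y = comb (size b) (nth 0 b) l.
Proof.
split=> [|[l ->]]; last by apply: zspan_comb => j /(mem_nth 0)/zspan_mem.
move: y; apply: zspan_ind => [|y z [l ->] [l' ->]|y yb].
- by exists (fun=> 0); rewrite /comb big1 // => j _; rewrite mulr0z.
- by exists (fun j => l j - l' j); rewrite combB.
exists (fun j => (j == index y b)%:Z).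
by rewrite comb_delta ?index_mem // nth_index.
Qed.

Definition relations_divisible (p : nat) b : Prop :=
  forall l, comb (size b) (nth 0 b) l = 0 ->
  forall j, (j < size b)%N -> (p %| l j)%Z.

Lemma intr_Fp (p : nat) (k : int) : prime p -> (p %| k)%Z -> k%:~R = 0 :> 'F_p.
Proof.
move=> pr /dvdzP[q ->]; rewrite intrM -[X in _ * X]/(p%:R : 'F_p).
by rewrite pchar_Fp_0 ?mulr0.
Qed.

(** Reducing the two transition matrices modulo p makes them inverse to each
    other, so the rank over the field with p elements bounds the sizes. *)
Lemma divisible_minimal p b c : prime p -> relations_divisible p b ->
  (forall y, y \in b -> zspan c y) -> (forall y, y \in c -> zspan b y) ->
  (size b <= size c)%N.
Proof.
move=> pr div bc cb.
have [P PE] : exists P : nat -> nat -> int, forall i, (i < size b)%N ->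
    nth 0 b i = comb (size c) (nth 0 c) (P i).
  have H i : exists l, (i < size b)%N -> nth 0 b i = comb (size c) (nth 0 c) l.
    have [lt_i|_] := ltnP i (size b); last by exists (fun=> 0).
    by have /bc/zspanP[l ->] := mem_nth 0 lt_i; exists l.
  by exists (fun i => projT1 (cid (H i))) => i; apply: (projT2 (cid (H i))).
have [Q QE] : exists Q : nat -> nat -> int, forall i, (i < size c)%N ->
    nth 0 c i = comb (size b) (nth 0 b) (Q i).
  have H i : exists l, (i < size c)%N -> nth 0 c i = comb (size b) (nth 0 b) l.
    have [lt_i|_] := ltnP i (size c); last by exists (fun=> 0).
    by have /cb/zspanP[l ->] := mem_nth 0 lt_i; exists l.
  by exists (fun i => projT1 (cid (H i))) => i; apply: (projT2 (cid (H i))).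
pose MP : 'M['F_p]_(size b, size c) := \matrix_(i, j) (P i j)%:~R.
pose MQ : 'M['F_p]_(size c, size b) := \matrix_(i, j) (Q i j)%:~R.
suff PQ1 : 1%:M *m MP *m MQ = 1%:M.
  exact: leq_trans (mulmx1_min_rank PQ1) (rank_leq_col MP).
rewrite mul1mx; apply/matrixP => i k; rewrite !mxE.
pose l (k : nat) : int := \sum_(j < size c) P i j * Q j k - (k == i)%:Z.
have l0 : comb (size b) (nth 0 b) l = 0.
  rewrite combB comb_delta //; apply/eqP; rewrite subr_eq0 PE //; apply/eqP.
  rewrite /comb; under eq_bigr => h _ do rewrite mulrz_sumr.
  rewrite exchange_big /=; apply: eq_bigr => j _; rewrite QE // -combZ.
  by apply: eq_bigr => h _; rewrite mulrC.
have /(intr_Fp pr)/eqP := div l l0 k (ltn_ord k).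
rewrite /l rmorphB /= subr_eq0 rmorph_sum => /eqP E.
transitivity (\sum_(j < size c) (P i j * Q j k)%:~R : 'F_p).
  by apply: eq_bigr => j _; rewrite !mxE intrM.
by rewrite E eq_sym -val_eqE.
Qed.

(** Divisibility of the relations in terms of membership alone: no entry lies in
    the subgroup generated by the later entries and the p-multiples of all. *)
Definition independent_mod (p : nat) b : Prop :=
  forall u y t, b = u ++ y :: t -> ~ zspan (t ++ [seq z *+ p | z <- b]) y.

Lemma comb_cons y t l :
  comb (size (y :: t)) (nth 0 (y :: t)) l
  = y *~ l 0%N + comb (size t) (nth 0 t) (fun j => l j.+1).
Proof. by rewrite /comb big_ord_recl. Qed.

(** The first coefficient of a relation that p does not divide could be inverted
    modulo p, which would express its entry by the later ones. *)
Lemma independent_mod_divisible p b : prime p ->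
  independent_mod p b -> relations_divisible p b.
Proof.
move=> pr ind l l0; set B := [seq z *+ p | z <- b].
suff H t u : b = u ++ t -> forall l, zspan B (comb (size t) (nth 0 t) l) ->
    forall j, (j < size t)%N -> (p %| l j)%Z.
  by apply: (H b [::]) => //; rewrite l0; apply: zspan0.
elim: t u => // y t IH u Eb {}l {l0}.
have yB (k : int) : zspan B (y *~ (p%:Z * k)).
  rewrite mulrzA; apply: zspanMz; apply: zspan_mem; rewrite -[y *~ _]/(y *+ p).
  by apply: (map_f (fun z => z *+ p)); rewrite Eb mem_cat inE eqxx orbT.
have [/dvdzP[q Eq]|np] := boolP (p %| l 0%N)%Z.
  rewrite comb_cons Eq mulrC => S [|j] lt_j; first by rewrite Eq dvdz_mull.
  apply: (IH (rcons u y) _ (fun j => l j.+1)) lt_j; first by rewrite cat_rcons.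
  have := zspanB S (yB q); by rewrite mulrC addrAC subrr add0r.
rewrite comb_cons => S; exfalso; apply: (ind u y t Eb).
have sub z : zspan B z -> zspan (t ++ B) z.
  by apply: zspan_mono => w wB; rewrite mem_cat wB orbT.
have ly : zspan (t ++ B) (y *~ l 0%N).
  rewrite -[y *~ _](addrK (comb (size t) (nth 0 t) (fun j => l j.+1))).
  apply: zspanB; first exact: sub.
  by apply: zspan_comb => j /(mem_nth 0) jt; apply: zspan_mem; rewrite mem_cat jt.
have : coprimez (l 0%N) p%:Z.
  by rewrite coprimezE coprime_sym /= prime_coprime // -[_ %| _]/(p %| l 0%N)%Z.
case/coprimezP=> -[s v] /= E; rewrite -[y]mulr1z -E mulrzDr.
rewrite [s * _]mulrC [v * _]mulrC mulrzA; apply: zspanD; first exact: zspanMz.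
by apply: sub; apply: yB.
Qed.

Lemma divisible_independent_mod p b : prime p ->
  relations_divisible p b -> independent_mod p b.
Proof.
move=> pr div u y t Eb.
have sub z : zspan (t ++ [seq z *+ p | z <- b]) z -> exists l l' : nat -> int,
    z = comb (size t) (nth 0 t) l + comb (size b) (nth 0 b) (fun j => l' j * p%:Z).
  move: z; apply: zspan_ind => [|_ _ [l [l' ->]] [m [m' ->]]|z].
  - exists (fun=> 0), (fun=> 0).
    by rewrite combZ /comb !big1 ?mul0rz ?addr0 // => j _; rewrite mulr0z.
  - exists (fun j => l j - m j), (fun j => l' j - m' j).
    by rewrite !combZ !combB mulrzBl opprD addrACA.
  rewrite mem_cat => /orP[zt|/mapP[w wb ->]].
    exists (fun j => (j == index z t)%:Z), (fun=> 0).
    rewrite combZ comb_delta ?index_mem // nth_index //.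
    by rewrite [X in _ + X *~ _]/comb big1 ?mul0rz ?addr0 // => j _; rewrite mulr0z.
  exists (fun=> 0), (fun j => (j == index w b)%:Z).
  rewrite combZ comb_delta ?index_mem // nth_index //.
  by rewrite [X in X + _]/comb big1 ?add0r // => j _; rewrite mulr0z.
case/sub=> l [l' E].
pose k j : int := (if (j < size u)%N then 0 else
  if j == size u then 1 else - l (j - (size u).+1)%N) - l' j * p%:Z.
have k0 : comb (size b) (nth 0 b) k = 0.
  rewrite combB; apply/eqP; rewrite subr_eq0; apply/eqP.
  apply: (addrI (comb (size t) (nth 0 t) l)); rewrite -E.
  rewrite {1 2}Eb size_cat /= /comb big_split_ord /= [X in _ + (X + _)]big1 ?add0r; last first.
    by move=> j _; rewrite ltn_ord mulr0z.
  rewrite big_ord_recl /= addn0 ltnn eqxx nth_cat ltnn subnn mulr1z addrCA.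
  rewrite -[RHS]addr0; congr (_ + _); rewrite -big_split big1 //= => j _.
  rewrite ltnNge leq_addr /= -[X in _ == X]addn0 eqn_add2l /=.
  rewrite nth_cat ltnNge leq_addr /= addKn addnS -addSn addKn.
  by rewrite mulrNz subrr.
have /(div k k0) : (size u < size b)%N by rewrite Eb size_cat /= -addSnnS leq_addr.
rewrite /k ltnn eqxx => /dvdzP[q Eq].
have : (p %| 1)%Z by apply/dvdzP; exists (q + l' (size u)); rewrite mulrDl -Eq subrK.
by rewrite dvdzE /= dvdn1 => /eqP p1; rewrite p1 in pr.
Qed.

(** Consider all generating lists of least length, and let d be the least absolute
    value of a nonzero coefficient in their relations. By Euclidean division, d
    divides all the coefficients of all the relations of a list where it occurs,
    and d <> 1 since a generator with coefficient 1 or -1 could be dropped. If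
    there is no nontrivial relation, any prime will do. *)
Lemma divisible_exists (L : set A) c0 : zspan c0 = L ->
  exists p b, [/\ prime p, zspan b = L & relations_divisible p b].
Proof.
move=> c0L.
have exr : exists r, `[< exists b, size b = r /\ zspan b = L >].
  by exists (size c0); apply/asboolP; exists c0.
case: (ex_minnP exr) => r /asboolP[b0 [b0r b0L]] r_min {exr}.
have [[d0 D0]|none] := pselect (exists d, exists f l i,
   [/\ zspan (mkseq f r) = L, comb r f l = 0, (i < r)%N, l i != 0 & `|l i|%N = d]); last first.
  exists 2%N, b0; split=> // l l0 j lt_j.
  have [->|lj] := eqVneq (l j) 0; first exact: dvdz0.
  case: none; exists `|l j|%N, (nth 0 b0), l, j; split=> //; rewrite -?b0r //.
  by rewrite mkseq_nth.
have exd : exists d, `[< exists f l i,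
   [/\ zspan (mkseq f r) = L, comb r f l = 0, (i < r)%N, l i != 0 & `|l i|%N = d] >].
  by exists d0; apply/asboolP.
case: (ex_minnP exd) => d /asboolP[f [l [i [fL l0 lt_i li ld]]]] d_min {exd d0 D0}.
have d_le g m j : zspan (mkseq g r) = L -> comb r g m = 0 -> (j < r)%N ->
    (`|m j| < d)%N -> m j = 0.
  move=> gL m0 lt_j lt_d; apply/eqP/contraT => mj.
  suff : (d <= `|m j|)%N by rewrite leqNgt lt_d.
  by apply: d_min; apply/asboolP; exists g, m, j; split.
have lt_mod (k : int) : (`|(k %% l i)%Z| < d)%N.
  by have := ltz_mod k li; have := modz_ge0 k li; lia.
(* Replacing the i-th generator f i by f i + q f k turns the k-th coefficient
   of the relation into its remainder modulo l i. *)
have stepA m : comb r f m = 0 -> m i = l i -> forall k, (k < r)%N -> (l i %| m k)%Z.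
  move=> m0 mi k lt_k; have [->|ki] := eqVneq k i; first by rewrite mi dvdzz.
  pose q := (m k %/ l i)%Z.
  pose g j := if j == i then f i + f k *~ q else f j.
  pose m' j := if j == k then (m k %% l i)%Z else m j.
  have E j : g j *~ m' j = f j *~ m j + ((if j == i then f k *~ q *~ l i else 0)
       - (if j == k then f k *~ q *~ l i else 0)).
    rewrite /g /m'; have [->|ji] := eqVneq j i.
      by rewrite eq_sym (negPf ki) subr0 mulrzDl mi.
    have [->|_] := eqVneq j k; last by rewrite subr0 addr0.
    have -> : f k *~ m k = f k *~ (m k %% l i)%Z + f k *~ q *~ l i.
      by rewrite -mulrzA -mulrzDr addrC -divz_eq.
    by rewrite sub0r addrK.
  have sum_if (h : nat) (v : A) : (h < r)%N ->
      \sum_(j < r) (if j == h :> nat then v else 0) = v.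
    move=> lt_h; rewrite (bigD1 (Ordinal lt_h)) //= eqxx big1 ?addr0 // => j.
    by rewrite -val_eqE /= => /negPf->.
  have m'0 : comb r g m' = 0.
    rewrite /comb; under eq_bigr => j _ do rewrite E.
    by rewrite big_split sumrB /= !sum_if // subrr addr0.
  have gL : zspan (mkseq g r) = L.
    rewrite -fL; apply/seteqP.
    have memf h j : (j < r)%N -> zspan (mkseq h r) (h j).
      by move=> lt_j; apply: zspan_mem; apply: map_f; rewrite mem_iota.
    split; apply: zspan_min => y /mapP[j]; rewrite mem_iota /= => lt_j ->.
      rewrite /g; case: eqP => _; last exact: memf.
      by apply: zspanD; [apply: memf|apply: zspanMz; apply: memf].
    have [->|ji] := eqVneq j i; last by have := memf g j lt_j; rewrite /g (negPf ji).
    have gi := memf g i lt_i; have gk := memf g k lt_k.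
    rewrite /g eqxx in gi; rewrite /g (negPf ki) in gk.
    by have := zspanB gi (zspanMz q gk); rewrite addrK.
  have := d_le g m' k gL m'0 lt_k; rewrite /m' eqxx lt_mod => /(_ isT) r0.
  by apply/dvdz_mod0P.
(* Subtracting the multiple of l that leaves a remainder as the i-th coefficient
   leaves 0 there, by minimality; adding l then gives the coefficient l i. *)
have stepC m : comb r f m = 0 -> forall k, (k < r)%N -> (l i %| m k)%Z.
  move=> m0 k lt_k; pose q := (m i %/ l i)%Z.
  have m1 : comb r f (fun j => m j - l j * q) = 0 by rewrite combB combZ l0 m0 mul0rz subr0.
  have mi : m i - l i * q = 0.
    have Em : m i - l i * q = (m i %% l i)%Z.
      by rewrite {1}(divz_eq (m i) (l i)) -/q [l i * q]mulrC addrAC subrr add0r.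
    by apply: (d_le f (fun j => m j - l j * q) i) => //; rewrite Em.
  have m2 : comb r f (fun j => m j - (l j * q - l j)) = 0.
    by rewrite combB combB combZ l0 m0 mul0rz !subr0.
  have E2 : m i - (l i * q - l i) = l i by rewrite opprB addrCA mi addr0.
  have /dvdzP[a Ea] := stepA _ m2 E2 k lt_k.
  have /dvdzP[c Ec] := stepA _ l0 erefl k lt_k.
  apply/dvdzP; exists (a + c * q - c); rewrite mulrBl mulrDl -Ea -mulrA [q * _]mulrC mulrA -Ec.
  by set X := l k * q; lia.
have d1 : d != 1%N.
  apply/eqP => d1; pose c := [seq f j | j <- rem i (iota 0 r)].
  have cL : zspan c = L.
    have memc j : (j < r)%N -> j != i -> zspan c (f j).
      move=> lt_j ji; apply: zspan_mem; apply: map_f; rewrite mem_rem_uniq ?iota_uniq //.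
      by rewrite !inE ji mem_iota.
    rewrite -fL; apply/seteqP; split; apply: zspan_min => y /mapP[j].
      by move/mem_rem => jr ->; apply: zspan_mem; apply: map_f.
    rewrite mem_iota /= => lt_j ->; have [->|ji] := eqVneq j i; last exact: memc.
    have : zspan c (f i *~ l i).
      move: l0; rewrite /comb (bigD1 (Ordinal lt_i)) //= => /eqP; rewrite addr_eq0 => /eqP->.
      apply: zspanN; apply: (big_ind (zspan c)) => [|v w|h]; [exact: zspan0|exact: zspanD|].
      by rewrite -val_eqE /= => hi; apply: zspanMz; apply: memc.
    have [->|->] : l i = 1 \/ l i = -1 by lia.
      by rewrite mulr1z.
    by rewrite mulrNz mulr1z => /zspanN; rewrite opprK.
  have := r_min (size c); rewrite size_map size_rem ?mem_iota // size_iota.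
  have -> : `[< exists b, size b = r.-1 /\ zspan b = L >].
    by apply/asboolP; exists c; rewrite size_map size_rem ?mem_iota // size_iota.
  by move/(_ isT); case: (r) lt_i => // r'; rewrite ltnn.
have d_gt1 : (1 < d)%N by rewrite -absz_gt0 ld in li; lia.
exists (pdiv d), (mkseq f r); split=> //; first exact: pdiv_prime.
rewrite /relations_divisible size_mkseq => m m0 j lt_j.
have {}m0 : comb r f m = 0.
  by rewrite -m0; apply: eq_bigr => h _; rewrite nth_mkseq.
apply: dvdz_trans (stepC m m0 j lt_j).
by rewrite dvdzE /= ld pdiv_dvd.
Qed.

End AbelianBasis.

(** * Coordinates in the abelian factor *)

Fixpoint vec (m : nat) (s : seq int) : cgX (zpow m) :=
  match m with
  | 0 => 0 : nat
  | k.+1 => ((uncons s).1, vec k (uncons s).2)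
  end.

Lemma vec_cons m z s : vec m.+1 (z :: s) = (z, vec m s).
Proof. exact: (f_equal (fun p => (p.1, vec m p.2)) (uncons_cons z s)). Qed.

Lemma computable_vec m (X : codedType) (s : X -> seq int) :
  computable s -> computable (fun p => vec m (s p)).
Proof.
elim: m s => [|m IH] s Cs /=; first exact: computable_const.
apply: computable_pair; first exact: (computable_fst (computable_uncons Cs)).
by apply: (IH (fun p => (uncons (s p)).2)); apply: (computable_snd (computable_uncons Cs)).
Qed.

Section Theta.
Variable A : zmodType.

Fixpoint theta (m : nat) (f : nat -> A) : cgG (zpow m) -> A :=
  match m return cgG (zpow m) -> A with
  | 0 => fun _ => 0%R
  | k.+1 => fun v => (f 0%N *~ v.1 + theta (fun i => f i.+1) v.2)%R
  end.

Lemma thetaB m f (u v : cgG (zpow m)) : theta f (u * v^-1) = (theta f u - theta f v)%R.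
Proof.
elim: m f u v => [|m IH] f u v /=; first by rewrite GRing.subr0.
rewrite -[LHS]/(f 0%N *~ (u.1 - v.1) + theta (fun i => f i.+1) (u.2 * v.2^-1)%g)%R.
by rewrite IH mulrzBr GRing.opprD GRing.addrACA.
Qed.

Lemma theta_vec m f s : size s = m ->
  theta f (cval (vec m s)) = (\sum_(i < m) f i *~ nth 0%R s i)%R.
Proof.
elim: m f s => [|m IH] f s; first by rewrite big_ord0.
case: s => // z s [sm]; rewrite big_ord_recl -(IH (fun i => f i.+1) s sm).
by rewrite vec_cons.
Qed.

End Theta.

(** * Presented elements *)

Notation word := (seq (nat * nat)).
Notation rawpres := (word * seq int)%type.

Definition raw (n m : nat) (r : presentation n m) : rawpres :=
  ([seq (val p.1, nat_of_bool p.2) | p <- r.1], tval r.2).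

Lemma seq_code_map (T : Type) (X : codedType) (f : T -> X) (e : T -> nat) s :
  (forall y, e y = code (f y)) -> seq_code e s = code [seq f y | y <- s].
Proof. by move=> ef; elim: s => //= y s ->; rewrite ef. Qed.

Lemma code_raw n m (r : presentation n m) : pres_code r = code (raw r).
Proof.
rewrite /pres_code /raw code_pair; congr cpair.
by apply: seq_code_map => -[i e].
Qed.

(** * Intersections *)

Section Intersection.
Variables (n : nat) (F : groupType) (x : 'I_n -> F).
Hypotheses (x_inj : injective x) (x_basis : free_basis (range x) [set: F]).
Variables (m : nat) (A : zmodType) (a : 'I_m -> A).
Hypothesis a_gen : @subgroup_gen (Algebra.to_multiplicative A) (range a) = setT.

Notation Y := (zpow m).
Notation FY := (cg_prod (cg_word x_inj x_basis) Y).
Let comY : commutative_group (cgG Y) := @commutative_zpow m.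

(** The abelian factor is central, so adding generators from it is the same as
    multiplying by the subgroup that they generate. *)
Lemma gen_central S b g : @gen FY (S ++ [seq ([::], y) | y <- b]) g <->
  exists2 l, gen b l & @gen FY S (g.1, g.2 * l^-1).
Proof.
set T := S ++ _; have sT := @gen_subgroup FY T; have sS := @gen_subgroup FY S.
split=> [|[l bl Sgl]]; last first.
  have E : (g.1 * 1, g.2 * l^-1 * l) = g by rewrite mulg1 mulgVK; case: (g).
  rewrite -{}E; apply: (@subgroupM _ _ (g.1, g.2 * l^-1) (1, l) sT).
    by apply: gen_mono Sgl => y yS; rewrite mem_cat yS.
  move: l bl {Sgl}; apply: gen_min => [|y yb].
    split; first exact: subgroup1 sT.
    move=> u v Tu Tv; have := proj2 sT _ _ Tu Tv; congr (@gen FY T (_, _)).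
    by rewrite /= mulgV.
  by apply: (@mem_gen FY T ([::], y)); rewrite mem_cat map_f ?orbT.
move: g; apply: (@gen_min FY T) => [|s].
  split; first by exists 1; rewrite ?mulgV; [apply: gen1|apply: subgroup1 sS].
  move=> g h [l bl Sl] [l' bl' Sl']; exists (l * l'^-1).
    exact: (proj2 (gen_subgroup b)).
  have := proj2 sS _ _ Sl Sl'; congr (@gen FY S (_, _)) => /=.
  rewrite !invgM !invgK -!mulgA; congr (_ * _).
  by rewrite mulgA [l^-1 * l']comY comY.
rewrite mem_cat => /orP[sS'|/mapP[y yb ->]].
  exists 1; first exact: gen1.
  rewrite /= invg1 mulg1; exact: (@mem_gen FY S s sS').
by exists (cval y); [apply: mem_gen | rewrite /= mulgV; apply: subgroup1 sS].
Qed.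

(** The map theta is defined by recursion on m, which calls for coefficients
    indexed by all natural numbers. *)
Definition alpha (i : nat) : A := if insub i is Some j then a j else 0%R.
Notation th := (@theta A m alpha).

Definition conv (r : rawpres) : cgX FY := (r.1, vec m r.2).
Definition psi (g : cgG FY) : F \x_t A := (g.1, th g.2).

Lemma psiB g h : psi (g * h^-1) = psi g * (psi h)^-1.
Proof. by rewrite /psi /= thetaB. Qed.

Lemma psi1 : psi 1 = 1.
Proof. by rewrite -(mulgV 1) psiB mulgV. Qed.

Lemma th1 : th 1 = 0%R. Proof. by rewrite -(mulgV 1) thetaB GRing.subrr. Qed.

Lemma thM u v : th (u * v) = (th u + th v)%R.
Proof. by rewrite -{1}[v]invgK thetaB -[v^-1]mul1g thetaB th1 GRing.sub0r GRing.opprK. Qed.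

Lemma psi_conv (r : presentation n m) : psi (cval (conv (raw r))) = elem x a r.
Proof.
congr pair.
  rewrite /= /word_val; case: r => w s /=; elim: w => [|[i e] w IH]; first by rewrite big_nil.
  by rewrite big_cons -IH /= /letter /= valK; case: e.
rewrite /= theta_vec ?size_tuple //; apply: eq_bigr => i _.
by rewrite /alpha valK (tnth_nth 0%R).
Qed.

Lemma th_surj c : exists v : cgX Y, th (cval v) = c.
Proof.
have : @subgroup_gen (Algebra.to_multiplicative A) (range a) c by rewrite a_gen.
have sI : @subgroup (Algebra.to_multiplicative A) [set c | exists v : cgX Y, th (cval v) = c].
  split; first by exists cg1; rewrite cval1 th1.
  move=> _ _ [u <-] [v <-]; exists (cgM u (cgV v)).
  by rewrite cvalM cvalV thetaB.
move: c; apply: (subgroup_gen_min sI) => _ [i _ <-].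
exists (vec m (mkseq (fun j => (j == i)%:Z%R) m)); rewrite theta_vec ?size_mkseq //.
rewrite (bigD1 i) //= big1 => [|j ji].
  by rewrite nth_mkseq // eqxx mulr1z GRing.addr0 /alpha valK.
by rewrite nth_mkseq // -[_ == _]/(j == i) (negPf ji) mulr0z.
Qed.

Lemma ex_relators : exists R0 : seq (cgX Y), forall v, gen R0 v <-> th v = 0%R.
Proof.
apply: (noetherian_zpow (L := [set v | th v = 0%R])).
split; first exact: th1.
by move=> u v /= u0 v0; rewrite thetaB u0 v0 GRing.subr0.
Qed.

Definition relators : seq (cgX Y) := projT1 (cid ex_relators).

Lemma relatorsP v : gen relators v <-> th v = 0%R.
Proof. exact: (projT2 (cid ex_relators)). Qed.

Lemma th_eq u v : th u = th v <-> gen relators (u * v^-1).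
Proof.
rewrite relatorsP thetaB; split=> [->|/eqP]; first by rewrite GRing.subrr.
by rewrite GRing.subr_eq0 => /eqP.
Qed.

(** Generators of the preimage in F x Z^m of the subgroup generated by S. *)
Definition lifted (S : seq rawpres) : seq (cgX FY) :=
  [seq conv r | r <- S] ++ [seq ([::], y) | y <- relators].

Definition pres_subgroup (S : seq rawpres) : set (F \x_t A) :=
  subgroup_gen [set psi (cval (conv r)) | r in [set` S]].

Lemma gen_lifted S g : gen (lifted S) g <-> pres_subgroup S (psi g).
Proof.
have sD : subgroup (pres_subgroup S) by apply: subgroup_gen_subgroup.
rewrite gen_central; split=> [[l /relatorsP l0]|].
  have -> : psi g = psi (g.1, g.2 * l^-1) by rewrite /psi /= thetaB l0 GRing.subr0.
  move: (_, _); apply: (@gen_min FY) => [|_ /mapP[r rS ->]].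
    split; first by rewrite /= psi1; apply: subgroup1 sD.
    by move=> h k Dh Dk; rewrite /= psiB; apply: (proj2 sD).
  by apply: subset_subgroup_gen; exists r.
have : forall h, pres_subgroup S h -> exists g', @gen FY [seq conv r | r <- S] g' /\ psi g' = h.
  apply: subgroup_gen_min => [|_ [r rS <-]].
    have sG := @gen_subgroup FY [seq conv r | r <- S].
    split; first by exists 1; rewrite psi1; split=> //; apply: subgroup1 sG.
    move=> _ _ [h [Gh <-]] [k [Gk <-]]; exists (h * k^-1); rewrite psiB.
    by split=> //; apply: (proj2 sG).
  exists (cval (conv r)); split=> //; apply: (@mem_gen FY); exact: map_f.
move=> H /H[g' [Gg' [E1 E2]]]; exists (g'.2^-1 * g.2).
  rewrite -[X in _ * X]invgK -invgM; apply/relatorsP.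
  by rewrite -[(_ * _)^-1]mul1g thetaB th1 thM
    -[g.2^-1]mul1g thetaB th1 E2 !GRing.sub0r GRing.addNr GRing.oppr0.
rewrite invgM invgK mulVKg -E1; case: (g') Gg' => //.
Qed.

End Intersection.

Section IntersectionComputable.
Variables (n : nat) (F : groupType) (x : 'I_n -> F).
Hypotheses (x_inj : injective x) (x_basis : free_basis (range x) [set: F]).
Variable m : nat.

Notation Y := (zpow m).
Notation FY := (cg_prod (cg_word x_inj x_basis) Y).
Let comY : commutative_group (cgG Y) := @commutative_zpow m.
Let noY : noetherian Y := @noetherian_zpow m.
Let decY := dec_gen_zpow m.

Variables (X : codedType) (T1 T2 : X -> seq (cgX FY)).
Hypotheses (CT1 : computable T1) (CT2 : computable T2).

Definition inter (p : X) : set (F * cgG Y) := gen (T1 p) `&` gen (T2 p).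

Lemma inter_subgroup p : subgroup (inter p).
Proof.
split; first by split; apply: gen1.
move=> g h [g1 g2] [h1 h2]; split; exact: (proj2 (gen_subgroup _)).
Qed.

Lemma dec_gen_FY (Z : codedType) (T : Z -> seq (cgX FY)) (g : Z -> cgX FY) :
  computable T -> computable g -> dec (fun z => gen (T z) (cval (g z))).
Proof.
move=> CT Cg; have D := dec_gen_free_abelian x_inj x_basis comY noY decY.
by apply: (dec_comp D (f := fun z => (T z, g z))); apply: computable_pair.
Qed.

Lemma dec_inter (Z : codedType) (p : Z -> X) (g : Z -> cgX FY) :
  computable p -> computable g -> dec (fun z => inter (p z) (cval (g z))).
Proof.
move=> Cp Cg; apply: (dec_and (P := fun z => gen (T1 (p z)) (cval (g z)))).
  by apply: dec_gen_FY => //; comp.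
by apply: dec_gen_FY => //; comp.
Qed.

Lemma inter_abelian_part : exists2 L : X -> seq (cgX Y), computable L &
  forall p v, gen (L p) v <-> inter p (1, v).
Proof.
have [K CK KP] := abelian_part x_inj x_basis comY noY decY.
have [I CI IP] := zpow_intersection m.
exists (fun p => I (K (T1 p), K (T2 p))) => [|p v]; last by rewrite IP /= !KP.
by comp.
Qed.

(** An element w of F fails to lie in the projection of H1 /\ H2 either because
    it does not lie in that of H2, or because some (w, v) in H2 does not lie in
    the product of H1 with the abelian part of H2. *)
Lemma dec_inter_proj : dec (fun q : X * word =>
  [set g.1 | g in inter q.1] (wval x q.2)).
Proof.
have [K CK KP] := abelian_part x_inj x_basis comY noY decY.
have [E EP] := noY (L := setT) (conj I (fun _ _ _ _ => I)).
have surjY v : exists y : cgX Y, cval y = v.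
  by have /EP/genP[l [_ <-]] : [set: cgG Y] v by []; exists (sprod l).
apply: post.
  apply: (eq_semidec (P := fun q : X * word => exists y : cgX Y,
     inter q.1 (@cval FY (q.2, y)))).
    move=> [p w]; split=> [[y Hy]|[[g v] Hg /= gw]]; first by eexists; first exact: Hy.
    by have [y yv] := surjY v; exists y; rewrite /= /cgprod_val /= yv -gw.
  by semi; apply: dec_semidec; apply: dec_inter; comp.
pose TE p := T2 p ++ [seq (([::] : word), y) | y <- E].
pose TK p := T1 p ++ [seq (([::] : word), y) | y <- K (T2 p)].
apply: (eq_semidec (P := fun q : X * word =>
   ~ gen (TE q.1) (@cval FY (q.2, cg1)) \/
   exists y : cgX Y, gen (T2 q.1) (@cval FY (q.2, y)) /\
                     ~ gen (TK q.1) (@cval FY (q.2, y)))).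
  move=> [p w]; split=> /=.
    case=> [nTE [g [Hg1 Hg2] /= gw]|[y [T2y nTK]] [g [Hg1 Hg2] /= gw]].
      apply: nTE; apply/gen_central; exists g.2^-1; first exact/EP.
      by rewrite /= cval1 invgK mul1g -gw; case: (g) Hg2.
    apply: nTK; apply/gen_central; exists (g.2^-1 * cval y).
      apply/KP; have := subgroupM (gen_subgroup _) (subgroupV (gen_subgroup _) Hg2) T2y.
      by congr (@gen FY _ (_, _)); rewrite /= -gw mulVg.
    by rewrite /= invgM mulgA mulgV mul1g invgK -gw; case: (g) Hg1.
  move=> nH; have [TEw|] := pselect (gen (TE p) (@cval FY (w, cg1))); last by left.
  right; move/gen_central: TEw => [l _] /=; rewrite cval1 mul1g => T2l.
  have [y yl] := surjY l^-1; exists y.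
  rewrite /cgprod_val /= yl; split=> // /gen_central[k /KP T2k T1k].
  apply: nH; exists (wval x w, l^-1 * k^-1) => //; split=> //.
  have := proj2 (gen_subgroup _) _ _ T2l T2k; congr (@gen FY _ (_, _)).
  by rewrite /= invg1 mulg1.
semi.
- by apply: dec_semidec; apply: dec_not; apply: dec_gen_FY; rewrite /TE; comp.
- by apply: dec_semidec; apply: dec_not; apply: dec_gen_FY; rewrite /TK; comp.
Qed.

End IntersectionComputable.

Section SchreierComputable.
Variables (n : nat) (F : groupType) (x : 'I_n -> F).
Hypotheses (x_inj : injective x) (x_basis : free_basis (range x) [set: F]).
Variables (X : codedType) (K : X -> set F) (sK : forall p, subgroup (K p)).
Hypothesis decK : dec (fun q : X * word => K q.1 (wval x q.2)).

Notation FW := (cg_word x_inj x_basis).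

(** Least representatives are found by unbounded search, which ends at the given
    word at the latest. *)
Lemma computable_rep (Z : codedType) (p : Z -> X) (w : Z -> word) :
  computable p -> computable w ->
  computable (fun z => rep x_basis (sK (p z)) (wval x (w z))).
Proof.
move=> Cp Cw; apply: computable_decode.
apply: (computable_comp2 (f := fun p w => vtx x_basis (sK p) (wval x w))) => //.
apply: (least_computable (P := fun (q : X * word) (k : nat) =>
  K q.1 ((wval x (decode k))^-1 * wval x q.2))).
  apply: (eq_dec (P := fun q : X * word * nat =>
    K q.1.1 (wval x (@cgM FW (@cgV FW (decode q.2 : word)) q.1.2)))).
    by case=> -[p' w'] k /=; rewrite wval_cat wval_winv.
  apply: (dec_comp decK (f := fun q : X * word * nat =>
    (q.1.1, (@cgM FW (@cgV FW (decode q.2 : word)) q.1.2)))).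
  by comp.
by case=> p' w' /=; rewrite /vtx; case: ex_minnP => k /asboolP Kk k_min; split=> // j Kj;
   apply: k_min; apply/asboolP.
Qed.

Lemma dec_schreier_basis : dec (fun q : X * word =>
  schreier_basis x_basis (sK q.1) (wval x q.2)).
Proof.
pose sw (p : X) i (q : word) : word :=
  @cgM FW (@cgV FW (rep x_basis (sK p) (wval x ((i, 0) :: q))))
     ((i, 0) :: rep x_basis (sK p) (wval x q)).
apply: (eq_dec (P := fun q : X * word => @cval FW q.2 <> @cval FW [::] /\
  exists v l t, q.2 = v ++ l :: t /\
    (l.2 = 0 /\ @cval FW q.2 = @cval FW (sw q.1 l.1 t)))).
  have swE p i q : wval x (sw p i q) = schreier_gen x_basis (sK p) i (wval x q).
    exact: (wval_schreier_word x_basis (sK p)).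
  move=> [p w]; rewrite (schreier_basisP x_inj).
  split=> -[w1 [v [l [t [Ew [l2 E]]]]]]; split=> //; exists v, l, t; do 2 split=> //.
    by rewrite -swE.
  exact: eq_trans E (esym (swE _ _ _)).
apply: dec_and; first by apply: dec_not; apply: (dec_cval (Y := FW)); comp.
apply: (dec_ex_tail (P := fun (q : X * word) l t =>
   l.2 = 0 /\ @cval FW q.2 = @cval FW (sw q.1 l.1 t))); last by comp.
apply: dec_and; first by comp.
apply: (dec_cval (Y := FW)); first by comp.
rewrite /sw; apply: (computable_cgM (Y := FW)).
  apply: (computable_cgV (Y := FW)); apply: computable_rep; comp.
by comp; apply: computable_rep; comp.
Qed.

End SchreierComputable.

Lemma dec_prime (X : codedType) (q : X -> nat) :
  computable q -> dec (fun p => prime (q p)).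
Proof.
apply: (dec_comp (P := fun q => prime q)).
apply: (eq_dec (P := fun q => (1 < q)%N /\
   ~ exists2 d, (d < q)%N & exists2 e, (e < q)%N & iter d (addn e) 0%N = q)).
  move=> k; split=> [[k1 nk]|pk].
    apply/primeP; split=> // d dk /=; have [e Ek] := dvdnP dk.
    have [//|d1] := eqVneq d 1%N; have [//|dk'] := eqVneq d k.
    have lt_d : (d < k)%N by rewrite ltn_neqAle dk' dvdn_leq // ltnW.
    exfalso; apply: nk; exists d => //; exists e; first by nia.
    by rewrite iter_addn_0 Ek.
  split; first exact: prime_gt1.
  case=> d lt_d [e lt_e]; rewrite iter_addn_0 => Ek.
  case/primeP: pk => _ /(_ d); rewrite -Ek dvdn_mull // => /(_ isT)/orP[]/eqP; nia.
apply: dec_and; first by comp.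
apply: dec_not; apply: (dec_ex_lt (P := fun k d =>
  exists2 e, (e < k)%N & iter d (addn e) 0%N = k)).
  by apply: (dec_ex_lt (P := fun q e => iter q.2 (addn e) 0%N = q.1)); comp.
by comp.
Qed.

Section Bases.
Variables (m : nat) (A : zmodType) (a : 'I_m -> A).
Hypothesis a_gen : @subgroup_gen (Algebra.to_multiplicative A) (range a) = setT.

Notation Y := (zpow m).
Notation th := (@theta A m (alpha a)).
Notation thv := (fun z : cgX Y => th (cval z)).
Notation relators := (relators a).
Let comY : commutative_group (cgG Y) := @commutative_zpow m.

Lemma gen_relators b v : gen (b ++ relators) v <-> zspan [seq thv z | z <- b] (th v).
Proof.
rewrite gen_cat //; split=> [[s [t [bs /relatorsP t0 ->]]]|].
  rewrite thM t0 GRing.addr0; move: s bs; apply: gen_min => [|z zb].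
    split; first by rewrite /= th1; apply: zspan0.
    by move=> u w Su Sw; rewrite /= thetaB; apply: zspanB.
  by apply: zspan_mem; apply: map_f.
have H y : zspan [seq thv z | z <- b] y -> exists2 s, gen b s & th s = y.
  move: y; apply: zspan_ind => [|_ _ [s bs <-] [t bt <-]|_ /mapP[z zb ->]].
  - by exists 1; [apply: gen1 | apply: th1].
  - by exists (s * t^-1); [apply: (proj2 (gen_subgroup b)) | rewrite thetaB].
  - by exists (cval z); first exact: mem_gen.
case/H=> s bs E; exists s, (s^-1 * v); split=> //; last by rewrite mulVKg.
by rewrite comY; apply/th_eq.
Qed.

Definition cgpow (q : nat) (z : cgX Y) : cgX Y := iter q (cgM z) cg1.

Lemma thv_cgpow q z : thv (cgpow q z) = (thv z *+ q)%R.
Proof.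
elim: q => [|q IH]; first by rewrite /= cval1 th1.
by rewrite /= cvalM thM -/(cgpow q z) IH GRing.mulrS.
Qed.

Lemma dec_gen_relators (X : codedType) (b : X -> seq (cgX Y)) (y : X -> cgX Y) :
  computable b -> computable y -> dec (fun p => gen (b p ++ relators) (cval (y p))).
Proof.
move=> Cb Cy; apply: (dec_comp (dec_gen_zpow m) (f := fun p => (b p ++ relators, y p))).
by comp.
Qed.

(** A list with the same span and a prime modulo which it is independent are
    searched for. *)
Lemma computable_abelian_basis (X : codedType) (L : X -> seq (cgX Y)) : computable L ->
  exists2 b : X -> seq (cgX Y), computable b &
    forall p, abelian_basis [seq thv z | z <- b p] (zspan [seq thv z | z <- L p]).
Proof.
move=> CL; pose P (p : X) (c : seq (cgX Y) * nat) :=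
  prime c.2 /\ ((forall y, y \in c.1 -> gen (L p ++ relators) (cval y)) /\
  ((forall y, y \in L p -> gen (c.1 ++ relators) (cval y)) /\
  forall u y t, c.1 = u ++ y :: t ->
    ~ gen ((t ++ [seq cgpow c.2 z | z <- c.1]) ++ relators) (cval y))).
have [|p|f Cf fP] := @uniformize _ _ P.
- apply: dec_semidec; rewrite /P; apply: dec_and; first by apply: dec_prime; comp.
  apply: dec_and; first by apply: dec_all; [apply: dec_gen_relators|]; comp.
  apply: dec_and; first by apply: dec_all; [apply: dec_gen_relators|]; comp.
  apply: (dec_tail (P := fun (q : X * (seq (cgX Y) * nat)) y t =>
    ~ gen ((t ++ [seq cgpow q.2.2 z | z <- q.2.1]) ++ relators) (cval y))); last by comp.
  apply: dec_not; apply: dec_gen_relators; last by comp.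
  by rewrite /cgpow; comp.
- have [q [bA [pq bAL /(divisible_independent_mod pq) ind]]] :=
    divisible_exists (erefl (zspan [seq thv z | z <- L p])).
  have [b Eb] : exists b : seq (cgX Y), [seq thv z | z <- b] = bA.
    elim: (bA) => [|c s [b <-]]; first by exists [::].
    by have [z <-] := th_surj a_gen c; exists (z :: b).
  exists (b, q); split=> //=; do ![split].
  + by move=> y yb; apply/gen_relators; rewrite -bAL -Eb; apply: zspan_mem; apply: map_f.
  + by move=> y yL; apply/gen_relators; rewrite Eb bAL; apply: zspan_mem; apply: map_f.
  move=> u y t Ebu /gen_relators; rewrite map_cat -map_comp.
  rewrite (eq_map (thv_cgpow q)) (map_comp (fun z => z *+ q)%R) Eb.
  by apply: (ind [seq thv z | z <- u]); rewrite -Eb Ebu map_cat.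
exists (fun p => (f p).1); first by comp.
move=> p; have [pq [bL [Lb ind]]] := fP p; set b := (f p).1 in bL Lb ind *.
have zspanE : zspan [seq thv z | z <- b] = zspan [seq thv z | z <- L p].
  by apply/seteqP; split; apply: zspan_min => _ /mapP[z zb ->]; apply/gen_relators;
     [apply: bL | apply: Lb].
split; first by [].
move=> c cL; apply: (divisible_minimal (p := (f p).2)) => //.
- apply: independent_mod_divisible => // u y t Eb.
  have [u' [y' [t' [Eb' [Ey Et]]]]] : exists u' y' t', b = u' ++ y' :: t' /\
      (thv y' = y /\ [seq thv z | z <- t'] = t).
    elim: (b) u Eb => [|z s IH] [|w u] //= [Ez Es]; first by exists [::], z, s.
    by have [u' [y' [t' [-> E]]]] := IH u Es; exists (z :: u'), y', t'.
  move=> S; apply: (ind u' y' t' Eb'); apply/gen_relators.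
  rewrite map_cat -map_comp (eq_map (thv_cgpow (f p).2)) (map_comp (fun z => z *+ (f p).2)%R).
  by rewrite Ey Et.
- by move=> y yb; rewrite /zspan cL -zspanE; apply: zspan_mem.
- by move=> y yc; rewrite zspanE -cL; apply: subset_subgroup_gen.
Qed.

End Bases.

(** * Programs with a parameter *)

Lemma computable_const_prog : computable (fun c => prog_code (const_prog c)).
Proof.
apply: (eq_computable (f := fun c : nat =>
  iter c (fun r => code (5%N, (prog_code PSucc, r))) (prog_code PZero))).
  by elim=> //= c ->.
by comp.
Qed.

(** The s-m-n theorem, for one decision procedure with a parameter. *)
Lemma parametrize (X Y : codedType) (P : X -> Y -> Prop) :
  dec (fun q : X * Y => P q.1 q.2) ->
  exists C, forall p, exists D, evals C (code p) (prog_code D) /\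
    forall y, evals D (code y) (`[< P p y >] : nat).
Proof.
move=> [E HE]; pose D p := PComp E (PPair (const_prog p) id_prog).
have [C HC] : computable (fun p : nat => prog_code (D p)).
  apply: (eq_computable (f := fun p : nat => code (5%N, (prog_code E,
     code (4%N, (prog_code (const_prog p), prog_code id_prog)))))); first by [].
  by have CC := computable_const_prog; comp.
exists C => p; exists (D (code p)); split; first exact: HC.
move=> y; apply: ev_comp (HE (p, y)).
exact: ev_pair (evals_const _ _) (evals_id _).
Qed.

(** * The basis of the intersection *)

Section Basis.
Variables (n : nat) (F : groupType) (x : 'I_n -> F).
Hypotheses (x_inj : injective x) (x_basis : free_basis (range x) [set: F]).
Variables (m : nat) (A : zmodType) (a : 'I_m -> A).
Hypothesis a_gen : @subgroup_gen (Algebra.to_multiplicative A) (range a) = setT.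

Notation Y := (zpow m).
Notation FY := (cg_prod (cg_word x_inj x_basis) Y).
Notation th := (@theta A m (alpha a)).
Notation thv := (fun z : cgX Y => th (cval z)).
Notation rawlists := (seq rawpres * seq rawpres)%type.
Notation psi := (psi (x_inj := x_inj) (x_basis := x_basis) (m := m) a).
Notation conv := (conv x_inj x_basis m).
Notation pres_subgroup := (pres_subgroup x_inj x_basis a).

Let T1 (p : rawlists) := lifted x_inj x_basis a p.1.
Let T2 (p : rawlists) := lifted x_inj x_basis a p.2.

Let computable_conv : computable (conv : rawpres -> cgX FY).
Proof. by apply: computable_pair; [comp | apply: computable_vec; comp]. Qed.

Let computable_lifted : computable (lifted x_inj x_basis a).
Proof.
apply: computable_cat; last by comp.
by apply: computable_map; last exact: computable_id; have C := computable_conv; comp.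
Qed.

Let CT1 : computable T1.
Proof. by have C := computable_lifted; rewrite /T1; comp. Qed.
Let CT2 : computable T2.
Proof. by have C := computable_lifted; rewrite /T2; comp. Qed.

Notation interH := (inter T1 T2).

Lemma interE p g : interH p g <-> (pres_subgroup p.1 `&` pres_subgroup p.2) (psi g).
Proof. by rewrite /inter /setI /= !gen_lifted. Qed.

Definition proj (p : rawlists) : set F := [set g.1 | g in interH p].

Lemma proj_sub p : subgroup (proj p).
Proof. exact/subgroup_image/inter_subgroup. Qed.

Let dec_proj : dec (fun q : rawlists * word => proj q.1 (wval x q.2)).
Proof. exact: dec_inter_proj CT1 CT2. Qed.

Lemma trivial_subgroup : subgroup [set g : F | g = 1].
Proof. by split=> // g h /= -> ->; rewrite mulgV. Qed.

(** Cosets of the trivial subgroup are elements, so their least representatives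
    are normal forms. *)
Definition normal_word (g : F) : word := rep x_basis trivial_subgroup g.

Lemma wval_normal_word g : wval x (normal_word g) = g.
Proof. by have /mulg1_eq := rep_coset x_basis trivial_subgroup g; rewrite invgK. Qed.

Lemma computable_normal_word (Z : codedType) (w : Z -> word) : computable w ->
  computable (fun z => normal_word (wval x (w z))).
Proof.
move=> Cw; apply: (@computable_rep n F x x_inj x_basis nat (fun=> [set g : F | g = 1])
   (fun=> trivial_subgroup) _ Z (fun=> 0%N) w) => //; last by comp.
by apply: (dec_cval (Y := cg_word x_inj x_basis) (g := fun=> [::])); comp.
Qed.

(** The lift of a basis element is computed from its least word, so that it does
    not depend on the word by which the element is presented. *)
Lemma basis_exists : exists (B : rawlists -> set (F \x_t A)),
  (forall p, is_basis (pres_subgroup p.1 `&` pres_subgroup p.2) (B p)) /\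
  dec (fun q : rawlists * rawpres => B q.1 (psi (cval (conv q.2)))).
Proof.
have [L CL LP] := inter_abelian_part CT1 CT2.
have [b Cb bP] := computable_abelian_basis a_gen CL.
pose P (q : rawlists * word) (y : cgX Y) :=
  interH q.1 (@cval FY (q.2, y)) \/ ~ proj q.1 (wval x q.2).
have [|[p w]|alw Calw alwP] := @uniformize _ _ P.
- apply: dec_semidec; apply: dec_or.
    by apply: (dec_inter CT1 CT2 (p := fun z : rawlists * word * cgX Y => z.1.1)
              (g := fun z => (z.1.2, z.2))); comp.
  by apply: dec_not; apply: (dec_comp dec_proj); comp.
- have [[[g v] Hg /= gw]|nw] := pselect (proj p (wval x w)); last by exists cg1; right.
  have [E EP] := noetherian_zpow (L := [set: cgG Y]) (conj I (fun _ _ _ _ => I)).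
  have /EP/genP[l [_ El]] : [set: cgG Y] v by [].
  by exists (sprod l); left; rewrite /= /cgprod_val /= El -gw.
pose al p u := thv (alw (p, normal_word u)).
pose U p := schreier_basis x_basis (proj_sub p).
pose B p : set (F \x_t A) := [set ((u, al p u) : F \x_t A) | u in U p] `|`
            [set ((1, c) : F \x_t A) | c in [set` [seq thv z | z <- b p]]].
exists B; split=> [p|]; last first.
  apply: (eq_dec (P := fun q : rawlists * rawpres =>
    (U q.1 (wval x q.2.1) /\
     gen (relators a)
       (cval (cgM (vec m q.2.2) (cgV (alw (q.1, normal_word (wval x q.2.1))))))) \/
    (wval x q.2.1 = wval x [::] /\
     exists2 z, z \in b q.1 & gen (relators a) (cval (cgM (vec m q.2.2) (cgV z)))))).
    move=> [p [w s]] /=; rewrite /B; split.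
      case=> [[Uw]|[w1 [z zb]]]; rewrite cvalM cvalV => /th_eq E.
        by left; exists (wval x w) => //; congr (_, _).
      right; exists (thv z); first by apply: map_f.
      by rewrite /psi /= w1 E.
    case=> [[u Uu] [uw E]|[c /mapP[z zb ->] [w1 E]]].
      left; rewrite -uw; split=> //; rewrite cvalM cvalV; apply/th_eq.
      by rewrite -E.
    right; rewrite -w1; split=> //; exists z => //.
    by rewrite cvalM cvalV; apply/th_eq; rewrite -E.
  apply: dec_or; apply: dec_and.
  - have DU := dec_schreier_basis x_inj x_basis proj_sub dec_proj.
    by apply: (dec_comp DU (f := fun q : rawlists * rawpres => (q.1, q.2.1))); comp.
  - apply: (dec_comp (dec_gen_zpow m) (f := fun q : rawlists * rawpres => (relators a,
      cgM (vec m q.2.2) (cgV (alw (q.1, normal_word (wval x q.2.1))))))).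
    comp; [apply: computable_vec | apply: computable_normal_word]; comp.
  - by apply: (dec_cval (Y := cg_word x_inj x_basis) (g := fun=> [::])); comp.
  - apply: (dec_ex_in (P := fun (q : rawlists * rawpres) z =>
       gen (relators a) (cval (cgM (vec m q.2.2) (cgV z))))); last by comp.
    apply: (dec_comp (dec_gen_zpow m) (f := fun q : rawlists * rawpres * cgX Y =>
      (relators a, cgM (vec m q.1.2.2) (cgV q.2)))).
    by comp; apply: computable_vec; comp.
set H := pres_subgroup p.1 `&` pres_subgroup p.2.
have HE g : interH p g <-> H (psi g) by apply: interE.
have liftA c : exists v, th v = c by have [y yc] := th_surj a_gen c; exists (cval y).
have projE : [set g.1 | g in H] = proj p.
  apply/seteqP; split=> g.
    case=> -[u c] Huc /= <-; have [v Ev] := liftA c.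
    by exists (u, v) => //; apply/HE; rewrite /psi /= Ev.
  by case=> -[u v] /HE Huv /= <-; eexists; first exact: Huv.
have absE : [set c : A | H (1, c)] = zspan [seq thv z | z <- L p].
  have sL : subgroup [set v | interH p (1, v)].
    have sI := inter_subgroup T1 T2 p; split; first exact: subgroup1 sI.
    by move=> u v Iu Iv; have := proj2 sI _ _ Iu Iv; congr (interH p (_, _)); rewrite /= mulgV.
  apply/seteqP; split=> c.
    have [v <-] := liftA c => H1v; apply/gen_relators/gen_cat; first exact: commutative_zpow.
    exists v, 1; rewrite mulg1; split=> //; last exact: gen1.
    by apply/LP/HE.
  have [v <-] := liftA c; case/gen_relators/gen_cat; first exact: commutative_zpow.
  move=> s [t [/LP/HE Hs /relatorsP t0 ->]].
  by move: Hs; rewrite /psi /= thM t0 GRing.addr0.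
have sH : subgroup H.
  have s1 := subgroup_gen_subgroup [set psi (cval (conv r)) | r in [set` p.1]].
  have s2 := subgroup_gen_subgroup [set psi (cval (conv r)) | r in [set` p.2]].
  split; first by split; apply: subgroup1.
  by move=> g h [g1 g2] [h1 h2]; split; [apply: (proj2 s1) | apply: (proj2 s2)].
have [UK Ufree] : free_basis (U p) (proj p) by apply: schreier_free_basis.
have [bL bmin] := bP p; rewrite -absE in bL bmin.
have BH g : B p g -> H g.
  case=> [[u Uu <-]|[c cb <-]].
    have Ku : proj p u by rewrite -UK; apply: subset_subgroup_gen.
    have : interH p (wval x (normal_word u), cval (alw (p, normal_word u))) \/
           ~ proj p (wval x (normal_word u)) by apply: (alwP (p, normal_word u)).
    by rewrite wval_normal_word => -[/HE|].
  have : [set c : A | H (1, c)] c by rewrite -bL; apply: subset_subgroup_gen.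
  by [].
exists (U p), (al p), [seq thv z | z <- b p]; split=> //; first by rewrite projE.
have sB := subgroup_gen_subgroup (B p).
apply/seteqP; split=> [g|[u c] Huc]; first exact: subgroup_gen_min.
have [c' Bc'] : exists c', subgroup_gen (B p) (u, c').
  have : subgroup_gen (U p) u by rewrite UK -projE; eexists; first exact: Huc.
  move: u {Huc}; apply: subgroup_gen_min => [|u Uu].
    split; first by exists 1; apply: subgroup1 sB.
    by move=> g h [c1 B1] [c2 B2]; exists (c1 * c2^-1); apply: (proj2 sB _ _ B1 B2).
  by exists (al p u); apply: subset_subgroup_gen; left; exists u.
have Hc' : H (u, c') by move: Bc'; apply: subgroup_gen_min.
have : [set c : A | H (1, c)] (c'^-1 * c : Algebra.to_multiplicative A).
  have := subgroupM sH (subgroupV sH Hc') Huc; congr (H (_, _)).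
  by rewrite /= mulVg.
rewrite -bL => Bd.
have B1 : forall d, @subgroup_gen (Algebra.to_multiplicative A)
    [set` [seq thv z | z <- b p]] d -> subgroup_gen (B p) (1, d).
  apply: subgroup_gen_min => [|d db]; last by apply: subset_subgroup_gen; right; exists d.
  split; first exact: subgroup1 sB.
  move=> d e Bd' Be'; have := proj2 sB _ _ Bd' Be'; congr (subgroup_gen _ (_, _)).
  by rewrite /= mulgV.
have := subgroupM sB Bc' (B1 _ Bd); congr (subgroup_gen _ (_, _)).
  by rewrite /= mulg1.
by rewrite /= mulVKg.
Qed.

End Basis.

Theorem corollary4p27
  (n : nat) (F : groupType) (x : 'I_n -> F)
  (x_inj : injective x) (x_basis : free_basis (range x) [set: F])
  (m : nat) (A : zmodType) (a : 'I_m -> A)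
  (a_gen : @subgroup_gen (Algebra.to_multiplicative A) (range a) = setT) :
  exists C : prog,
    forall S1 S2 : seq (presentation n m),
      let H1 := subgroup_gen [set elem x a r | r in [set` S1]] in
      let H2 := subgroup_gen [set elem x a r | r in [set` S2]] in
      exists (D : prog) (B : set (F \x_t A)),
        [/\ evals C (cpair (seq_code (@pres_code n m) S1)
                           (seq_code (@pres_code n m) S2))
                    (prog_code D),
            is_basis (H1 `&` H2) B
          & decides x a D B].
Proof.
have [B [B_basis B_dec]] := basis_exists x_inj x_basis a_gen.
have [C HC] := parametrize
  (P := fun p r => B p (psi a (cval (conv x_inj x_basis m r)))) B_dec.
exists C => S1 S2 H1 H2; pose p := ([seq raw r | r <- S1], [seq raw r | r <- S2]).
have [D [CD HD]] := HC p; exists D, (B p); split.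
- by rewrite !(seq_code_map _ (@code_raw n m)) -code_pair.
- have downE (S : seq (presentation n m)) :
      subgroup_gen [set elem x a r | r in [set` S]] =
      pres_subgroup x_inj x_basis a [seq raw r | r <- S].
    congr subgroup_gen; apply/seteqP; split=> g.
      by case=> r rS <-; exists (raw r); [apply: map_f | apply: psi_conv].
    by case=> _ /mapP[r rS ->] <-; exists r => //; rewrite psi_conv.
  rewrite /H1 /H2 !downE; exact: (B_basis p).
move=> r; have := HD (raw r); rewrite -code_raw psi_conv.
by case: asboolP => // Br; split.
Qed.
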